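(* Let $q\ge1$, $d=2^q$. The space $\mathcal M_d^{\otimes2}$ is the direct sum of the following subspaces, each of which carries an irreducible subrepresentation of the two-copy representation $\varphi^{\otimes2}$ of the Clifford group $\mathcal C_q$: for $q=1$: $V_{\mathrm{id}}\oplus V_{\mathrm r}\oplus V_{\mathrm l}\oplus V_0\oplus V_1\oplus V_{\{\mathrm S\}}\oplus V_{\{\mathrm A\}}$; for $q=2$: $V_{\mathrm{id}}\oplus V_{\mathrm r}\oplus V_{\mathrm l}\oplus V_0\oplus V_1\oplus V_2\oplus V_{[\mathrm{adj}]}\oplus V_{[1]}\oplus V_{\{\mathrm{adj}\}}\oplus V_{\{1\}}\oplus V_{\{2\}}\oplus V_{[\mathrm A]}\oplus V^\perp_{\{\mathrm{adj}\}}$; for $q\ge3$: $V_{\mathrm{id}}\oplus V_{\mathrm r}\oplus V_{\mathrm l}\oplus V_0\oplus V_1\oplus V_2\oplus V_{[\mathrm{adj}]}\oplus V_{[1]}\oplus V_{[2]}\oplus V_{\{\mathrm{adj}\}}\oplus V_{\{1\}}\oplus V_{\{2\}}\oplus V_{[\mathrm A]}\oplus V^\perp_{\{\mathrm{adj}\}}$.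
   Context: $\mathcal{M}_d$ is the space of complex $d\times d$ matrices with inner product $\langle A,B\rangle=\mathrm{tr}(A^\dagger B)$. $X,Y,Z$ are the single-qubit Pauli matrices; $\hat{\mathcal{P}}_q$ is the set of $q$-fold tensor products of elements of $\{\mathbb{1},X,Y,Z\}$. Set $\sigma_0=\mathbb 1/\sqrt d$, $\boldsymbol{\sigma}_q=\{P/\sqrt d:P\in\hat{\mathcal P}_q\setminus\{\mathbb 1\}\}$. Normalized product: $\sigma\cdot\tau=\sqrt d\,\sigma\tau$ (for commuting $\sigma\ne\tau$ in $\boldsymbol\sigma_q$ it is $\pm$ an element of $\boldsymbol\sigma_q$; for anticommuting ones $i\sigma\cdot\tau$ is). For $\tau\in\boldsymbol{\sigma}_q$: $\boldsymbol{N}_\tau=\{\sigma\in\boldsymbol{\sigma}_q:\sigma\tau+\tau\sigma=0\}$, $\boldsymbol{C}_\tau=\{\sigma\in\boldsymbol{\sigma}_q\setminus\{\tau\}:\sigma\tau=\tau\sigma\}$. $S_{\sigma,\rho}=\frac1{\sqrt2}(\sigma\otimes\rho+\rho\otimes\sigma)$, $A_{\sigma,\rho}=\frac1{\sqrt2}(\sigma\otimes\rho-\rho\otimes\sigma)$, bilinear in $(\sigma,\rho)$. Spaces: $V_{\mathrm{id}}=\mathrm{span}\{\sigma_0\otimes\sigma_0\}$; $V_{\mathrm r}=\mathrm{span}\{\sigma_0\otimes\tau:\tau\in\boldsymbol\sigma_q\}$; $V_{\mathrm l}=\mathrm{span}\{\tau\otimes\sigma_0:\tau\in\boldsymbol\sigma_q\}$;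 $V_{[\mathrm A]}=\mathrm{span}\{A_{\sigma,\tau}:\tau\in\boldsymbol\sigma_q,\sigma\in\boldsymbol C_\tau\}$; $V_{\{\mathrm A\}}=\mathrm{span}\{A_{\sigma,\tau}:\sigma\in\boldsymbol N_\tau\}$; $V_{\{\mathrm S\}}=\mathrm{span}\{S_{\sigma,\tau}:\sigma\in\boldsymbol N_\tau\}$; $V_0=\mathrm{span}\{\sum_{\sigma\in\boldsymbol\sigma_q}\sigma\otimes\sigma\}$; $V_1$ (resp. $V_2$) $=\{\sum_{\sigma\in\boldsymbol\sigma_q}\lambda_\sigma\sigma\otimes\sigma:\sum_\sigma\lambda_\sigma=0,\ \sum_{\sigma\in\boldsymbol N_\tau}\lambda_\sigma=-\frac d2\lambda_\tau$ (resp. $+\frac d2\lambda_\tau$) $\forall\tau\}$; $V_{[\mathrm{adj}]}=\mathrm{span}\{\sum_{\sigma\in\boldsymbol C_\tau}S_{\sigma,\sigma\cdot\tau}:\tau\in\boldsymbol\sigma_q\}$; $V_{\{\mathrm{adj}\}}=\mathrm{span}\{\sum_{\sigma\in\boldsymbol N_\tau}A_{\sigma,i\sigma\cdot\tau}:\tau\in\boldsymbol\sigma_q\}$; $V^\perp_{\{\mathrm{adj}\}}$ is the orthogonal complement of $V_{\{\mathrm{adj}\}}$ in $V_{\{\mathrm A\}}$. For $\tau\in\boldsymbol\sigma_q$: $V^\tau_{[\mathrm S]}=\mathrm{span}\{S_{\sigma,\sigma\cdot\tau}:\sigma\in\boldsymbol C_\tau\}$ with the well-defined linear map $T_\tau(S_{\sigma,\sigma\cdot\tau})=\frac12\sum_{\rho\in\boldsymbol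 C_\tau\cap\boldsymbol N_\sigma}S_{\rho,\rho\cdot\tau}$, and $V_{[1]}=\bigoplus_\tau\ker(T_\tau+\frac d4)$, $V_{[2]}=\bigoplus_\tau\ker(T_\tau-\frac d4)$; $V^\tau_{\{\mathrm S\}}=\mathrm{span}\{S_{\sigma,i\sigma\cdot\tau}:\sigma\in\boldsymbol N_\tau\}$ with the well-defined linear map $\mathcal A_\tau(S_{\sigma,i\sigma\cdot\tau})=\sum_{\rho\in\boldsymbol N_\tau,\rho\sigma=\sigma\rho}S_{\rho,i\rho\cdot\tau}-\sum_{\rho\in\boldsymbol N_\tau\cap\boldsymbol N_\sigma}S_{\rho,i\rho\cdot\tau}$ (first sum includes $\rho=\sigma$), and $V_{\{1\}}=\bigoplus_\tau\ker(\mathcal A_\tau-d)$, $V_{\{2\}}=\bigoplus_\tau\ker(\mathcal A_\tau+d)$. The Pauli group $\mathcal{P}_q\subset U(2^q)$ consists of all $q$-fold tensor products of elements of the group generated by $X,Z,i\mathbb 1_2$; the Clifford group is $\mathcal{C}_q=\{U\in U(2^q):U\mathcal{P}_qU^\dagger\subseteq\mathcal{P}_q\}/U(1)$. The two-copy representation on $\mathcal{M}_d^{\otimes2}$ is $\varphi^{\otimes2}(C)(A\otimes B)=(CAC^\dagger)\otimes(CBC^\dagger)$, extended linearly. *)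

(* Defs.v *)
From HB Require Import structures.
From mathcomp Require Import all_boot all_order all_algebra.
From mathcomp Require Import reals.
From mathcomp Require Import complex mxtens.
Set Implicit Arguments. Unset Strict Implicit. Unset Printing Implicit Defensive.
Import Order.TTheory GRing.Theory Num.Theory.
Local Open Scope ring_scope.

Section Clifford.
Variable R : realType.
Variable q : nat.

Definition Cx := R[i].
Definition dim := (2 ^ q)%N.
Definition Md := 'M[Cx]_dim.
Definition M2 := 'M[Cx]_(dim * dim).         (* M_d (x) M_d, via Kronecker product *)

Definition csqrt (n : nat) : Cx := (Num.sqrt (n%:R : R))%:C%C.
Definition ci : Cx := 'i%C.

Definition adj m n (A : 'M[Cx]_(m, n)) : 'M[Cx]_(n, m) := (map_mx (@conjc R) A)^T.
Definition hs (A B : M2) : Cx := \tr (adj A *m B).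
Definition tens (A B : Md) : M2 := tensmx A B.

(* single-qubit Paulis: 0 = 1, 1 = X, 2 = Y, 3 = Z ; entries indexed by bits *)
Definition pauli1 (a : 'I_4) : 'M[Cx]_2 :=
  \matrix_(x < 2, y < 2)
   match val a with
   | 0 => if x == y then 1 else 0
   | 1 => if x == y then 0 else 1
   | 2 => if x == y then 0 else (if val x == 0%N then - ci else ci)
   | _ => if x == y then (if val x == 0%N then 1 else -1) else 0
   end.

(* Pauli strings: q-fold tensor products of elements of {1,X,Y,Z};
   qubit k of the basis index i : 'I_(2^q) is bit k of i *)
Definition pstr := {ffun 'I_q -> 'I_4}.
Definition pid : pstr := [ffun => ord0].
Definition bitk (i : 'I_dim) (k : 'I_q) : 'I_2 := inord (odd (i %/ 2 ^ k)).
Definition pauli_str (p : pstr) : Md :=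
  \matrix_(i, j) \prod_(k < q) pauli1 (p k) (bitk i k) (bitk j k).

Definition sigma0 : Md := (csqrt dim)^-1 *: 1%:M.
Definition sig (p : pstr) : Md := (csqrt dim)^-1 *: pauli_str p.
Definition nid (p : pstr) : bool := p != pid.
Definition dotn (A B : Md) : Md := csqrt dim *: (A *m B).

Definition commb (s t : pstr) : bool := sig s *m sig t == sig t *m sig s.
Definition antib (s t : pstr) : bool := sig s *m sig t + sig t *m sig s == 0.
Definition inN (t s : pstr) : bool := nid s && antib s t.
Definition inC (t s : pstr) : bool := [&& nid s, s != t & commb s t].

Definition Ssym (A B : Md) : M2 := (csqrt 2)^-1 *: (tens A B + tens B A).
Definition Aasym (A B : Md) : M2 := (csqrt 2)^-1 *: (tens A B - tens B A).

Definition space := M2 -> Prop.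

Definition spanF (I : finType) (P : pred I) (f : I -> M2) : space :=
  fun x => exists c : I -> Cx, x = \sum_(i | P i) c i *: f i.

Definition V_id : space := spanF (fun _ : unit => true) (fun _ => tens sigma0 sigma0).
Definition V_r : space := spanF nid (fun t => tens sigma0 (sig t)).
Definition V_l : space := spanF nid (fun t => tens (sig t) sigma0).
Definition V_brA : space :=
  spanF (fun st : pstr * pstr => nid st.2 && inC st.2 st.1)
        (fun st => Aasym (sig st.1) (sig st.2)).
Definition V_cbA : space :=
  spanF (fun st : pstr * pstr => nid st.2 && inN st.2 st.1)
        (fun st => Aasym (sig st.1) (sig st.2)).
Definition V_cbS : space :=
  spanF (fun st : pstr * pstr => nid st.2 && inN st.2 st.1)
        (fun st => Ssym (sig st.1) (sig st.2)).
Definition V_0 : space :=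
  spanF (fun _ : unit => true) (fun _ => \sum_(s | nid s) tens (sig s) (sig s)).

Definition V_eps (eps : Cx) : space := fun x =>
  exists lam : pstr -> Cx,
    x = \sum_(s | nid s) lam s *: tens (sig s) (sig s)
    /\ \sum_(s | nid s) lam s = 0
    /\ forall t, nid t ->
         \sum_(s | inN t s) lam s = eps * ((dim%:R : Cx) / 2%:R) * lam t.
Definition V_1 : space := V_eps (-1).
Definition V_2 : space := V_eps 1.

Definition V_bradj : space :=
  spanF nid (fun t => \sum_(s | inC t s) Ssym (sig s) (dotn (sig s) (sig t))).
Definition V_cbadj : space :=
  spanF nid (fun t => \sum_(s | inN t s) Aasym (sig s) (ci *: dotn (sig s) (sig t))).
Definition V_cbadj_perp : space :=
  fun x => V_cbA x /\ forall y, V_cbadj y -> hs y x = 0.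

(* V^t_[S]: generators gS t s = S_{s, s.t} (s in C_t), and the map T_t on them *)
Definition gS (t s : pstr) : M2 := Ssym (sig s) (dotn (sig s) (sig t)).
Definition T_gen (t s : pstr) : M2 :=
  2%:R^-1 *: \sum_(r | inC t r && inN s r) gS t r.
(* V^t_{S}: generators gA t s = S_{s, i s.t} (s in N_t), and the map A_t *)
Definition gA (t s : pstr) : M2 := Ssym (sig s) (ci *: dotn (sig s) (sig t)).
Definition A_gen (t s : pstr) : M2 :=
  \sum_(r | inN t r && commb r s) gA t r - \sum_(r | inN t r && inN s r) gA t r.

(* eigenspace ker(L - lam) of the (well-defined) linear map L on
   span{g s | P s} determined by its values Lg s on the generators *)
Definition eigsp (P : pred pstr) (g Lg : pstr -> M2) (lam : Cx) : space :=
  fun x => exists c : pstr -> Cx,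
    x = \sum_(s | P s) c s *: g s /\ \sum_(s | P s) c s *: Lg s = lam *: x.

Definition sumsp (W : pstr -> space) : space :=
  fun x => exists v : pstr -> M2, (forall t, nid t -> W t (v t)) /\ x = \sum_(t | nid t) v t.

Definition V_br1 : space := sumsp (fun t => eigsp (inC t) (gS t) (T_gen t) (- (dim%:R / 4%:R))).
Definition V_br2 : space := sumsp (fun t => eigsp (inC t) (gS t) (T_gen t) (dim%:R / 4%:R)).
Definition V_cb1 : space := sumsp (fun t => eigsp (inN t) (gA t) (A_gen t) dim%:R).
Definition V_cb2 : space := sumsp (fun t => eigsp (inN t) (gA t) (A_gen t) (- dim%:R)).

Definition unitary (U : Md) : Prop := U *m adj U = 1%:M.
Definition pauli_group (P : Md) : Prop := exists (k : nat) (p : pstr), P = ci ^+ k *: pauli_str p.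
Definition clifford (U : Md) : Prop :=
  unitary U /\ forall P, pauli_group P -> pauli_group (U *m P *m adj U).
(* phi^{(x)2}(U) on M_d (x) M_d: A (x) B |-> UAU^+ (x) UBU^+, i.e.
   X |-> (U (x) U) X (U (x) U)^+ ; independent of the phase of U *)
Definition act2 (U : Md) (X : M2) : M2 := tensmx U U *m X *m adj (tensmx U U).

Definition subspace (V : space) : Prop :=
  V 0 /\ (forall x y, V x -> V y -> V (x + y)) /\ (forall (a : Cx) x, V x -> V (a *: x)).
Definition invariant (V : space) : Prop :=
  forall U, clifford U -> forall x, V x -> V (act2 U x).
Definition irrep (V : space) : Prop :=
  [/\ subspace V, invariant V, (exists x, V x /\ x != 0) &
      forall W : space, subspace W -> (forall x, W x -> V x) -> invariant W ->
        (forall x, W x -> x = 0) \/ (forall x, V x -> W x)].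

Definition direct_sum (Vs : seq space) : Prop :=
  (forall X : M2, exists v : 'I_(size Vs) -> M2,
      (forall i : 'I_(size Vs), nth (fun _ => False) Vs i (v i)) /\ X = \sum_(i < size Vs) v i)
  /\ (forall v w : 'I_(size Vs) -> M2,
      (forall i : 'I_(size Vs), nth (fun _ => False) Vs i (v i)) ->
      (forall i : 'I_(size Vs), nth (fun _ => False) Vs i (w i)) ->
      \sum_(i < size Vs) v i = \sum_(i < size Vs) w i -> forall i, v i = w i).

Definition irrep_decomposition (Vs : seq space) : Prop :=
  direct_sum Vs /\ forall i : 'I_(size Vs), irrep (nth (fun _ => False) Vs i).

End Clifford.

(* Main.v *)
(* Conjugation by a Clifford unitary permutes the Pauli strings up to sign.  The
   matrices sigma (x) (sigma . tau), with a factor i when sigma and tau anticommute,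
   form an orthonormal basis E(tau, sigma) of M_d (x) M_d, on which it acts by
   E(tau, sigma) |-> +- E(pi tau, pi sigma), with a sign depending only on tau.  In
   these coordinates all the subspaces are described fibre by fibre over tau: either
   by functions constant on a set Om of pairs (tau, sigma), or by functions f on Om
   with sum 0, f (sigma + tau) = +- f sigma and H f = mu f on Om, where H is the
   Hadamard transform of the symplectic form and mu is d, - d or 0.  As H ^ 2 = d ^ 2,
   the latter are complementary eigenspaces.

   For irreducibility, take a nonzero vector of an invariant subspace: conjugating
   with Paulis isolates one fibre tau, and averaging over the transvections that fix
   tau and sigma gives a vector constant on the orbits of this group.  There are so
   few orbits that it is the value at sigma of a kernel commuting with H and with the
   stabiliser of tau; the translates of this vector by transvections span the whole
   space. *)

(* The shift of sigma by tau exchanges the two tensor factors, so parity under it separates [S] from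
   [A]. On the supports [OmD], [OmC], [OmN] the character of tau has the constant value e = 1, 1,
   -1. For parity e, H preserves the functions of sum 0 on the support and has the eigenvalues d and
   - d; for parity - e it vanishes on the support, which is the eigenvalue 0. With the constant
   functions each support carries four pieces, except that parity -1 is void over tau = 1; three
   supports with one-point fibres are left, and 3 + 3 + 4 + 4 = 14. The constants d / 2 and d / 4 of
   the definitions come from H f = sum f - 2 (sum of f over anticommuting strings).

   The condition of sum 0 is not in the definition of the eigenspaces over [OmC] and has to be
   derived; this works unless d ^ 2 = 8 lambda. For q = 1 and q = 2 some supports are so small that
   H is forced to be d on them, and the pieces for - d disappear; elsewhere explicit test vectors
   show that the pieces are nonzero. *)
Require Import Defs.
From HB Require Import structures.
From mathcomp Require Import all_boot all_order all_algebra all_fingroup.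
From mathcomp Require Import reals.
From mathcomp Require boolp.
From mathcomp Require Import complex mxtens.
From mathcomp Require Import ring zify.
Set Implicit Arguments. Unset Strict Implicit. Unset Printing Implicit Defensive.
Import Order.TTheory GRing.Theory Num.Theory.
Local Open Scope ring_scope.

(** * Pauli strings as a symplectic space *)

(* The letters 1, X, Y, Z (codes 0, 1, 2, 3) have bits (x, z) = (0,0), (1,0), (1,1), (0,1). *)
Definition xbit (a : 'I_4) : bool := (val a == 1%N) || (val a == 2%N).
Definition zbit (a : 'I_4) : bool := (1 < val a)%N.
Definition of_bits (x z : bool) : 'I_4 :=
  if x then (if z then @Ordinal 4 2 isT else @Ordinal 4 1 isT)
  else (if z then @Ordinal 4 3 isT else @Ordinal 4 0 isT).

Lemma xbit_of x z : xbit (of_bits x z) = x. Proof. by case: x z => [] []. Qed.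
Lemma zbit_of x z : zbit (of_bits x z) = z. Proof. by case: x z => [] []. Qed.

Lemma bits_inj a b : xbit a = xbit b -> zbit a = zbit b -> a = b.
Proof.
by case: a b => [[|[|[|[|?]]]] ?] [[|[|[|[|?]]]] ?] //= _ _; apply: val_inj.
Qed.

Section Strings.
Variable q : nat.
Implicit Types (s t r u a : pstr q).

Definition padd s t : pstr q :=
  [ffun k => of_bits (xbit (s k) (+) xbit (t k)) (zbit (s k) (+) zbit (t k))].
(** The symplectic form over F_2: the term at [k] is true when the two letters anticommute, so
    [sp s t] says that the Pauli matrices of [s] and [t] anticommute. *)
Definition sp s t : bool :=
  \big[addb/false]_k ((xbit (s k) && zbit (t k)) (+) (zbit (s k) && xbit (t k))).
Definition single k b : pstr q := [ffun j => if j == k then b else ord0].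

Local Notation "s +^ t" := (padd s t) (at level 50, left associativity).

Lemma pstrP s t :
  (forall k, xbit (s k) = xbit (t k) /\ zbit (s k) = zbit (t k)) -> s = t.
Proof. by move=> h; apply/ffunP => k; case: (h k) => ? ?; apply: bits_inj. Qed.

Lemma xbitD s t k : xbit ((s +^ t) k) = xbit (s k) (+) xbit (t k).
Proof. by rewrite ffunE xbit_of. Qed.
Lemma zbitD s t k : zbit ((s +^ t) k) = zbit (s k) (+) zbit (t k).
Proof. by rewrite ffunE zbit_of. Qed.
Lemma xbit0 k : xbit (pid q k) = false. Proof. by rewrite ffunE. Qed.
Lemma zbit0 k : zbit (pid q k) = false. Proof. by rewrite ffunE. Qed.

Lemma paddC : commutative padd.
Proof. by move=> s t; apply: pstrP => k; rewrite !(xbitD, zbitD) ![_ (t k) (+) _]addbC. Qed.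
Lemma paddA : associative padd.
Proof. by move=> s t u; apply: pstrP => k; rewrite !(xbitD, zbitD) !addbA. Qed.
Lemma padd0 s : s +^ pid q = s.
Proof. by apply: pstrP => k; rewrite !(xbitD, zbitD, xbit0, zbit0) !addbF. Qed.
Lemma add0p s : pid q +^ s = s. Proof. by rewrite paddC padd0. Qed.
Lemma paddss s : s +^ s = pid q.
Proof. by apply: pstrP => k; rewrite !(xbitD, zbitD, xbit0, zbit0) !addbb. Qed.
Lemma paddK t s : s +^ t +^ t = s.
Proof. by rewrite -paddA paddss padd0. Qed.
Lemma padKd t s : t +^ (t +^ s) = s.
Proof. by rewrite paddA paddss add0p. Qed.
Lemma paddCA s t u : s +^ (t +^ u) = t +^ (s +^ u).
Proof. by rewrite !paddA (paddC s). Qed.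
Lemma padd_eq s t u : (s +^ t == u) = (s == u +^ t).
Proof. by apply/eqP/eqP => [<-|->]; rewrite paddK. Qed.
Lemma padd_eq0 s t : (s +^ t == pid q) = (s == t).
Proof. by rewrite padd_eq add0p. Qed.

Lemma spDl s t u : sp (s +^ t) u = sp s u (+) sp t u.
Proof.
rewrite /sp -big_split /=; apply: eq_bigr => k _; rewrite xbitD zbitD.
by case: (xbit (s k)) (zbit (s k)) (xbit (t k)) (zbit (t k)) (xbit (u k)) (zbit (u k))
  => [] [] [] [] [] [].
Qed.
Lemma spC s t : sp s t = sp t s.
Proof.
apply: eq_bigr => k _.
by case: (xbit (s k)) (zbit (s k)) (xbit (t k)) (zbit (t k)) => [] [] [] [].
Qed.
Lemma spDr s t u : sp s (t +^ u) = sp s t (+) sp s u.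
Proof. by rewrite !(spC s) spDl. Qed.
Lemma spss s : sp s s = false.
Proof. by rewrite /sp big1 // => k _; case: xbit zbit => [] []. Qed.
Lemma sp0l s : sp (pid q) s = false.
Proof. by rewrite /sp big1 // => k _; rewrite xbit0 zbit0. Qed.
Lemma sp0r s : sp s (pid q) = false. Proof. by rewrite spC sp0l. Qed.

Lemma sp_single k b s :
  sp (single k b) s = (xbit b && zbit (s k)) (+) (zbit b && xbit (s k)).
Proof.
rewrite /sp (bigD1 k) //= ffunE eqxx big1 ?addbF // => j /negPf jk.
by rewrite ffunE jk.
Qed.

Lemma sp_nondeg s : s != pid q -> exists a, sp a s.
Proof.
move=> s0; have [k sk] : exists k, s k != ord0.
  apply/existsP; rewrite -negb_forall; apply: contraNN s0 => /forallP h.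
  by apply/eqP/ffunP => k; rewrite ffunE; apply/eqP/h.
(* The letter with bits (z, not z) anticommutes with the nontrivial letter at [k]: the form is z +
   (not z) x, and x = 1 when z = 0. *)
exists (single k (of_bits (zbit (s k)) (~~ zbit (s k)))).
rewrite sp_single xbit_of zbit_of.
by move: sk; case: (s k) => [[|[|[|[|?]]]] ?].
Qed.

(** A pair [v] stands for the linear equation [sp a v.1 = v.2] in [a]; the mask [m] holds the
    F_2-coefficients of a combination of equations. *)
Fixpoint psum (m : bitseq) (l : seq (pstr q * bool)) : pstr q * bool :=
  match m, l with
  | b :: m', v :: l' =>
      let w := psum m' l' in if b then (v.1 +^ w.1, v.2 (+) w.2) else w
  | _, _ => (pid q, false)
  end.

Lemma psum_sp a m l : (forall v, v \in l -> sp a v.1 = v.2) ->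
  sp a (psum m l).1 = (psum m l).2.
Proof.
elim: m l => [|b m IH] [|v l] h /=; rewrite ?sp0r //.
have {}IH := IH l (fun v hv => h v (mem_behead (s := _ :: l) hv)).
by case: b; rewrite //= spDr IH h ?mem_head.
Qed.

Lemma psum_nil m : psum m [::] = (pid q, false). Proof. by case: m. Qed.

(** Duality for a nondegenerate form. In the inductive step, if the separating [a] also sees the new
    [w], the question is asked again for [u + w]; adding [a] to the answer [b] corrects the value at
    [w] when needed. *)
Lemma span_or_sep l u :
  (exists m, (psum m l).1 = u) \/
  (exists a, (forall v, v \in l -> sp a v.1 = false) /\ sp a u).
Proof.
elim: l u => [|w l IH] u.
  have [->|u0] := eqVneq u (pid q); first by left; exists [::].
  by have [a au] := sp_nondeg u0; right; exists a.
have [[m hm]|[a [al au]]] := IH u; first by left; exists (false :: m).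
have [aw|aw] := boolP (sp a w.1); last first.
  by right; exists a; split => // v /[!inE] /orP[/eqP->|/al//]; apply: negPf.
have [[m hm]|[b [bl]]] := IH (u +^ w.1).
  by left; exists (true :: m) => /=; rewrite hm paddC paddK.
rewrite spDr => bu; right.
have [bw|bw] := boolP (sp b w.1); last first.
  exists b; rewrite (negPf bw) addbF in bu; split=> //.
  by move=> v /[!inE] /orP[/eqP->|/bl//]; apply: negPf.
exists (a +^ b); split.
  by move=> v /[!inE] /orP[/eqP->|hv]; rewrite spDl ?aw ?bw // al // bl.
by move: bu; rewrite bw spDl au; case: sp.
Qed.

Lemma sp_solve l : (forall m, (psum m l).1 = pid q -> (psum m l).2 = false) ->
  exists a, forall v, v \in l -> sp a v.1 = v.2.
Proof.
elim: l => [|w l IH] h; first by exists (pid q).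
have [a al] := IH (fun m => h (false :: m)).
have [aw|aw] := eqVneq (sp a w.1) w.2.
  by exists a => v /[!inE] /orP[/eqP->|/al].
(* If [w.1] depends on the earlier vectors, consistency already forces the value [w.2]; otherwise
   some [c] orthogonal to them flips the value at [w.1]. *)
have [[m hm]|[c [cl cw]]] := span_or_sep l w.1.
  have := h (true :: m); rewrite /= hm paddss => /(_ erefl).
  by rewrite -(psum_sp m al) hm; move: aw; case: sp; case: w.2.
exists (a +^ c) => v /[!inE] /orP[/eqP->|hv]; rewrite spDl; last by rewrite cl ?al ?addbF.
by rewrite cw; move: aw; case: sp; case: w.2.
Qed.

(** * Symplectic transvections *)

Definition transv a s : pstr q := if sp a s then a +^ s else s.

Lemma transvK a : involutive (transv a).
Proof.
move=> s; rewrite /transv; have [as_|/negPf as_] := boolP (sp a s).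
  by rewrite spDr spss as_ /= padKd.
by rewrite as_.
Qed.
Lemma transvD a s t : transv a (s +^ t) = transv a s +^ transv a t.
Proof.
rewrite /transv spDr; case: (sp a s); case: (sp a t) => //=.
- by rewrite paddA (paddC (a +^ s)) padKd.
- by rewrite paddA.
- by rewrite paddCA.
Qed.
Lemma sp_transv a s t : sp (transv a s) (transv a t) = sp s t.
Proof.
rewrite /transv; have [h1|/negPf h1] := boolP (sp a s); have [h2|/negPf h2] := boolP (sp a t);
  rewrite ?(spDl, spDr) ?spss ?(spC s a) ?h1 ?h2 //=.
by case: (sp s t).
Qed.
Lemma transv_fix a s : sp a s = false -> transv a s = s.
Proof. by rewrite /transv => ->. Qed.
Lemma transv_move s t : sp s t -> transv (s +^ t) s = t.
Proof. by move=> h; rewrite /transv spDl spss spC h paddC padKd. Qed.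
Lemma transv_eq a s t : (transv a s == transv a t) = (s == t).
Proof. exact: (inj_eq (can_inj (transvK a))). Qed.
Lemma transv0 a : transv a (pid q) = pid q.
Proof. by rewrite transv_fix ?sp0r. Qed.

(** Up to a sign, E(t, s) is the tensor product of the matrices of [s] and [s + t]. In D, C, N these
    are, respectively, equal and nontrivial; nontrivial, distinct and commuting; anticommuting. *)
Definition OmD t s := (t == pid q) && (s != pid q).
Definition OmC t s := [&& t != pid q, s != pid q, s != t & ~~ sp s t].
Definition OmN t s := (t != pid q) && sp s t.


(** The shift by [t] exchanges the two tensor factors, and each support is symmetric in them. *)
Lemma Om_padd (Om : pstr q -> pstr q -> bool) : [\/ Om = OmD, Om = OmC | Om = OmN] ->
  forall t s, Om t (s +^ t) = Om t s.
Proof.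
case=> -> t s; rewrite /OmD /OmC /OmN.
- by case: eqP => //= ->; rewrite padd0.
- rewrite padd_eq add0p padd_eq paddss spDl spss addbF.
  by case: (t == _) => //=; rewrite andbCA.
- by rewrite spDl spss addbF.
Qed.

Definition sc (b : bool) s := if b then s else pid q.

Lemma psum_cons m v l :
  psum m (v :: l) = (sc (head false m) v.1 +^ (psum (behead m) l).1,
                     (head false m && v.2) (+) (psum (behead m) l).2).
Proof.
case: m => [|b m] /=; last by case: b; rewrite //= add0p; case: psum.
by rewrite add0p; case: l.
Qed.

Lemma sp_sc a b s : sp a (sc b s) = b && sp a s.
Proof. by case: b; rewrite /= ?sp0r. Qed.

Lemma sp_solve3 v1 v2 v3 c1 c2 c3 :
  (forall b1 b2 b3, sc b1 v1 +^ (sc b2 v2 +^ sc b3 v3) = pid q ->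
     (b1 && c1) (+) ((b2 && c2) (+) (b3 && c3)) = false) ->
  exists a, [/\ sp a v1 = c1, sp a v2 = c2 & sp a v3 = c3].
Proof.
move=> h; have [m|a al] := @sp_solve [:: (v1, c1); (v2, c2); (v3, c3)].
  by rewrite !psum_cons psum_nil /= padd0 addbF; apply: h.
by exists a; split; [apply: (al (v1, c1))|apply: (al (v2, c2))|apply: (al (v3, c3))];
  rewrite !inE eqxx ?orbT.
Qed.

Lemma sp_solve4 v1 v2 v3 v4 c1 c2 c3 c4 :
  (forall b1 b2 b3 b4, sc b1 v1 +^ (sc b2 v2 +^ (sc b3 v3 +^ sc b4 v4)) = pid q ->
     (b1 && c1) (+) ((b2 && c2) (+) ((b3 && c3) (+) (b4 && c4))) = false) ->
  exists a, [/\ sp a v1 = c1, sp a v2 = c2, sp a v3 = c3 & sp a v4 = c4].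
Proof.
move=> h; have [m|a al] := @sp_solve [:: (v1, c1); (v2, c2); (v3, c3); (v4, c4)].
  by rewrite !psum_cons psum_nil /= padd0 addbF; apply: h.
by exists a; split; [apply: (al (v1, c1))|apply: (al (v2, c2))|apply: (al (v3, c3))|apply: (al (v4, c4))];
  rewrite !inE eqxx ?orbT.
Qed.

(** * Orbits of transvections on the supports *)

Section Supports.
Variable Om : pstr q -> pstr q -> bool.
Hypothesis goodOm : [\/ Om = OmD, Om = OmC | Om = OmN].

Lemma Om_nz t s : Om t s -> s != pid q.
Proof.
case: goodOm => ->; first by case/andP.
  by case/and4P.
by case/andP => _; apply: contraTneq => ->; rewrite sp0l.
Qed.

Lemma Om_nsc t s b : Om t s -> s != sc b t.
Proof.
move=> h; case: b => /=; last exact: Om_nz h.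
case: goodOm h => ->; first by case/andP => /eqP ->.
  by case/and4P.
by case/andP => _; apply: contraTneq => ->; rewrite spss.
Qed.

Lemma Om_sp t s r : Om t s -> Om t r -> sp s t = sp r t.
Proof.
case: goodOm => ->; first by case/andP => /eqP -> _; rewrite !sp0r.
  by move=> /and4P[_ _ _ /negPf->] /and4P[_ _ _ /negPf->].
by move=> /andP[_ ->] /andP[_ ->].
Qed.

(** Away from [s] and [s + t], the only invariant of the transvections fixing [t] and [s] is
    commutation with [s]. Anticommuting [r] and [r'] are joined by the transvection along their sum,
    commuting ones through some [u] that anticommutes with both and has the same relations to [t]
    and [s]. *)
Lemma transv_orbit (T : Type) (f : pstr q -> T) t s r r' :
  (forall a, sp a t = false -> sp a s = false -> forall u, f (transv a u) = f u) ->
  Om t s -> Om t r -> Om t r' ->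
  r != s -> r != s +^ t -> r' != s -> r' != s +^ t -> sp s r = sp s r' -> f r = f r'.
Proof.
move=> inv os or or' rs rst rs' rst' e.
have direct u v : sp u t = sp v t -> sp s u = sp s v -> sp u v -> f u = f v.
  move=> h1 h2 h3; rewrite -(inv (u +^ v)) ?(spDl, spC _ s) ?h1 ?h2 ?addbb //.
  by rewrite transv_move.
have [h|/negPf h] := boolP (sp r r'); first by apply: direct => //; apply: Om_sp.
have [b1 b2 b3 b4 /= z|u [ut us ur ur']] :=
  @sp_solve4 t s r r' (sp r t) (sp s r) true true; last first.
  rewrite (_ : f r = f u) 1?(_ : f r' = f u) //; apply: direct => //.
  - by rewrite ut; apply: Om_sp.
  - by rewrite (spC s u) us.
  - by rewrite spC.
  - by rewrite (spC s u) us.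
  - by rewrite spC.
(* Pairing a dependency with [r] balances its [t] and [s] terms. Unequal [b3] and [b4] would put [r]
   or [r'] into the span of [t] and [s], all of whose elements are excluded. *)
have := congr1 (sp r) z; rewrite sp0r !spDr !sp_sc spss h !andbF !addbF (spC r s) => h12.
rewrite !andbT; suff -> : b3 = b4 by rewrite addbb addbF.
move: z; case: b3; case: b4 => //=; rewrite ?(padd0, add0p) ?paddA => /eqP.
- rewrite padd_eq0 eq_sym; case: b1 {h12}; case: b2 => /=; rewrite ?(padd0, add0p).
  + by rewrite paddC (negPf rst).
  + by have := Om_nsc true or => /negPf ->.
  + by rewrite (negPf rs).
  + by rewrite (negPf (Om_nz or)).
- rewrite padd_eq0 eq_sym; case: b1 {h12}; case: b2 => /=; rewrite ?(padd0, add0p).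
  + by rewrite paddC (negPf rst').
  + by have := Om_nsc true or' => /negPf ->.
  + by rewrite (negPf rs').
  + by rewrite (negPf (Om_nz or')).
Qed.

(** Transitivity on a fibre, put as propagation of a predicate so that no group has to be named. One
    transvection suffices if [s] and [r] anticommute; otherwise two, through some [u] anticommuting
    with both. *)
Lemma transv_trans_stab (P : pstr q -> Prop) t s r :
  (forall a u, sp a t = false -> P u -> P (transv a u)) ->
  Om t s -> Om t r -> P s -> P r.
Proof.
move=> inv os or ps.
have direct u v : sp u t = sp v t -> sp u v -> P u -> P v.
  by move=> h1 h2 pu; rewrite -(transv_move h2); apply: inv => //; rewrite spDl h1 addbb.
have [->|rs] := eqVneq r s; first by [].
have [h|/negPf h] := boolP (sp s r); first by apply: direct ps => //; apply: Om_sp.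
have [b1 b2 b3 /= z|u [ut us ur]] := @sp_solve3 t s r (sp s t) true true; last first.
  by apply: (@direct u) => //; [rewrite ut; apply: Om_sp | apply: (@direct s); rewrite // spC].
have := congr1 (sp s) z; rewrite sp0r !spDr !sp_sc spss h !andbF !addbF => ->.
rewrite !andbT /=; move: z; case: b2; case: b3 => //=; rewrite ?(padd0, add0p) => /eqP.
- by rewrite padd_eq0 eq_sym (negPf (Om_nsc _ os)).
- by rewrite padd_eq0 eq_sym (negPf (Om_nsc _ or)).
Qed.

Lemma Om_nz_eq t s t' s' : Om t s -> Om t' s' -> (t == pid q) = (t' == pid q).
Proof.
case: goodOm => ->.
- by case/andP => -> _ /andP[-> _].
- by case/andP => /negPf -> _ /andP[/negPf -> _].
- by case/andP => /negPf -> _ /andP[/negPf -> _].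
Qed.

Lemma Om_transv a t s : Om (transv a t) (transv a s) = Om t s.
Proof.
have tp u : (transv a u == pid q) = (u == pid q) by rewrite -{1}(transv0 a) transv_eq.
by case: goodOm => ->; rewrite /OmD /OmC /OmN !tp ?transv_eq ?sp_transv.
Qed.
End Supports.

(** Every transvection fixes the identity string, so transitivity on nonzero strings is transitivity
    on the fibre of [OmD] over it. *)
Lemma transv_trans_nz (P : pstr q -> Prop) t r :
  (forall a u, P u -> P (transv a u)) -> (t == pid q) = (r == pid q) -> P t -> P r.
Proof.
move=> inv; have [->|t0] := eqVneq t (pid q); first by move/esym/eqP ->.
move/esym/negbT => r0.
have OmD0 u : u != pid q -> OmD (pid q) u by rewrite /OmD eqxx.
apply: (@transv_trans_stab OmD (Or31 _ _ erefl) P (pid q)); try exact: OmD0.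
by move=> a u _; apply: inv.
Qed.

Lemma transv_trans Om (P : pstr q -> pstr q -> Prop) t s t' s' :
  [\/ Om = OmD, Om = OmC | Om = OmN] ->
  (forall a u v, P u v -> P (transv a u) (transv a v)) ->
  Om t s -> Om t' s' -> P t s -> P t' s'.
Proof.
move=> gO inv os os' pts.
(* Move [t] to [t'] first, carrying [s] along to some [s1]; the stabiliser of [t'] then takes [s1]
   to [s']. *)
have [s1 [o1 p1]] : exists s1, Om t' s1 /\ P t' s1.
  apply: (@transv_trans_nz (fun u => exists v, Om u v /\ P u v) t); last by exists s.
    by move=> a u [v [ov pv]]; exists (transv a v); split; [rewrite Om_transv|apply: inv].
  exact: Om_nz_eq os os'.
apply: (transv_trans_stab gO _ o1 os' p1) => a u at_ pu.
by rewrite -(transv_fix at_); apply: inv.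
Qed.

End Strings.
Local Notation "s +^ t" := (padd s t) (at level 50, left associativity).

(** * Pauli matrices *)

Lemma bits_eq n (a b : nat) : (a < 2 ^ n)%N -> (b < 2 ^ n)%N ->
  (forall k, (k < n)%N -> odd (a %/ 2 ^ k) = odd (b %/ 2 ^ k)) -> a = b.
Proof.
elim: n a b => [|n IH] a b; first by rewrite expn0 !ltnS !leqn0 => /eqP -> /eqP ->.
rewrite expnS !mul2n => ha hb h.
rewrite -(odd_double_half a) -(odd_double_half b).
have := h 0 isT; rewrite expn0 !divn1 => ->; congr (_ + _.*2)%N.
apply: IH => [||k kn]; first by rewrite -ltn_double; lia.
  by rewrite -ltn_double; lia.
by rewrite -!divn2 -!divnMA -expnS; apply: h.
Qed.

Section Pauli.
Variable R : realType.
Variable q : nat.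
Local Notation C := (Cx R).
Local Notation i1 := (ci R).
Local Notation d := (Defs.dim q).
Implicit Types (s t r u : pstr q).

Lemma ci2 : i1 * i1 = -1.
Proof. by rewrite -expr2 sqr_i. Qed.

Lemma conj_ci : conjc i1 = - i1.
Proof. by apply/eqP; rewrite eq_complex /= oppr0 !eqxx. Qed.

Lemma bitkE (i : 'I_d) (k : 'I_q) : val (bitk i k) = odd (i %/ 2 ^ k).
Proof. by rewrite /bitk /= inordK //; case: odd. Qed.

Lemma bitk_inj (i j : 'I_d) : (forall k, bitk i k = bitk j k) -> i = j.
Proof.
move=> h; apply: val_inj; apply: (@bits_eq q); [exact: ltn_ord..|] => k kq.
by apply: (can_inj oddb); have := congr1 val (h (Ordinal kq)); rewrite !bitkE /= => ->.
Qed.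

(** A basis index is the family of its bits, so products and traces of strings reduce to single
    qubits. *)
Lemma sum_bits (F : 'I_q -> 'I_2 -> C) :
  \sum_(l < d) \prod_k F k (bitk l k) = \prod_k \sum_b F k b.
Proof.
rewrite bigA_distr_bigA /=.
pose h (l : 'I_d) : {ffun 'I_q -> 'I_2} := [ffun k => bitk l k].
have hb : bijective h.
  apply: inj_card_bij; last by rewrite card_ffun !card_ord.
  by move=> i j /ffunP e; apply: bitk_inj => k; have := e k; rewrite !ffunE.
rewrite (reindex h) /=; last exact: onW_bij.
by apply: eq_bigr => l _; apply: eq_bigr => k _; rewrite ffunE.
Qed.

(** Exponent of i in a product of two letters: XY = iZ, YZ = iX, ZX = iY, and i ^ 3 = - i in the
    opposite order. *)
Definition ph1e (a b : 'I_4) : nat :=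
  match val a, val b with
  | 1, 2 => 1 | 2, 3 => 1 | 3, 1 => 1
  | 2, 1 => 3 | 3, 2 => 3 | 1, 3 => 3
  | _, _ => 0 end.

Lemma pauli1M a b : pauli1 R a *m pauli1 R b =
  i1 ^+ ph1e a b *: pauli1 R (of_bits (xbit a (+) xbit b) (zbit a (+) zbit b)).
Proof.
apply/matrixP => i j; rewrite !mxE !big_ord_recl big_ord0 !mxE.
have i3 : i1 ^+ 3 = - i1 by rewrite exprS expr2 ci2 mulrN1.
case: a => [[|[|[|[|?]]]] ?] //; case: b => [[|[|[|[|?]]]] ?] //;
case: i => [[|[|?]] ?] //; case: j => [[|[|?]] ?] //=;
rewrite -?val_eqE /= ?expr0 ?expr1 ?i3;
rewrite ?(mulr0,mul0r,mulr1,mul1r,addr0,add0r,mulrN,mulNr,opprK,ci2,oppr0) //.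
Qed.

Lemma pauli1_herm a i j : conjc (pauli1 R a j i) = pauli1 R a i j.
Proof.
rewrite !mxE; case: a => [[|[|[|[|?]]]] ?] //; case: i => [[|[|?]] ?] //; case: j => [[|[|?]] ?] //=;
by apply/eqP; rewrite eq_complex /= ?oppr0 ?opprK ?eqxx.
Qed.

Lemma pauli1_tr a : \sum_b pauli1 R a b b = if a == ord0 then 2%:R else 0.
Proof.
rewrite !big_ord_recl big_ord0 !mxE; case: a => [[|[|[|[|?]]]] ?] //=;
by rewrite -?val_eqE /= ?addr0 ?subrr.
Qed.

Lemma pauli1_compl i j i' j' :
  \sum_a conjc (pauli1 R a i j) * pauli1 R a i' j' = if (i == i') && (j == j') then 2%:R else 0.
Proof.
under eq_bigr do rewrite pauli1_herm.
rewrite !big_ord_recl big_ord0 !mxE.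
case: i => [[|[|?]] ?] //; case: j => [[|[|?]] ?] //;
case: i' => [[|[|?]] ?] //; case: j' => [[|[|?]] ?] //=;
rewrite -?val_eqE /=;
by rewrite ?(mulr0,mul0r,mulr1,mul1r,addr0,add0r,mulrN,mulNr,opprK,ci2,oppr0,subrr,addNr).
Qed.

Definition phe s t : nat := \sum_k ph1e (s k) (t k).

(** The phase is imaginary exactly for anticommuting strings; this decides where an extra factor i
    is wanted. *)
Lemma odd_phe s t : odd (phe s t) = sp s t.
Proof.
rewrite /phe /sp (big_morph odd oddD (erefl : odd 0 = false)).
apply: eq_bigr => k _; case: (s k) (t k) => [[|[|[|[|?]]]] ?] // [[|[|[|[|?]]]] ?] //.
Qed.

Definition ph s t : C := i1 ^+ phe s t.

Lemma pauliM s t : pauli_str R s *m pauli_str R t = ph s t *: pauli_str R (s +^ t).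
Proof.
apply/matrixP => i j; rewrite !mxE.
transitivity (\sum_(l < d) \prod_k
   (pauli1 R (s k) (bitk i k) (bitk l k) * pauli1 R (t k) (bitk l k) (bitk j k))).
  by apply: eq_bigr => l _; rewrite !mxE -big_split.
rewrite (sum_bits (fun k b => pauli1 R (s k) (bitk i k) b * pauli1 R (t k) b (bitk j k))).
rewrite /ph /phe -prodrXr -big_split /=; apply: eq_bigr => k _.
by have := congr1 (fun M : 'M_2 => M (bitk i k) (bitk j k)) (pauli1M (s k) (t k));
  rewrite !mxE ffunE.
Qed.

Lemma pauli_adj s : adj (pauli_str R s) = pauli_str R s.
Proof.
apply/matrixP => i j; rewrite !mxE rmorph_prod; apply: eq_bigr => k _; exact: pauli1_herm.
Qed.

Lemma prod_if (P : pred 'I_q) : \prod_k (if P k then 2%:R else 0 : C) =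
  if [forall k, P k] then d%:R else 0.
Proof.
case: (boolP [forall k, P k]) => [/forallP h|].
  rewrite (eq_bigr (fun _ => 2%:R)) => [|k _]; last by rewrite h.
  by rewrite prodr_const card_ord natrX.
by rewrite negb_forall => /existsP[k /negPf h]; rewrite (bigD1 k) //= h mul0r.
Qed.

Lemma pauli_tr s : \tr (pauli_str R s) = if s == pid q then d%:R else 0.
Proof.
rewrite /mxtrace; under eq_bigr do rewrite mxE.
rewrite (sum_bits (fun k b => pauli1 R (s k) b b)).
under eq_bigr do rewrite pauli1_tr; rewrite prod_if; congr (if _ then _ else _).
apply/forallP/eqP => [h|-> k]; last by rewrite ffunE.
by apply/ffunP => k; rewrite ffunE; apply/eqP.
Qed.

Lemma pauli_compl i j i' j' : \sum_(s : pstr q) conjc (pauli_str R s i j) * pauli_str R s i' j' =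
  if (i == i') && (j == j') then d%:R else 0.
Proof.
transitivity (\sum_(s : pstr q) \prod_k
   (conjc (pauli1 R (s k) (bitk i k) (bitk j k)) * pauli1 R (s k) (bitk i' k) (bitk j' k))).
  by apply: eq_bigr => s _; rewrite !mxE rmorph_prod -big_split.
rewrite -(bigA_distr_bigA (fun k a => conjc (pauli1 R a (bitk i k) (bitk j k))
   * pauli1 R a (bitk i' k) (bitk j' k))).
under eq_bigr do rewrite pauli1_compl; rewrite prod_if; congr (if _ then _ else _).
apply/forallP/andP => [h|[/eqP-> /eqP->] k]; last by rewrite !eqxx.
by split; apply/eqP/bitk_inj => k; have /andP[/eqP ? /eqP ?] := h k.
Qed.

Lemma pauli0 : pauli_str R (pid q) = 1%:M.
Proof.
apply/matrixP => i j; rewrite !mxE.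
have [<-|ij] := eqVneq i j; first by rewrite big1 // => k _; rewrite mxE ffunE eqxx.
have /existsP[k kk] : [exists k, bitk i k != bitk j k].
  rewrite -negb_forall; apply: contraNN ij => /forallP h; apply/eqP/bitk_inj => k; exact/eqP/h.
by rewrite (bigD1 k) //= mxE ffunE (negPf kk) mul0r.
Qed.

Lemma ph_ss s : ph s s = 1.
Proof.
rewrite /ph /phe big1 ?expr0 // => k _.
by case: (s k) => [[|[|[|[|?]]]] ?].
Qed.

Lemma ph2 s t : ph s t * ph s t = (-1) ^+ sp s t.
Proof. by rewrite /ph -expr2 exprAC expr2 ci2 -odd_phe signr_odd. Qed.

Lemma ph_neq0 s t : ph s t != 0.
Proof. by apply/eqP => h; have := ph2 s t; rewrite h mul0r => /esym/eqP; rewrite signr_eq0. Qed.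

Lemma ph_conj s t : conjc (ph s t) * ph s t = 1.
Proof.
have -> : conjc (ph s t) = (conjc i1) ^+ phe s t by rewrite -rmorphXn.
by rewrite conj_ci /ph -exprMn mulNr ci2 opprK expr1n.
Qed.

(** The adjoint of a product of Hermitian matrices reverses the order, so [ph t s] is the conjugate,
    that is the inverse, of [ph s t], whose square is the sign. *)
Lemma ph_swap s t : ph t s = (-1) ^+ sp s t * ph s t.
Proof.
have e : conjc (ph s t) *: pauli_str R (s +^ t) = ph t s *: pauli_str R (s +^ t).
  have <- : adj (pauli_str R s *m pauli_str R t) = ph t s *: pauli_str R (s +^ t).
    rewrite (paddC s) -pauliM -{2}(pauli_adj t) -{2}(pauli_adj s) /adj -trmx_mul.
    by congr (_^T); apply: map_mxM.
  rewrite pauliM -{1}(pauli_adj (s +^ t)); apply/matrixP => i j.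
  by rewrite !mxE rmorphM.
have nz : pauli_str R (s +^ t) != 0.
  apply/eqP => h; have := pauliM (s +^ t) (s +^ t).
  rewrite h mul0mx ph_ss paddss pauli0 scale1r => /(congr1 mxtrace).
  rewrite mxtrace1 linear0 => /esym/eqP; rewrite pnatr_eq0.
  by rewrite /Defs.dim expn_eq0.
have {}e : conjc (ph s t) = ph t s.
  by apply/eqP; rewrite -subr_eq0; move/eqP: e; rewrite -subr_eq0 -scalerBl scaler_eq0 (negPf nz) orbF.
transitivity (conjc (ph s t) * ((-1) ^+ sp s t * (ph s t * ph s t))).
  by rewrite ph2 -expr2 sqrr_sign mulr1.
by rewrite mulrCA; congr (_ * _); rewrite mulrA ph_conj mul1r.
Qed.
End Pauli.

(** * The basis E(tau, sigma) *)

Lemma exchange_big4 (V : nmodType) (I J K L : finType) (G : I -> J -> K -> L -> V) :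
  \sum_i \sum_j \sum_k \sum_l G i j k l = \sum_k \sum_l \sum_i \sum_j G i j k l.
Proof.
rewrite pair_bigA /= [RHS]pair_bigA /=; under eq_bigr do rewrite pair_bigA /=.
by rewrite exchange_big; apply: eq_bigr => p _; rewrite [RHS]pair_bigA.
Qed.

Section Basis.
Variable R : realType.
Variable q : nat.
Local Notation C := (Cx R).
Local Notation i1 := (ci R).
Local Notation d := (Defs.dim q).
Local Notation P := (@pauli_str R q).
Local Notation sg := (@sig R q).
Implicit Types (s t r u : pstr q).

Lemma csqrt_sqr n : csqrt R n * csqrt R n = n%:R.
Proof. by rewrite /csqrt -rmorphM -expr2 sqr_sqrtr ?ler0n // rmorph_nat. Qed.

Lemma csqrt_conj n : conjc (csqrt R n) = csqrt R n.
Proof. exact: conjc_real. Qed.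

Lemma conjcM (x y : C) : conjc (x * y) = conjc x * conjc y.
Proof. exact: rmorphM. Qed.

Lemma csqrt_neq0 n : (0 < n)%N -> csqrt R n != 0.
Proof.
by move=> n0; apply/eqP => h; have /esym/eqP := csqrt_sqr n; rewrite h mul0r pnatr_eq0; case: n n0 {h}.
Qed.

Lemma dim_gt0 : (0 < d)%N. Proof. by rewrite expn_gt0. Qed.

Lemma dim_neq0 : d%:R != 0 :> C. Proof. by rewrite pnatr_eq0 -lt0n dim_gt0. Qed.

Let rd := csqrt R d.
Let rd0 : rd != 0. Proof. exact/csqrt_neq0/dim_gt0. Qed.

Lemma daggerM m n p (A : 'M[C]_(m, n)) (B : 'M[C]_(n, p)) : adj (A *m B) = adj B *m adj A.
Proof. by rewrite /adj -trmx_mul; congr (_^T); apply: map_mxM. Qed.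

Lemma daggerZ m n c (A : 'M[C]_(m, n)) : adj (c *: A) = conjc c *: adj A.
Proof. by apply/matrixP => i j; rewrite !mxE rmorphM. Qed.

Lemma daggerD m n (A B : 'M[C]_(m, n)) : adj (A + B) = adj A + adj B.
Proof. by apply/matrixP => i j; rewrite !mxE rmorphD. Qed.

Lemma daggerK m n (A : 'M[C]_(m, n)) : adj (adj A) = A.
Proof. by apply/matrixP => i j; rewrite !mxE conjcK. Qed.

Lemma dagger1 n : adj (1%:M : 'M[C]_n) = 1%:M.
Proof. by apply/matrixP => i j; rewrite !mxE eq_sym; case: eqP => _; [rewrite conjc1|rewrite conjc0]. Qed.

Lemma sig_adj s : adj (sg s) = sg s.
Proof. by rewrite /sig daggerZ pauli_adj conjc_inv csqrt_conj. Qed.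

Lemma sigma0E : sigma0 R q = sg (pid q).
Proof. by rewrite /sigma0 /sig pauli0. Qed.

Lemma sigM s t : sg s *m sg t = (rd^-1 * ph R s t) *: sg (s +^ t).
Proof. by rewrite /sig -scalemxAl -scalemxAr pauliM !scalerA; congr (_ *: _); rewrite mulrAC. Qed.

Lemma dotn_sig s t : dotn (sg s) (sg t) = ph R s t *: sg (s +^ t).
Proof. by rewrite /dotn sigM scalerA mulrA divff // mul1r. Qed.

Lemma sig_tr s : \tr (sg s) = if s == pid q then rd else 0.
Proof.
rewrite /sig mxtraceZ pauli_tr; case: eqP => _; last by rewrite mulr0.
by rewrite -csqrt_sqr mulKf.
Qed.

Lemma sig_orth s t : \tr (adj (sg s) *m sg t) = (s == t)%:R.
Proof.
rewrite sig_adj sigM mxtraceZ sig_tr padd_eq0; case: eqP => [->|_]; last by rewrite mulr0.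
by rewrite ph_ss mulr1 mulVf.
Qed.

Lemma sig_neq0 s : sg s != 0.
Proof.
apply/eqP => h; have := sig_orth s s; rewrite eqxx h mulmx0 linear0 => /esym/eqP.
by rewrite oner_eq0.
Qed.

Lemma sig_inj a b s t : a != 0 -> a *: sg s = b *: sg t -> s = t.
Proof.
move=> a0 /(congr1 (fun M => \tr (adj (sg s) *m M))).
have trZ c M : \tr (adj (sg s) *m (c *: M)) = c * \tr (adj (sg s) *m M).
  by rewrite -scalemxAr mxtraceZ.
rewrite [LHS]trZ [RHS]trZ (sig_orth s s) (sig_orth s t) eqxx.
by case: eqP => // _ /eqP; rewrite mulr1 mulr0 (negPf a0).
Qed.

Lemma sig_comm s t : sg t *m sg s = (-1) ^+ sp s t *: (sg s *m sg t).
Proof. by rewrite !sigM ph_swap paddC [RHS]scalerA mulrCA. Qed.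

Lemma sigM_neq0 s t : sg s *m sg t != 0.
Proof.
by rewrite sigM scaler_eq0 negb_or sig_neq0 mulf_neq0 ?invr_neq0 ?ph_neq0.
Qed.

Lemma commbE s t : commb R s t = ~~ sp s t.
Proof.
rewrite /commb (sig_comm s t); case: sp => /=; last by rewrite scale1r eqxx.
by rewrite scaleN1r -addr_eq0 -mulr2n -scaler_nat scaler_eq0 (negPf (sigM_neq0 _ _)) pnatr_eq0.
Qed.

Lemma antibE s t : antib R s t = sp s t.
Proof.
rewrite /antib (sig_comm s t); case: sp => /=; first by rewrite scaleN1r subrr eqxx.
by rewrite scale1r -mulr2n -scaler_nat scaler_eq0 (negPf (sigM_neq0 _ _)) pnatr_eq0.
Qed.

Lemma inNE t s : inN R t s = sp s t.
Proof.
by rewrite /inN antibE /nid; case: eqP => [->|//]; rewrite sp0l.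
Qed.

Lemma inCE t s : inC R t s = [&& s != pid q, s != t & ~~ sp s t].
Proof. by rewrite /inC commbE. Qed.

(** The factor that makes the product of two strings Hermitian; with it the phase [th] is a sign. *)
Definition iota (b : bool) : C := if b then i1 else 1.
Definition th t s : C := iota (sp s t) * ph R s t.
Fact Eb_key : unit. Proof. by []. Qed.
(* Locked: unification would otherwise unfold it down to matrix entries. *)
Definition Eb : pstr q -> pstr q -> M2 R q :=
  locked_with Eb_key (fun t s => tens (sg s) (iota (sp s t) *: dotn (sg s) (sg t))).

Lemma Eb_def t s : Eb t s = tens (sg s) (iota (sp s t) *: dotn (sg s) (sg t)).
Proof. by rewrite /Eb unlock. Qed.

Lemma tensZl c (A B : Md R q) : tens (c *: A) B = c *: tens A B.
Proof. by apply/matrixP => i j; rewrite !mxE mulrA. Qed.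
Lemma tensZr c (A B : Md R q) : tens A (c *: B) = c *: tens A B.
Proof. by apply/matrixP => i j; rewrite !mxE mulrCA. Qed.

Lemma th2 t s : th t s * th t s = 1.
Proof.
rewrite /th mulrACA ph2 /iota; case: sp; last by rewrite !mul1r.
by rewrite ci2 mulrNN mulr1.
Qed.

Lemma sqr1_conj (c : C) : c * c = 1 -> conjc c = c.
Proof.
move/eqP; rewrite -expr2 sqrf_eq1 => /orP[] /eqP ->; first exact: conjc1.
by rewrite rmorphN; congr (- _); exact: conjc1.
Qed.

Lemma EbE t s : Eb t s = th t s *: tens (sg s) (sg (s +^ t)).
Proof. by rewrite Eb_def dotn_sig scalerA tensZr. Qed.

Lemma tens_Eb s t : tens (sg s) (sg t) = th (s +^ t) s *: Eb (s +^ t) s.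
Proof. by rewrite EbE scalerA th2 scale1r padKd. Qed.

(** Exchange of the tensor factors in the basis. Its sign is the reason why on commuting pairs [S]
    is even and [A] odd under the shift by [t], and the other way round on anticommuting pairs. *)
Lemma Eb_swap t s :
  tens (iota (sp s t) *: dotn (sg s) (sg t)) (sg s) = (-1) ^+ sp s t *: Eb t (s +^ t).
Proof.
rewrite dotn_sig scalerA tensZl EbE paddK scalerA; congr (_ *: _).
rewrite /th spDl spss addbF mulrCA; congr (_ * _).
have := ph2 R (s +^ t) t; have := ph2 R s t; rewrite spDl spss addbF => h1 h2.
(* The two phases cancel because multiplying [sg s] twice by [sg t] returns a phase-free multiple of
   [sg s]. *)
suff e : ph R s t * ph R (s +^ t) t = 1.
  by rewrite -h1 -mulrA e mulr1.
have h : sg s *m (rd^-1 *: sg (pid q)) = (rd^-1 * rd^-1) *: sg s.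
  by rewrite -sigma0E /sigma0 scalerA -scalemxAr mulmx1.
have e1 : sg s *m sg t *m sg t = ((rd^-1 * ph R s t) * (rd^-1 * ph R (s +^ t) t)) *: sg s.
  by rewrite sigM -scalemxAl (sigM (s +^ t) t) [LHS]scalerA paddK.
move: e1; rewrite -mulmxA (sigM t t) ph_ss mulr1 paddss h => /esym.
move/eqP; rewrite -subr_eq0 -scalerBl scaler_eq0 (negPf (sig_neq0 s)) orbF subr_eq0 mulrACA.
by move/eqP/(canRL (mulKf (mulf_neq0 (invr_neq0 rd0) (invr_neq0 rd0)))); rewrite mulVf ?mulf_neq0 ?invr_neq0.
Qed.

Lemma tensmx_adj (A B : Md R q) : adj (tensmx A B) = tensmx (adj A) (adj B).
Proof. by apply/matrixP => i j; rewrite !mxE rmorphM. Qed.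

Lemma tensmx_tr (A B : Md R q) : \tr (tensmx A B) = \tr A * \tr B.
Proof. by rewrite /mxtrace mulr_sum; apply: eq_bigr => i _; rewrite mxE. Qed.

Lemma hs_tens (A B A' B' : Md R q) :
  hs (tens A B) (tens A' B') = \tr (adj A *m A') * \tr (adj B *m B').
Proof. by rewrite /hs /tens tensmx_adj tensmx_mul tensmx_tr. Qed.

Lemma hsE (A B : M2 R q) : hs A B = \sum_i \sum_j conjc (A i j) * B i j.
Proof.
rewrite /hs /mxtrace exchange_big; apply: eq_bigr => j _; rewrite mxE.
by apply: eq_bigr => i _; rewrite !mxE.
Qed.

Lemma hs_lin (A B D : M2 R q) c : hs A (c *: B + D) = c * hs A B + hs A D.
Proof. by rewrite /hs mulmxDr -scalemxAr mxtraceD mxtraceZ. Qed.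

Definition co (x : M2 R q) t s : C := hs (Eb t s) x.

Lemma coD x y t s : co (x + y) t s = co x t s + co y t s.
Proof. by have := hs_lin (Eb t s) x y 1; rewrite scale1r mul1r. Qed.
Lemma co0 t s : co 0 t s = 0.
Proof. by rewrite /co /hs mulmx0 linear0. Qed.
Lemma coZ c x t s : co (c *: x) t s = c * co x t s.
Proof. by have := hs_lin (Eb t s) x 0 c; rewrite addr0 -/(co 0 t s) co0 addr0. Qed.
Lemma coN x t s : co (- x) t s = - co x t s.
Proof. by rewrite -scaleN1r coZ mulN1r. Qed.
Lemma co_sum (I : Type) (l : seq I) (Q : pred I) (F : I -> M2 R q) t s :
  co (\sum_(i <- l | Q i) F i) t s = \sum_(i <- l | Q i) co (F i) t s.
Proof. by apply: (big_morph (fun x => co x t s)) => [x y|]; [apply: coD|apply: co0]. Qed.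

Lemma co_Eb t s t' s' : co (Eb t s) t' s' = ((t == t') && (s == s'))%:R.
Proof.
rewrite /co !EbE.
have -> c A B : hs (c *: A) B = conjc c * hs A B :> C.
  by rewrite /hs daggerZ -scalemxAl mxtraceZ.
rewrite /hs -scalemxAr mxtraceZ -/(hs _ _) hs_tens !sig_orth.
have [e1|n1] := eqVneq s' s; last first.
  by rewrite andbF mul0r !mulr0.
rewrite -e1 andbT mul1r !(paddC s') padd_eq paddK.
have [->|_] := eqVneq t' t; last by rewrite !mulr0.
by rewrite mulr1 sqr1_conj ?th2.
Qed.

Lemma sig_compl i j i' j' : \sum_s conjc (sg s i j) * sg s i' j' = ((i == i') && (j == j'))%:R.
Proof.
have E (s : pstr q) k l : sg s k l = rd^-1 * P s k l by rewrite mxE.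
under eq_bigr do rewrite !E conjcM mulrACA.
rewrite -mulr_sumr pauli_compl; case: andP => _; last by rewrite mulr0.
have -> : conjc rd^-1 = rd^-1 by rewrite conjc_inv csqrt_conj.
by rewrite -invfM csqrt_sqr mulVf // dim_neq0.
Qed.

(** For fixed [s] the second factor runs over all strings as [t] does, so this is completeness of
    the Pauli basis in each factor. It yields the expansion in the basis without counting
    dimensions. *)
Lemma Eb_compl I J I' J' :
  \sum_t \sum_s conjc (Eb t s I J) * Eb t s I' J' = ((I == I') && (J == J'))%:R.
Proof.
case: (mxtens_indexP I) => i k; case: (mxtens_indexP J) => j l.
case: (mxtens_indexP I') => i' k'; case: (mxtens_indexP J') => j' l'.
have E t s : conjc (Eb t s (mxtens_index (i, k)) (mxtens_index (j, l))) *
    Eb t s (mxtens_index (i', k')) (mxtens_index (j', l')) =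
    (conjc (sg s i j) * sg s i' j') * (conjc (sg (s +^ t) k l) * sg (s +^ t) k' l').
  rewrite EbE mxE [X in _ * X]mxE /tens !tensmxE conjcM mulrACA.
  rewrite sqr1_conj ?th2 // mul1r conjcM -!mulrA; congr (_ * _).
  by rewrite mulrCA.
under eq_bigr do under eq_bigr do rewrite E.
rewrite exchange_big /=.
transitivity (\sum_s (conjc (sg s i j) * sg s i' j') * ((k == k') && (l == l'))%:R).
  apply: eq_bigr => s _; rewrite -mulr_sumr -sig_compl; congr (_ * _).
  by rewrite [RHS](reindex_inj (can_inj (padKd s))).
rewrite -mulr_suml sig_compl -natrM mulnb !(can_eq (@mxtens_indexK _ _)).
by rewrite !xpair_eqE andbACA.
Qed.

Lemma coE x : x = \sum_t \sum_s co x t s *: Eb t s.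
Proof.
apply/matrixP => I J; rewrite summxE.
under eq_bigr do rewrite summxE.
transitivity (\sum_I' \sum_J' \sum_t \sum_s conjc (Eb t s I' J') * Eb t s I J * x I' J').
  rewrite (bigD1 I) //= (bigD1 J) //= [X in _ + X + _]big1 ?[X in _ + X]big1 ?addr0.
  - under eq_bigr do rewrite -mulr_suml.
    by rewrite -mulr_suml Eb_compl !eqxx mul1r.
  - move=> I' nI; rewrite big1 // => J' _.
    under eq_bigr do rewrite -mulr_suml.
    by rewrite -mulr_suml Eb_compl (negPf nI) mul0r.
  - move=> J' nJ; under eq_bigr do rewrite -mulr_suml.
    by rewrite -mulr_suml Eb_compl (negPf nJ) andbF mul0r.
rewrite exchange_big4; apply: eq_bigr => t _; apply: eq_bigr => s _.
rewrite [RHS]mxE /co hsE mulr_suml; apply: eq_bigr => I' _.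
by rewrite mulr_suml; apply: eq_bigr => J' _; rewrite mulrAC.
Qed.

Lemma co_inj x y : (forall t s, co x t s = co y t s) -> x = y.
Proof.
move=> h; rewrite [x]coE [y]coE; apply: eq_bigr => t _; apply: eq_bigr => s _; by rewrite h.
Qed.

End Basis.

(** * The action of Clifford unitaries *)

Section CliffordAction.
Variable R : realType.
Variable q : nat.
Local Notation C := (Cx R).
Local Notation i1 := (ci R).
Local Notation d := (Defs.dim q).
Local Notation P := (@pauli_str R q).
Local Notation sg := (@sig R q).
Implicit Types (s t r u : pstr q) (U : Md R q).

(** What the action on the basis requires; derived for every Clifford unitary, and checked directly
    for the Pauli matrices and the transvections. *)
Definition implements U (pi : pstr q -> pstr q) (ep : pstr q -> C) : Prop :=
  [/\ unitary U, forall s, U *m sg s *m adj U = ep s *: sg (pi s),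
      forall s, ep s * ep s = 1, forall s t, sp (pi s) (pi t) = sp s t & injective pi].

Lemma act2_tens U (A B : Md R q) :
  act2 U (tens A B) = tens (U *m A *m adj U) (U *m B *m adj U).
Proof. by rewrite /act2 /tens tensmx_adj !tensmx_mul. Qed.

Lemma act2D U (x y : M2 R q) : act2 U (x + y) = act2 U x + act2 U y.
Proof. by rewrite /act2 mulmxDr mulmxDl. Qed.
Lemma act2Z U c (x : M2 R q) : act2 U (c *: x) = c *: act2 U x.
Proof. by rewrite /act2 -scalemxAr -scalemxAl. Qed.
Lemma act20 U : act2 U (0 : M2 R q) = 0.
Proof. by rewrite /act2 mulmx0 mul0mx. Qed.
Lemma act2_sum U (I : Type) (l : seq I) (Q : pred I) (F : I -> M2 R q) :
  act2 U (\sum_(i <- l | Q i) F i) = \sum_(i <- l | Q i) act2 U (F i).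
Proof. by apply: (big_morph (act2 U)) => [x y|]; [apply: act2D|apply: act20]. Qed.

Lemma unitaryV U : unitary U -> adj U *m U = 1%:M.
Proof. exact: mulmx1C. Qed.

Lemma conjmxM U (A B : Md R q) : unitary U ->
  U *m (A *m B) *m adj U = (U *m A *m adj U) *m (U *m B *m adj U).
Proof. by move/unitaryV => h; rewrite !mulmxA -(mulmxA _ (adj U) U) h mulmx1. Qed.

(** The first factor contributes [ep s] and the product [ep s * ep t]; as [ep s] squares to 1, the
    sign is constant on a fibre. Preservation of [sp] keeps the factor i where it was. *)
Lemma act2_Eb U pi ep t s : implements U pi ep ->
  act2 U (Eb R t s) = ep t *: Eb R (pi t) (pi s).
Proof.
case=> uU hU e2 hsp _; rewrite !Eb_def act2_tens hU hsp.
have -> c (A B : Md R q) : U *m (c *: dotn A B) *m adj U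
    = c *: dotn (U *m A *m adj U) (U *m B *m adj U).
  by rewrite /dotn scalerA -scalemxAr -scalemxAl conjmxM // -scalerA.
rewrite !hU.
have -> a b (A B : Md R q) : dotn (a *: A) (b *: B) = (a * b) *: dotn A B.
  by rewrite /dotn -scalemxAl -scalemxAr !scalerA; congr (_ *: _); rewrite -!mulrA mulrC mulrA.
rewrite tensZl scalerA tensZr [in RHS]tensZr !scalerA; congr (_ *: _).
by rewrite -[RHS]mul1r -(e2 s); ring.
Qed.

Lemma co_act2 U pi ep x t s : implements U pi ep ->
  co (act2 U x) (pi t) (pi s) = ep t * co x t s.
Proof.
move=> h; have [_ _ _ _ inj] := h.
rewrite {1}[x]coE act2_sum co_sum (bigD1 t) //= [X in _ + X]big1 ?addr0.
  rewrite act2_sum co_sum (bigD1 s) //= [X in _ + X]big1 ?addr0.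
    by rewrite act2Z coZ (act2_Eb _ _ h) coZ co_Eb !eqxx mulr1 mulrC.
  move=> s' /negPf ns; rewrite act2Z coZ (act2_Eb _ _ h) coZ co_Eb.
  by rewrite eqxx (inj_eq inj) ns !mulr0.
move=> t' /negPf nt; rewrite act2_sum co_sum big1 // => s' _.
by rewrite act2Z coZ (act2_Eb _ _ h) coZ co_Eb (inj_eq inj) nt !mulr0.
Qed.

Lemma pauliE s : P s = csqrt R d *: sg s.
Proof. by rewrite /sig scalerA divff ?scale1r // csqrt_neq0 ?dim_gt0. Qed.

(** The image of a Hermitian matrix is Hermitian, so the phase i ^ k is a sign. Multiplicativity of
    conjugation makes [pi] additive, comparing the two orders of a product gives [sp], and only the
    identity is conjugated to a multiple of the identity, whence injectivity. *)
Lemma clifford_implements U : clifford U -> exists pi ep,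
  implements U pi ep /\ forall s t, pi (s +^ t) = pi s +^ pi t.
Proof.
case=> uU hU; have uV := unitaryV uU.
have {}hU s : exists kp : 'I_4 * pstr q, U *m sg s *m adj U = i1 ^+ kp.1 *: sg kp.2.
  have [|k [p hp]] := hU (P s); first by exists 0%N, s; rewrite expr0 scale1r.
  exists (inord (k %% 4), p); rewrite /= inordK ?ltn_mod //.
  have -> : i1 ^+ (k %% 4) = i1 ^+ k.
    rewrite [in RHS](divn_eq k 4) exprD mulnC exprM.
    have -> : i1 ^+ 4 = 1 by rewrite (exprM _ 2 2) [i1 ^+ 2]expr2 ci2 sqrrN expr1n.
    by rewrite expr1n mul1r.
  by rewrite {1}/sig -scalemxAr -scalemxAl hp scalerA mulrC -scalerA.
have [kp {}hU] := fin_all_exists hU.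
pose pi s := (kp s).2; pose ep s : C := i1 ^+ (kp s).1.
have {}hU s : U *m sg s *m adj U = ep s *: sg (pi s) by [].
have epC s : conjc (ep s) * ep s = 1.
  have -> : conjc (ep s) = (conjc i1) ^+ (kp s).1 by rewrite -rmorphXn.
  by rewrite conj_ci /ep -exprMn mulNr ci2 opprK expr1n.
have ep0 s : ep s != 0.
  by apply/eqP => h; have := epC s; rewrite h mulr0 => /esym/eqP; rewrite oner_eq0.
have ep2 s : ep s * ep s = 1.
  have := hU s; move=> /(congr1 (@adj _ _ _)).
  rewrite daggerZ !daggerM daggerK !sig_adj mulmxA hU => /eqP.
  rewrite -subr_eq0 -scalerBl scaler_eq0 (negPf (sig_neq0 R _)) orbF subr_eq0 => /eqP e.
  by rewrite {1}e epC.
have hM s t : ep s * ep t *: (sg (pi s) *m sg (pi t)) = ((csqrt R d)^-1 * ph R s t * ep (s +^ t)) *: sg (pi (s +^ t)).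
  have := conjmxM (sg s) (sg t) uU; rewrite !hU => e.
  have -> : ep s * ep t *: (sg (pi s) *m sg (pi t)) = (ep s *: sg (pi s)) *m (ep t *: sg (pi t)).
    by rewrite -[RHS]scalemxAl -[in RHS]scalemxAr [RHS]scalerA.
  by rewrite -e sigM -scalemxAr -scalemxAl hU scalerA.
have hD s t : pi (s +^ t) = pi s +^ pi t.
  have := hM s t; rewrite sigM [LHS]scalerA => /sig_inj -> //.
  by rewrite !mulf_neq0 ?ph_neq0 ?invr_neq0 ?csqrt_neq0 ?dim_gt0.
have inj0 s : pi s = pid q -> s = pid q.
  move=> e; have := hU s; rewrite e -sigma0E /sigma0 => h.
  apply: (@sig_inj R q 1 (ep s)); first exact: oner_neq0.
  rewrite [LHS]scale1r -sigma0E.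
  have -> : sg s = adj U *m (U *m sg s *m adj U) *m U.
    by rewrite !mulmxA uV mul1mx -mulmxA uV mulmx1.
  by rewrite h /sigma0 -!scalemxAr mulmx1 -!scalemxAl uV.
have inj : injective pi.
  move=> s t e; apply/eqP; rewrite -padd_eq0; apply/eqP/inj0.
  by rewrite hD e paddss.
exists pi, ep; split=> //; split=> // s t.
have := hM t s; rewrite (paddC t) ph_swap sig_comm.
have -> : (csqrt R d)^-1 * ((-1) ^+ sp s t * ph R s t) * ep (s +^ t) =
   (-1) ^+ sp s t * ((csqrt R d)^-1 * ph R s t * ep (s +^ t)).
  by rewrite mulrCA -!mulrA.
rewrite -[RHS]scalerA -hM scalerA [RHS]scalerA (mulrC (ep t)) => /eqP.
rewrite -subr_eq0 -scalerBl scaler_eq0 (negPf (sigM_neq0 _ _ _)) orbF.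
rewrite [X in X - _]mulrC -mulrBl mulf_eq0 (negPf (mulf_neq0 (ep0 _) (ep0 _))) orbF subr_eq0.
by move/eqP/signr_inj.
Qed.

Lemma pauli_comm s t : P t *m P s = (-1) ^+ sp s t *: (P s *m P t).
Proof. by rewrite !pauliM ph_swap paddC scalerA. Qed.

Lemma pauli_unitary a : unitary (P a).
Proof. by rewrite /unitary pauli_adj pauliM ph_ss paddss pauli0 scale1r. Qed.

Lemma pauli_implements a : implements (P a) id (fun s => (-1) ^+ sp a s).
Proof.
split=> //; first exact: pauli_unitary; last by move=> s; rewrite -expr2 sqrr_sign.
move=> s; rewrite pauli_adj /sig -scalemxAr -scalemxAl (pauli_comm s a) -scalemxAl -mulmxA.
by rewrite pauliM ph_ss paddss pauli0 scale1r mulmx1 !scalerA spC mulrC.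
Qed.

(** This is exp(i pi P_a / 4): conjugation by it fixes the strings commuting with [a] and turns an
    anticommuting P_s into i P_a P_s, a transvection up to sign. *)
Definition trans_mx a : Md R q := (csqrt R 2)^-1 *: (1%:M + i1 *: P a).
Definition trans_sgn a s : C := if sp a s then i1 * ph R a s else 1.

Lemma trans_sgn2 a s : trans_sgn a s * trans_sgn a s = 1.
Proof.
rewrite /trans_sgn; have := ph2 R a s; case: sp => e; last by rewrite mulr1.
by rewrite mulrACA e ci2 mulrNN mulr1.
Qed.

Lemma halfD (M : Md R q) : 2%:R^-1 *: (M + M) = M.
Proof.
rewrite -{1 2}[M]scale1r -scalerDl scalerA -[1 + 1]/(2%:R) mulVf ?scale1r //.
by rewrite pnatr_eq0.
Qed.

Lemma trans_mx_unitary a : unitary (trans_mx a).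
Proof.
rewrite /unitary /trans_mx daggerZ daggerD dagger1 daggerZ pauli_adj conj_ci.
rewrite conjc_inv csqrt_conj -scalemxAl -scalemxAr scalerA -invfM csqrt_sqr.
rewrite mulmxDl mul1mx mulmxDr mulmx1 -scalemxAr -scalemxAl pauliM ph_ss paddss pauli0 scale1r.
rewrite (scalerA (- i1)) mulNr ci2 opprK scale1r scaleNr addrA subrK.
by rewrite halfD.
Qed.

Lemma trans_implements a : implements (trans_mx a) (transv a) (trans_sgn a).
Proof.
split; [exact: trans_mx_unitary| |exact: trans_sgn2|exact: sp_transv|exact: can_inj (transvK a)].
move=> s; rewrite /sig -scalemxAr -scalemxAl [RHS]scalerA mulrC -[RHS]scalerA; congr (_ *: _).
rewrite /trans_mx daggerZ daggerD dagger1 daggerZ pauli_adj conj_ci conjc_inv csqrt_conj.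
rewrite -!scalemxAl -scalemxAr scalerA -invfM csqrt_sqr.
have -> : (1%:M + i1 *: P a) *m P s *m (1%:M + - i1 *: P a) =
    P s + (-1) ^+ sp s a *: P s + (i1 * ((-1) ^+ sp s a - 1)) *: (P s *m P a).
  have -> : (1%:M + i1 *: P a) *m P s = P s + (i1 * (-1) ^+ sp s a) *: (P s *m P a).
    by rewrite mulmxDl mul1mx -scalemxAl (pauli_comm s a) scalerA.
  rewrite mulmxDr mulmx1 -scalemxAr mulmxDl -scalemxAl -(mulmxA (P s)).
  rewrite [P a *m P a]pauliM ph_ss paddss pauli0 scale1r mulmx1 scalerDr !scalerA.
  rewrite mulrA mulNr ci2 opprK mul1r mulrBr mulr1 scalerBl scaleNr.
  by rewrite -!addrA; congr (_ + _); rewrite addrA addrC.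
rewrite (spC s) /transv /trans_sgn; case: ifP => h; last first.
  by rewrite expr0 !scale1r subrr mulr0 scale0r addr0 halfD.
rewrite expr1 scaleN1r subrr add0r -[RHS]scalerA -pauliM (pauli_comm s a) (spC s) h expr1.
rewrite [LHS]scalerA [RHS]scalerA; congr (_ *: _); by field.
Qed.

Lemma implements_clifford U pi ep : implements U pi ep ->
  (forall s, exists k, ep s = i1 ^+ k) -> clifford U.
Proof.
case=> uU hU _ _ _ hep; split => // _ [k [p ->]].
have [l el] := hep p; exists (k + l)%N, (pi p).
rewrite exprD -el -scalemxAr -scalemxAl -[RHS]scalerA; congr (_ *: _).
by rewrite !pauliE -[U *m _]scalemxAr -[LHS]scalemxAl hU scalerA [RHS]scalerA mulrC.
Qed.

Lemma pauli_clifford a : clifford (P a).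
Proof.
apply: (implements_clifford (pauli_implements a)) => s; exists (sp a s).*2.
by rewrite -mul2n exprM [i1 ^+ 2]expr2 ci2.
Qed.

Lemma trans_clifford a : clifford (trans_mx a).
Proof.
apply: (implements_clifford (trans_implements a)) => s; rewrite /trans_sgn.
by case: ifP => _; [exists (phe a s).+1; rewrite exprS|exists 0%N; rewrite expr0].
Qed.

End CliffordAction.

(** * Invariant subspaces in coordinates *)

Section Families.
Variable R : realType.
Variable q : nat.
Local Notation C := (Cx R).
Local Notation d := (Defs.dim q).
Implicit Types (s t r u : pstr q) (U : Md R q) (x y : M2 R q) (f g h : pstr q -> C).
Implicit Types Om : pstr q -> pstr q -> bool.

Definition chi s r : C := (-1) ^+ sp s r.
Definition Ht f s : C := \sum_r chi s r * f r.

Lemma chiC s r : chi s r = chi r s. Proof. by rewrite /chi spC. Qed.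
Lemma chiDl s u r : chi (s +^ u) r = chi s r * chi u r.
Proof. by rewrite /chi spDl signr_addb. Qed.
Lemma chiDr s u r : chi s (u +^ r) = chi s u * chi s r.
Proof. by rewrite !(chiC s) chiDl. Qed.
Lemma chi2 s r : chi s r * chi s r = 1. Proof. by rewrite -expr2 sqrr_sign. Qed.
Lemma chi0 s : chi s (pid q) = 1. Proof. by rewrite /chi sp0r. Qed.
Lemma chi_conj s r : conjc (chi s r) = chi s r. Proof. by apply/sqr1_conj/chi2. Qed.

Lemma sum_shift (V : nmodType) (F : pstr q -> V) t : \sum_s F (s +^ t) = \sum_s F s.
Proof.
have inj : injective (fun s => s +^ t) by move=> s r /(congr1 (fun v => v +^ t)); rewrite !paddK.
by rewrite [RHS](reindex_inj inj).
Qed.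

Lemma card_pstr : #|{: pstr q}|%:R = d%:R * d%:R :> C.
Proof. by rewrite card_ffun !card_ord -natrM -expnD addnn -mul2n expnM. Qed.

Lemma chi_sum u : \sum_s chi u s = if u == pid q then d%:R * d%:R else 0.
Proof.
have [->|u0] := eqVneq u (pid q).
  by under eq_bigr do rewrite chiC chi0; rewrite sumr_const card_pstr.
have [a au] := sp_nondeg u0.
have e : \sum_s chi u s = - \sum_s chi u s.
  rewrite -{1}(sum_shift _ a) -sumrN; apply: eq_bigr => s _.
  by rewrite chiDr {2}/chi spC au expr1 mulrN1.
by move/eqP: e; rewrite -addr_eq0 -mulr2n mulrn_eq0 => /eqP.
Qed.

Lemma HtK f u : Ht (Ht f) u = d%:R * d%:R * f u.
Proof.
rewrite /Ht; under eq_bigr do rewrite mulr_sumr; rewrite exchange_big /=.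
rewrite (bigD1 u) //= [X in _ + X]big1 ?addr0 => [|r nr].
  under eq_bigr => s _ do rewrite mulrA (chiC s) -chiDl paddss.
  by rewrite -mulr_suml chi_sum eqxx.
under eq_bigr => s _ do rewrite mulrA (chiC s) -chiDl.
by rewrite -mulr_suml chi_sum padd_eq0 eq_sym (negPf nr) mul0r.
Qed.

Lemma Ht_pid f : Ht f (pid q) = \sum_s f s.
Proof. by apply: eq_bigr => s _; rewrite chiC chi0 mul1r. Qed.

Definition mk t f : M2 R q := \sum_s f s *: Eb R t s.

Lemma co_mk t f t' s : co (mk t f) t' s = if t == t' then f s else 0.
Proof.
rewrite /mk co_sum (bigD1 s) //= big1 ?addr0 => [|r nr]; last first.
  by rewrite coZ co_Eb (negPf nr) andbF mulr0.
rewrite coZ co_Eb eqxx andbT; case: eqP => _; first exact: mulr1.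
exact: mulr0.
Qed.

Lemma mk_eq t f g : f =1 g -> mk t f = mk t g.
Proof. by move=> e; apply: eq_bigr => s _; rewrite e. Qed.

Lemma mkE x : x = \sum_t mk t (co x t). Proof. exact: coE. Qed.

Lemma mkZ t c f : c *: mk t f = mk t (fun s => c * f s).
Proof. by rewrite /mk scaler_sumr; apply: eq_bigr => s _; rewrite scalerA. Qed.

Lemma mk_sum t (I : finType) (Q : pred I) (F : I -> pstr q -> C) :
  \sum_(i | Q i) mk t (F i) = mk t (fun s => \sum_(i | Q i) F i s).
Proof.
rewrite /mk exchange_big /=; apply: eq_bigr => s _; by rewrite scaler_suml.
Qed.

Lemma act2_mk U pi ep t f : implements U pi ep ->
  act2 U (mk t (fun s => f (pi s))) = ep t *: mk (pi t) f.
Proof.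
move=> h; rewrite /mk act2_sum scaler_sumr; have [_ _ _ _ inj] := h.
rewrite [RHS](reindex_inj inj); apply: eq_bigr => s _.
by rewrite act2Z (act2_Eb _ _ h) !scalerA mulrC.
Qed.

Section Subspaces.
Variable W : Defs.space R q.
Hypothesis sW : subspace W.

Lemma subspaceZ c x : W x -> W (c *: x). Proof. by case: sW => _ [_ h]; apply: h. Qed.
Lemma subspaceD x y : W x -> W y -> W (x + y). Proof. by case: sW => _ [h _]; apply: h. Qed.
Lemma subspace0 : W 0. Proof. by case: sW. Qed.
Lemma subspaceB x y : W x -> W y -> W (x - y).
Proof. by move=> wx wy; rewrite -scaleN1r; apply: subspaceD => //; apply: subspaceZ. Qed.
Lemma subspace_sum (I : Type) (l : seq I) (Q : pred I) (F : I -> M2 R q) :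
  (forall i, Q i -> W (F i)) -> W (\sum_(i <- l | Q i) F i).
Proof. by move=> h; apply: (big_ind W) => //; [apply: subspace0|apply: subspaceD]. Qed.
Lemma subspaceZI c x : c != 0 -> W (c *: x) -> W x.
Proof. by move=> c0 h; rewrite -[x]scale1r -(mulVf c0) -scalerA; apply: subspaceZ. Qed.

Hypothesis iW : Defs.invariant W.

(** Conjugation by P_a multiplies the whole fibre over [t'] by the character value [chi a t'], so
    orthogonality of characters extracts one fibre. *)
Lemma weight_proj x t : W x -> W (mk t (co x t)).
Proof.
move=> wx; apply: (@subspaceZI (d%:R * d%:R)); first by rewrite mulf_neq0 ?dim_neq0.
suff -> : d%:R * d%:R *: mk t (co x t) = \sum_a chi a t *: act2 (pauli_str R a) x.
  by apply: subspace_sum => a _; apply/subspaceZ/iW => //; apply: pauli_clifford.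
apply: co_inj => t' s; rewrite coZ co_mk co_sum.
transitivity (\sum_a chi (t +^ t') a * co x t' s).
  rewrite -mulr_suml chi_sum padd_eq0; move: (d%:R * d%:R : C) => D.
  by case: eqP => [->|_] //; rewrite [RHS]mul0r mulr0.
apply: eq_bigr => a _.
rewrite chiDl.
rewrite (chiC t a) (chiC t' a).
rewrite [RHS]coZ.
rewrite -[LHS]mulrA.
congr (_ * _).
exact: esym (co_act2 x t' s (pauli_implements R a)).
Qed.

Lemma trans_mk a t f : sp a t = false -> W (mk t f) -> W (mk t (fun s => f (transv a s))).
Proof.
move=> at_ w.
have := act2_mk t (fun s => f (transv a s)) (trans_implements R a).
rewrite (transv_fix at_) /trans_sgn at_ scale1r => <-.
rewrite (@mk_eq t _ f) => [|s]; last by rewrite transvK.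
by apply: iW => //; apply: trans_clifford.
Qed.

Lemma trans_mk_move a t f g :
  (forall s, g (transv a s) = f s) -> W (mk t f) -> W (mk (transv a t) g).
Proof.
move=> fg w; apply: (@subspaceZI (trans_sgn R a t)).
  by apply/eqP => h; have := trans_sgn2 R a t; rewrite h mulr0 => /esym/eqP; rewrite oner_eq0.
rewrite -(act2_mk _ _ (trans_implements R a)) (mk_eq _ fg).
by apply: iW => //; apply: trans_clifford.
Qed.

Lemma gen_ind (gT : finGroupType) (A : {set gT}) (Q : gT -> Prop) :
  Q 1%g -> (forall a z, a \in A -> Q z -> Q (a * z)%g) -> forall z, z \in <<A>>%g -> Q z.
Proof.
move=> Q1 QM z /gen_prodgP[n [c cA ->]].
elim: n c cA => [|n IH] c cA; first by rewrite big_ord0.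
by rewrite big_ord_recl; apply: QM => //; apply: IH.
Qed.

(** The group is generated inside the finite permutation group of the strings, so it can be summed
    over; all its elements fix [s], and the value at [s] is only multiplied by the order of the
    group. *)
Lemma average t s f : W (mk t f) -> f s != 0 ->
  exists g, [/\ W (mk t g), g s != 0 &
   forall a, sp a t = false -> sp a s = false -> forall u, g (transv a u) = g u].
Proof.
move=> wf fs; pose p (a : pstr q) := perm (can_inj (transvK a)).
pose A := [set p a | a in [pred a | ~~ sp a t & ~~ sp a s]].
pose G := <<A>>%G.
have GQ z : z \in G -> z s = s /\ forall h, W (mk t h) -> W (mk t (fun u => h (z u))).
  move: z; apply: gen_ind => [|_ z /imsetP[a /andP[/negPf at_ /negPf as_] ->] [gs hg]].
    split=> [|h wh]; first by rewrite perm1.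
    by rewrite (@mk_eq t _ h) // => u; rewrite perm1.
  split=> [|h wh]; first by rewrite permM permE transv_fix.
  rewrite (@mk_eq t _ (fun u => h (z (transv a u)))) => [|u]; last by rewrite permM permE.
  by apply: (trans_mk (f := fun u => h (z u))) => //; apply: hg.
exists (fun u => \sum_(z in G) f (z u)); split.
- rewrite -mk_sum; apply: subspace_sum => z zG; by have [_] := GQ z zG; apply.
- rewrite (eq_bigr (fun _ => f s)) => [|z /GQ[-> _] //].
  by rewrite sumr_const mulrn_eq0 negb_or fs andbT -lt0n cardG_gt0.
- move=> a at_ as_ u; have pG : p a \in G.
    by apply/mem_gen/imsetP; exists a; rewrite // inE at_ as_.
  rewrite [RHS](reindex_inj (mulgI (p a))) /=; apply: eq_big => [z|z _].
    by rewrite groupMl.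
  by rewrite permM permE.
Qed.
End Subspaces.

(** The eigenvalue equation is asked on the support only. This matters for [mu = 0]: as [Ht] squares
    to d ^ 2, the transform of a nonzero [f] cannot vanish everywhere. *)
Definition Fam Om (e mu : C) t f :=
  [/\ forall s, ~~ Om t s -> f s = 0, forall s, f (s +^ t) = e * f s,
      forall s, Om t s -> Ht f s = mu * f s & \sum_s f s = 0].
Definition FamV Om e mu : Defs.space R q := fun x => forall t, Fam Om e mu t (co x t).
Definition LineV Om : Defs.space R q := fun x => exists h, forall t s, co x t s = (Om t s)%:R * h t.

Lemma HtD f g s : Ht (fun r => f r + g r) s = Ht f s + Ht g s.
Proof. by rewrite /Ht -big_split; apply: eq_bigr => r _; rewrite mulrDr. Qed.
Lemma HtZ c f s : Ht (fun r => c * f r) s = c * Ht f s.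
Proof. by rewrite /Ht mulr_sumr; apply: eq_bigr => r _; rewrite mulrCA. Qed.
Lemma Ht_eq f g s : f =1 g -> Ht f s = Ht g s.
Proof. by move=> e; apply: eq_bigr => r _; rewrite e. Qed.

Lemma Fam_eq Om e mu t f g : f =1 g -> Fam Om e mu t f -> Fam Om e mu t g.
Proof.
move=> E [h1 h2 h3 h4]; split=> [s|s|s|]; rewrite -?E; [exact: h1|exact: h2| |].
  by rewrite -(Ht_eq s E); apply: h3.
by rewrite (eq_bigr f).
Qed.

Lemma FamD Om e mu t f g : Fam Om e mu t f -> Fam Om e mu t g ->
  Fam Om e mu t (fun s => f s + g s).
Proof.
move=> [h1 h2 h3 h4] [k1 k2 k3 k4]; split=> [s o|s|s o|].
- by rewrite h1 ?k1 ?addr0.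
- by rewrite h2 k2 mulrDr.
- by rewrite HtD h3 ?k3 ?mulrDr.
- by rewrite big_split /= h4 k4 addr0.
Qed.

Lemma FamZ Om e mu t c f : Fam Om e mu t f -> Fam Om e mu t (fun s => c * f s).
Proof.
move=> [h1 h2 h3 h4]; split=> [s o|s|s o|].
- by rewrite h1 ?mulr0.
- by rewrite h2 mulrCA.
- by rewrite HtZ h3 // mulrCA.
- by rewrite -mulr_sumr h4 mulr0.
Qed.

Lemma Fam0 Om e mu t : Fam Om e mu t (fun=> 0).
Proof.
split=> [//|s|s _|]; rewrite ?mulr0 //; last by rewrite big1.
by rewrite /Ht big1 // => r _; rewrite mulr0.
Qed.

Lemma FamV_sub Om e mu : subspace (FamV Om e mu).
Proof.
split=> [t|]; first by apply: Fam_eq (Fam0 _ _ _ _) => s; rewrite co0.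
split=> [x y hx hy t|c x hx t].
  by apply: Fam_eq (FamD (hx t) (hy t)) => s; rewrite coD.
by apply: Fam_eq (FamZ c (hx t)) => s; rewrite coZ.
Qed.

Lemma LineV_sub Om : subspace (LineV Om).
Proof.
split; first by exists (fun=> 0) => t s; rewrite co0 mulr0.
split=> [x y [h hh] [k hk]|c x [h hh]].
  by exists (fun t => h t + k t) => t s; rewrite coD hh hk mulrDr.
by exists (fun t => c * h t) => t s; rewrite coZ hh mulrCA.
Qed.

Definition equivariant Om := forall pi : pstr q -> pstr q,
  injective pi -> (forall s t, pi (s +^ t) = pi s +^ pi t) ->
  (forall s t, sp (pi s) (pi t) = sp s t) -> forall t s, Om (pi t) (pi s) = Om t s.

Lemma FamV_inv Om e mu : equivariant Om -> Defs.invariant (FamV Om e mu).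
Proof.
move=> eO U cU x hx t'; have [pi [ep [h piD]]] := clifford_implements cU.
have [_ _ _ hsp inj] := h.
have [pi' K1 K2] := injF_bij inj.
have co' s : co (act2 U x) t' s = ep (pi' t') * co x (pi' t') (pi' s).
  by rewrite -(co_act2 _ _ _ h) !K2.
have O' s : Om t' s = Om (pi' t') (pi' s) by rewrite -{1}(K2 t') -{1}(K2 s) eO.
have D' s t : pi' (s +^ t) = pi' s +^ pi' t.
  by apply: inj; rewrite piD !K2.
have [h1 h2 h3 h4] := hx (pi' t'); split=> [s|s|s|].
- by rewrite O' co' => /h1 ->; rewrite mulr0.
- by rewrite !co' D' h2 mulrCA.
- rewrite O' => /h3; rewrite co' mulrCA => <-.
  rewrite /Ht mulr_sumr (reindex_inj inj); apply: eq_bigr => r _.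
  by rewrite co' K1 mulrCA /chi -{1}(K2 s) hsp.
- transitivity (\sum_s ep (pi' t') * co x (pi' t') s); last by rewrite -mulr_sumr h4 mulr0.
  by rewrite (reindex_inj inj); apply: eq_bigr => r _; rewrite co' K1.
Qed.

Lemma LineV_inv Om : equivariant Om -> Defs.invariant (LineV Om).
Proof.
move=> eO U cU x [k hk]; have [pi [ep [h piD]]] := clifford_implements cU.
have [_ _ _ hsp inj] := h.
have [pi' K1 K2] := injF_bij inj.
exists (fun t => ep (pi' t) * k (pi' t)) => t s.
by rewrite -{1}(K2 t) -{1}(K2 s) (co_act2 _ _ _ h) hk mulrCA -(eO pi) // !K2.
Qed.

Lemma co_neq0 x : x != 0 -> exists t s, co x t s != 0.
Proof.
move=> x0; have /existsP[t /existsP[s h]] : [exists t, exists s, co x t s != 0]; last by exists t, s.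
apply: contraNT x0 => /existsPn h; apply/eqP/co_inj => t s; rewrite co0.
by have /existsPn/(_ s) := h t; rewrite negbK => /eqP.
Qed.

(** Membership in [W] is an arbitrary proposition, hence the appeal to excluded middle. *)
Lemma irr_dich (V W : Defs.space R q) :
  (forall x, W x -> x != 0 -> forall y, V y -> W y) ->
  (forall x, W x -> x = 0) \/ (forall x, V x -> W x).
Proof.
move=> h; have [[x [wx x0]]|n] := boolp.EM (exists x, W x /\ x != 0).
  by right; apply: h wx x0.
by left=> x wx; apply/eqP; have [//|x0] := eqVneq x 0; case: n; exists x.
Qed.

(** Each fibre is at most one-dimensional, so one weight projection yields its generator. The fibres
    that occur lie over the identity alone or over nonidentity strings only, and transvections are
    transitive on these. *)
Lemma LineV_irr Om (W : Defs.space R q) : equivariant Om ->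
  (forall t s t' s', Om t s -> Om t' s' -> (t == pid q) = (t' == pid q)) ->
  subspace W -> (forall x, W x -> LineV Om x) -> Defs.invariant W ->
  (forall x, W x -> x = 0) \/ (forall x, LineV Om x -> W x).
Proof.
move=> eO tO sW WV iW; apply: irr_dich => x wx /co_neq0[t [s xts]] y [k hk].
have [h hh] := WV x wx.
have [ots ht0] : Om t s /\ h t != 0.
  by move: xts; rewrite hh; case: (Om t s); rewrite ?mul0r ?eqxx // mul1r.
pose K t s : C := (Om t s)%:R.
have wK : W (mk t (K t)).
  apply: (subspaceZI sW ht0); rewrite mkZ; rewrite (@mk_eq _ _ (co x t)) => [|r].
    exact: weight_proj.
  by rewrite hh mulrC.
rewrite (mkE y); apply: (subspace_sum sW) => t' _.
rewrite (@mk_eq _ _ (fun s => k t' * K t' s)) => [|r]; last by rewrite hk mulrC.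
rewrite -mkZ.
have [/existsP[s' os']|no] := boolP [exists s', Om t' s'].
  apply: (subspaceZ sW); apply: (@transv_trans_nz _ (fun u => W (mk u (K u))) t _ _ _ wK).
    move=> a u wu; apply: (trans_mk_move sW iW _ wu) => r; rewrite /K; congr (_%:R); congr nat_of_bool.
    by apply: eO; [exact: can_inj (transvK a)|exact: transvD|exact: sp_transv].
  exact: tO ots os'.
rewrite mkZ /mk big1 => [|r _]; first exact: subspace0 sW.
by move/existsPn/(_ r)/negPf: no => no; rewrite /K no mulr0 scale0r.
Qed.
End Families.

(** * Irreducibility of the eigenspace families *)

Section FamIrr.
Variable R : realType.
Variable q : nat.
Local Notation C := (Cx R).
Local Notation d := (Defs.dim q).
Implicit Types (s t r u : pstr q) (U : Md R q) (x y : M2 R q) (f g h : pstr q -> C).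
Variable Om : pstr q -> pstr q -> bool.
Hypothesis goodOm : [\/ Om = @OmD q, Om = @OmC q | Om = @OmN q].

Lemma good_equivariant : equivariant Om.
Proof.
move=> pi inj piD hsp.
have pi0 : pi (pid q) = pid q by rewrite -{1}(paddss (pid q)) piD paddss.
have pi0E s : (pi s == pid q) = (s == pid q) by rewrite -{1}pi0 (inj_eq inj).
by case: goodOm => -> t s; rewrite /OmD /OmC /OmN ?pi0E ?(inj_eq inj) ?hsp.
Qed.

(** The general function of [r] constant on the orbits of the stabiliser of [t] and [s]: two generic
    values, written with a constant and the character, and corrections at the points [s] and
    [s + t]. *)
Definition ker (k0 k1 k2 k3 : C) t s r : C :=
  if Om t r then k0 + k1 * chi R s r + (if r == s then k2 else 0) + (if r == s +^ t then k3 else 0)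
  else 0.

Lemma ker_transv k0 k1 k2 k3 a t s r :
  ker k0 k1 k2 k3 (transv a t) (transv a s) (transv a r) = ker k0 k1 k2 k3 t s r.
Proof. by rewrite /ker /chi Om_transv // -transvD !transv_eq sp_transv. Qed.

Lemma ker_sym k0 k1 k2 k3 t s r : Om t s -> Om t r ->
  ker k0 k1 k2 k3 t s r = ker k0 k1 k2 k3 t r s.
Proof. by move=> os or; rewrite /ker os or chiC ![r == _]eq_sym padd_eq. Qed.

Lemma ker_fixed e mu t s f : Fam Om e mu t f -> Om t s ->
  (forall a, sp a t = false -> sp a s = false -> forall u, f (transv a u) = f u) ->
  exists k0 k1 k2 k3, forall r, f r = ker k0 k1 k2 k3 t s r.
Proof.
move=> [f0 _ _ _] os inv.
have [v hv] : exists v : bool -> C, forall r, Om t r -> r != s -> r != s +^ t -> f r = v (sp s r).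
  pose Q b r := [&& Om t r, r != s, r != s +^ t & sp s r == b].
  (* [v] reads off the value on each of the two generic orbits; 0 stands in for an empty one. *)
  exists (fun b => if [pick r | Q b r] is Some r then f r else 0) => r or rs rst.
  case: pickP => [r' /and4P[or' rs' rst' /eqP e']|/(_ r)]; last by rewrite /Q or rs rst eqxx.
  by move=> /=; apply: (transv_orbit goodOm inv os).
pose k0 := (v false + v true) / 2%:R; pose k1 := (v false - v true) / 2%:R.
have vE r : k0 + k1 * chi R s r = v (sp s r).
  by rewrite /chi /k0 /k1; case: sp; rewrite ?expr0 ?expr1; field.
(* Over the identity, [s + t] is [s], and a second correction would be counted twice. *)
exists k0, k1, (f s - v false), (if s == s +^ t then 0 else f (s +^ t) - v (sp s t)) => r.
rewrite /ker vE; case: (boolP (Om t r)) => [or|/f0 -> //].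
have [->|rs] := eqVneq r s.
  by rewrite spss; case: eqP => _; rewrite addr0 addrC subrK.
have [er|rst] := eqVneq r (s +^ t); last by rewrite !addr0 hv.
have /negPf -> : s != s +^ t by rewrite -er eq_sym.
by rewrite er spDr spss addFb addr0 [RHS]addrC subrK.
Qed.

(** On a family the kernel acts as a scalar: the constant meets the condition of sum 0, the
    character produces [Ht], and the two point corrections give 1 and the parity. *)
Lemma ker_sum k0 k1 k2 k3 e mu t s h : Fam Om e mu t h -> Om t s ->
  \sum_r ker k0 k1 k2 k3 t s r * h r = (k1 * mu + k2 + k3 * e) * h s.
Proof.
move=> [h1 h2 h3 h4] os.
have E r : ker k0 k1 k2 k3 t s r * h r =
    k0 * h r + k1 * (chi R s r * h r) + (if r == s then k2 * h r else 0)
    + (if r == s +^ t then k3 * h r else 0).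
  rewrite /ker; case: (boolP (Om t r)) => [or|/h1 ->]; last by rewrite !mulr0 !if_same !addr0.
  by rewrite !mulrDl mulrA; case: eqP => _; case: eqP => _; rewrite ?mul0r.
have D (u : pstr q) k : \sum_r (if r == u then k * h r else 0) = k * h u.
  by rewrite -big_mkcond big_pred1_eq.
under eq_bigr do rewrite E.
by rewrite !big_split /= !D -!mulr_sumr h4 -/(Ht h s) h3 // h2 mulr0 add0r !mulrDl !mulrA.
Qed.

Lemma Fam_conj e mu t f : conjc e = e -> conjc mu = mu -> Fam Om e mu t f ->
  Fam Om e mu t (fun s => conjc (f s)).
Proof.
move=> ce cmu [h1 h2 h3 h4].
have csum (F : pstr q -> C) : \sum_r conjc (F r) = conjc (\sum_r F r).
  by rewrite (big_morph (@conjc R) (id1 := 0) (op1 := +%R)) ?conjc0 //; exact: rmorphD.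
split=> [s /h1 ->|s|s os|]; first exact: conjc0.
- by rewrite h2 conjcM ce.
- rewrite -{1}cmu -conjcM -h3 // /Ht -csum; apply: eq_bigr => r _.
  by rewrite conjcM chi_conj.
- by rewrite csum h4 conjc0.
Qed.

Lemma sqr_sum_neq0 f s : f s != 0 -> \sum_r f r * conjc (f r) != 0.
Proof.
apply: contra => /eqP h.
have := @psumr_eq0P _ _ predT (fun r => f r * conjc (f r)) (fun r _ => mulcJ_ge0 (f r)) h s isT.
by move/eqP; rewrite mulf_eq0 conjc_eq0 orbb.
Qed.

Lemma FamV_irr e mu (W : Defs.space R q) : conjc e = e -> conjc mu = mu ->
  subspace W -> (forall x, W x -> FamV Om e mu x) -> Defs.invariant W ->
  (forall x, W x -> x = 0) \/ (forall x, FamV Om e mu x -> W x).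
Proof.
move=> ce cmu sW WV iW; apply: irr_dich => x wx /co_neq0[t [s xts]] y hy.
have [f [wf fs inv]] := average sW iW (weight_proj sW iW t wx) xts.
have Ff : Fam Om e mu t f.
  by apply: Fam_eq (WV _ wf t) => r; rewrite co_mk eqxx.
have os : Om t s by apply: contraNT fs => n; case: Ff => /(_ s n) -> _ _ _.
have [k0 [k1 [k2 [k3 fE]]]] := ker_fixed Ff os inv.
pose K := ker k0 k1 k2 k3.
have wK t' s' : Om t' s' -> W (mk t' (K t' s')).
  move=> os'; apply: (transv_trans (P := fun u v => W (mk u (K u v))) goodOm _ os os').
    by move=> a u v wu; apply: (trans_mk_move sW iW _ wu) => r; apply: ker_transv.
  by rewrite (mk_eq _ (fun r => esym (fE r))).
pose m := k1 * mu + k2 + k3 * e.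
(* The kernel at [s] is [f] itself; applied to the conjugate of [f] it gives the squared norm of
   [f], so the scalar cannot be 0. *)
have m0 : m != 0.
  have := ker_sum k0 k1 k2 k3 (Fam_conj ce cmu Ff) os; rewrite -/m => E.
  have := sqr_sum_neq0 fs; rewrite (eq_bigr (fun r => K t s r * conjc (f r))) => [|r _]; last by rewrite {1}fE.
  by rewrite E mulf_eq0 negb_or => /andP[].
rewrite (mkE y); apply: (subspace_sum sW) => t' _.
apply: (subspaceZI sW m0).
(* By symmetry of the kernel, its acting as the scalar [m] expresses the fibre of [y] through the
   vectors [K t' s']. *)
suff -> : m *: mk t' (co y t') = \sum_(s' | Om t' s') co y t' s' *: mk t' (K t' s').
  by apply: (subspace_sum sW) => s' os'; apply/(subspaceZ sW)/wK.
under eq_bigr do rewrite mkZ.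
rewrite mkZ mk_sum; apply: mk_eq => r.
have Fy := hy t'; have [y1 _ _ _] := Fy.
case: (boolP (Om t' r)) => [or|nr]; last first.
  by rewrite y1 // mulr0 big1 // => s' _; rewrite /K /ker (negPf nr) mulr0.
rewrite -(ker_sum k0 k1 k2 k3 Fy or) (bigID (Om t')) /= [X in _ + X]big1 ?addr0.
  by apply: eq_bigr => s' os'; rewrite mulrC /K (ker_sym k0 k1 k2 k3 os' or).
by move=> s' /y1 ->; rewrite mulr0.
Qed.
End FamIrr.

(** * The subspaces of the decomposition *)

Section Characterisation.
Variable R : realType.
Variable q : nat.
Local Notation C := (Cx R).
Local Notation d := (Defs.dim q).
Local Notation sg := (@sig R q).
Local Notation Eb := (@Eb R q).
Local Notation c2 := ((csqrt R 2)^-1).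
Implicit Types (s t r u : pstr q) (U : Md R q) (x y : M2 R q) (f g h : pstr q -> C).
Implicit Types Om : pstr q -> pstr q -> bool.

Definition OmI t s := (t == pid q) && (s == pid q).
Definition OmR t s := (t != pid q) && (s == pid q).
Definition OmL t s := (t != pid q) && (s == t).

Lemma c2_neq0 : c2 != 0 :> C. Proof. by rewrite invr_neq0 ?csqrt_neq0. Qed.
Lemma th_neq0 t s : th R t s != 0.
Proof. by apply/eqP => h; have := th2 R t s; rewrite h mulr0 => /esym/eqP; rewrite oner_eq0. Qed.

Lemma span_line Om (Q : pred (pstr q)) (F : pstr q -> M2 R q) (k : pstr q -> C) x :
  (forall t s, Om t s -> Q t) -> (forall t, k t != 0) ->
  (forall t, Q t -> F t = k t *: mk t (fun s => (Om t s)%:R)) ->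
  spanF Q F x <-> LineV Om x.
Proof.
move=> OQ k0 hF.
have E (c : pstr q -> C) t s : co (\sum_(i | Q i) c i *: F i) t s = (Om t s)%:R * (c t * k t).
  rewrite co_sum; have [Qt|nQ] := boolP (Q t); last first.
    rewrite big1 => [|i Qi]; last first.
      by rewrite coZ hF // coZ co_mk; case: eqP => [e|_]; rewrite ?mulr0 //; move: nQ; rewrite -e Qi.
    have -> : Om t s = false by apply/negP => /OQ Qt; rewrite Qt in nQ.
    exact: esym (mul0r _).
  rewrite (bigD1 t) //= big1 ?addr0 => [|i /andP[Qi /negPf ni]].
    by rewrite coZ hF // coZ co_mk eqxx mulrA mulrC.
  by rewrite coZ hF // coZ co_mk ni !mulr0.
split=> [[c ->]|[h hh]]; first by exists (fun t => c t * k t) => t s; apply: E.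
exists (fun t => h t / k t); apply: co_inj => t s; by rewrite E hh divfK.
Qed.

Lemma span_line1 Om (F : M2 R q) x :
  (forall t s, Om t s -> t = pid q) -> F = mk (pid q) (fun s => (Om (pid q) s)%:R) ->
  spanF (fun _ : unit => true) (fun _ => F) x <-> LineV Om x.
Proof.
move=> O0 ->.
have E (c : C) t s : co (c *: mk (pid q) (fun s => (Om (pid q) s)%:R)) t s = (Om t s)%:R * c.
  rewrite coZ co_mk; case: eqP => [<-|n]; first exact: mulrC.
  rewrite mulr0; have -> : Om t s = false by apply/negP => /O0 e; apply: n.
  exact: esym (mul0r _).
split=> [[c ->]|[h hh]].
  by exists (fun=> c tt) => t s; rewrite (bigD1 tt) //= big1 ?addr0 ?E // => -[].
exists (fun=> h (pid q)); apply: co_inj => t s.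
rewrite (bigD1 tt) //= big1 ?addr0 ?E; last by case.
rewrite hh; case: (boolP (Om t s)) => [/O0 -> //|_]; exact: etrans (mul0r _) (esym (mul0r _)).
Qed.

Lemma mk_delta t (a : pstr q) : mk t (fun s => (s == a)%:R) = Eb t a.
Proof.
rewrite /mk (bigD1 a) //= eqxx scale1r big1 ?addr0 // => s /negPf ->.
exact: scale0r.
Qed.

Lemma V_idP x : V_id x <-> LineV OmI x.
Proof.
apply: span_line1 => [t s /andP[/eqP]//|].
rewrite (@mk_eq _ _ _ _ (fun s => (s == pid q)%:R)) => [|s]; last by rewrite /OmI eqxx.
by rewrite mk_delta sigma0E tens_Eb paddss /th ph_ss /iota spss mulr1 scale1r.
Qed.

Lemma V_rP x : V_r x <-> LineV OmR x.
Proof.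
apply: (span_line (k := fun t => th R t (pid q))) => [t s /andP[]//|t|t t0]; first exact: th_neq0.
rewrite (@mk_eq _ _ _ _ (fun s => (s == pid q)%:R)) => [|s]; last by rewrite /OmR -[t != _]/(nid t) t0.
by rewrite mk_delta sigma0E tens_Eb add0p.
Qed.

Lemma V_lP x : V_l x <-> LineV OmL x.
Proof.
apply: (span_line (k := fun t => th R t t)) => [t s /andP[]//|t|t t0]; first exact: th_neq0.
rewrite (@mk_eq _ _ _ _ (fun s => (s == t)%:R)) => [|s]; last by rewrite /OmL -[t != _]/(nid t) t0.
by rewrite mk_delta sigma0E tens_Eb padd0.
Qed.

Lemma Eb_diag s : Eb (pid q) s = tens (sg s) (sg s).
Proof.
rewrite /Defs.tens !Eb_def /iota sp0r scale1r; congr (tens _ _).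
by rewrite -sigma0E /sigma0 /dotn -scalemxAr mulmx1 scalerA divff ?scale1r // csqrt_neq0 ?dim_gt0.
Qed.

Lemma V_0P x : V_0 x <-> LineV (@OmD q) x.
Proof.
apply: span_line1 => [t s /andP[/eqP]//|].
rewrite /mk big_mkcond; apply: eq_bigr => s _; rewrite /OmD eqxx -Eb_diag -[s != _]/(nid s).
by case: nid => /=; rewrite ?scale1r ?scale0r.
Qed.

Lemma gS_E t s : sp s t = false -> gS R t s = c2 *: (Eb t s + Eb t (s +^ t)).
Proof.
by move=> h; rewrite /gS /Ssym; have := Eb_swap R t s; rewrite !Eb_def h /iota !scale1r => ->.
Qed.

Lemma gA_E t s : sp s t -> gA R t s = c2 *: (Eb t s - Eb t (s +^ t)).
Proof.
by move=> h; rewrite /gA /Ssym; have := Eb_swap R t s; rewrite h expr1 scaleN1r /iota => ->; rewrite !Eb_def h.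
Qed.

Lemma gAA_E t s : sp s t -> Aasym (sg s) (ci R *: dotn (sg s) (sg t)) = c2 *: (Eb t s + Eb t (s +^ t)).
Proof.
by move=> h; rewrite /Aasym; have := Eb_swap R t s; rewrite h expr1 scaleN1r /iota => ->; rewrite opprK !Eb_def h.
Qed.

(** In the uses [e] is 1 or -1 and the generators at [s] and [s + t] agree up to [e], so only the
    combination of their two coefficients is visible. *)
Lemma mk_pair t (Q : pred (pstr q)) (c : pstr q -> C) (e : C) :
  (forall s, Q (s +^ t) = Q s) ->
  \sum_(s | Q s) c s *: (c2 *: (Eb t s + e *: Eb t (s +^ t))) =
  mk t (fun s => if Q s then c2 * (c s + e * c (s +^ t)) else 0).
Proof.
move=> Qt.
transitivity (\sum_(s | Q s) ((c2 * c s) *: Eb t s) + \sum_(s | Q s) (c2 * (e * c s)) *: Eb t (s +^ t)).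
  rewrite -big_split /=; apply: eq_bigr => s _.
  by rewrite scalerA scalerDr scalerA mulrC; congr (_ + _ *: _); rewrite mulrA mulrAC.
rewrite [X in _ + X]big_mkcond -[X in _ + X](sum_shift _ t) -big_mkcond /=.
under [X in _ + X]eq_bigl do rewrite Qt.
rewrite -big_split /= /mk [RHS](bigID Q) /= [X in _ = _ + X]big1 ?addr0 => [|s /negPf ->]; last exact: scale0r.
by apply: eq_bigr => s ->; rewrite paddK mulrDr scalerDl.
Qed.
End Characterisation.

Section Characterisation2.
Variable R : realType.
Variable q : nat.
Local Notation C := (Cx R).
Local Notation d := (Defs.dim q).
Local Notation sg := (@sig R q).
Local Notation Eb := (@Eb R q).
Local Notation c2 := ((csqrt R 2)^-1).
Implicit Types (s t r u : pstr q) (U : Md R q) (x y : M2 R q) (f g h : pstr q -> C).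
Implicit Types Om : pstr q -> pstr q -> bool.

Lemma inC_nz t s : nid t -> inC R t s = OmC t s.
Proof. by rewrite /nid inCE /OmC => ->. Qed.

Lemma inN_Om t s : inN R t s = OmN t s.
Proof. by rewrite inNE /OmN; case: eqP => [->|//]; rewrite sp0r. Qed.

Lemma inN_shift t s : inN R t (s +^ t) = inN R t s.
Proof. by rewrite !inNE spDl spss addbF. Qed.

Lemma inC_shift t s : t != pid q -> inC R t (s +^ t) = inC R t s.
Proof. by move=> t0; rewrite !inC_nz // Om_padd //; constructor 2. Qed.

Lemma V_bradjP x : V_bradj x <-> LineV (@OmC q) x.
Proof.
(* Each basis vector of the fibre arises from [s] and from [s + t], hence the 2. *)
apply: (span_line (k := fun=> c2 * 2%:R)) => [t s /and4P[]//|_|t t0].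
  by rewrite mulf_neq0 ?c2_neq0 ?pnatr_eq0.
rewrite mkZ; transitivity (\sum_(s | inC R t s) 1 *: (c2 *: (Eb t s + 1 *: Eb t (s +^ t)))).
  apply: eq_bigr => s; rewrite inCE => /and3P[_ _ /negPf h].
  by rewrite !scale1r -gS_E.
rewrite mk_pair => [|s]; last exact: inC_shift.
apply: mk_eq => s; rewrite inC_nz // mul1r; case: OmC; last by rewrite mulr0.
by rewrite [RHS]mulr1.
Qed.

Lemma V_cbadjP x : V_cbadj x <-> LineV (@OmN q) x.
Proof.
apply: (span_line (k := fun=> c2 * 2%:R)) => [t s /andP[]//|_|t t0].
  by rewrite mulf_neq0 ?c2_neq0 ?pnatr_eq0.
rewrite mkZ; transitivity (\sum_(s | inN R t s) 1 *: (c2 *: (Eb t s + 1 *: Eb t (s +^ t)))).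
  by apply: eq_bigr => s; rewrite inNE => h; rewrite !scale1r -gAA_E.
rewrite mk_pair => [|s]; last exact: inN_shift.
apply: mk_eq => s; rewrite inN_Om mul1r; case: OmN; last by rewrite mulr0.
by rewrite [RHS]mulr1.
Qed.

(** The link to the sums over [N] in the definitions: for a function of sum 0, a sum of eps (d / 2)
    f(s) over the strings anticommuting with [s] means the eigenvalue - eps d. *)
Lemma Ht_split f s : Ht f s = \sum_r f r - 2%:R * \sum_(r | sp s r) f r.
Proof.
rewrite /Ht (bigID (sp s)) /= [X in _ = X - _](bigID (sp s)) /=.
under eq_bigr => r h do rewrite /chi h expr1 mulN1r.
under [X in _ + X]eq_bigr => r h do rewrite /chi (negPf h) expr0 mul1r.
by rewrite sumrN; ring.
Qed.

Lemma mk_inj t f g : mk t f = mk t g -> f =1 g.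
Proof. by move=> e s; have := congr1 (fun x => co x t s) e; rewrite !co_mk eqxx. Qed.

Lemma sumsp_FamV Om e mu (W : pstr q -> Defs.space R q) x :
  (forall s, Om (pid q) s = false) ->
  (forall t y, nid t -> W t y <-> exists f, Fam Om e mu t f /\ y = mk t f) ->
  sumsp W x <-> FamV Om e mu x.
Proof.
move=> O0 hW; split=> [[v [hv ->]] t|hx].
  have vE t' t0 : nid t' -> co (v t') t0 =1 fun s => if t' == t0 then co (v t') t0 s else 0.
    by move=> n' s; have [f [_ ->]] := (hW t' (v t') n').1 (hv t' n'); rewrite !co_mk; case: eqP.
  have [nt|nt] := boolP (nid t); last first.
    apply: Fam_eq (Fam0 _ _ _ _) => s; rewrite co_sum big1 // => t' n'.
    by rewrite vE //; case: eqP => // e'; rewrite e' (negPf nt) in n'.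
  have [f [Ff ef]] := (hW t (v t) nt).1 (hv t nt).
  apply: Fam_eq Ff => s; rewrite co_sum (bigD1 t) //= big1 ?addr0 => [|t' /andP[n' /negPf e']].
    by rewrite ef co_mk eqxx.
  by rewrite vE // e'.
exists (fun t => mk t (co x t)); split=> [t nt|]; first by apply/(hW t _ nt); exists (co x t).
rewrite {1}(mkE x) (bigID (@nid q)) /= [X in _ + X]big1 ?addr0 // => t.
rewrite negbK => /eqP ->; have [h _ _ _] := hx (pid q).
by rewrite /mk big1 // => s _; rewrite h ?O0 // scale0r.
Qed.

Lemma V_epsP (eps : C) x : V_eps eps x <-> FamV (@OmD q) 1 (- eps * d%:R) x.
Proof.
have E (lam : pstr q -> C) : \sum_(s | nid s) lam s *: tens (sg s) (sg s) =
    mk (pid q) (fun s => if nid s then lam s else 0).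
  by rewrite /mk big_mkcond; apply: eq_bigr => s _; rewrite -Eb_diag; case: nid; rewrite ?scale0r.
split=> [[lam [-> [h0 h]]] t|hx].
  rewrite E; have [<-|nt] := eqVneq (pid q) t; last first.
    by apply: Fam_eq (Fam0 _ _ _ _) => s; rewrite co_mk (negPf nt).
  apply: (@Fam_eq _ _ _ _ _ _ (fun s => if nid s then lam s else 0)) => [s|].
    by rewrite co_mk eqxx.
  split=> [s|s|s|]; rewrite /OmD ?eqxx /=.
  - by rewrite negbK /nid => ->.
  - by rewrite padd0 mul1r.
  - move=> ns; rewrite -[s != _]/(nid s) in ns; rewrite ns Ht_split -big_mkcond h0 sub0r.
    have -> : \sum_(r | sp s r) (if nid r then lam r else 0) = \sum_(r | inN R s r) lam r.
      rewrite -big_mkcondr; apply: eq_bigl => r; rewrite inNE spC.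
      by rewrite andb_idr // /nid => h1; apply: contraTneq h1 => ->; rewrite sp0l.
    by rewrite h //; field.
  - by rewrite -big_mkcond.
have [h1 h2 h3 h4] := hx (pid q).
exists (co x (pid q)); rewrite E; split; [|split].
- apply: co_inj => t s; rewrite co_mk; case: eqP => [<-|n]; last first.
    by have [-> //] := hx t; rewrite /OmD; case: eqP n => // ->.
  by case: ifP => // h; apply: h1; rewrite /OmD -[s != _]/(nid s) h andbF.
- rewrite big_mkcond -[RHS]h4; apply: eq_bigr => s _; case: ifP => // h.
  by rewrite h1 // /OmD -[s != _]/(nid s) h andbF.
move=> t nt; have := h3 t; rewrite /OmD eqxx -[t != _]/(nid t) nt => /(_ isT).
rewrite Ht_split h4 sub0r => e.
have -> : \sum_(s | inN R t s) co x (pid q) s = \sum_(r | sp t r) co x (pid q) r.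
  by apply: eq_bigl => s; rewrite inNE spC.
apply: (@mulfI _ (- 2%:R)); first by rewrite oppr_eq0 pnatr_eq0.
by rewrite mulNr e; field.
Qed.

(** Reindexing by the shift multiplies the transform by [chi R r t * e]. Taken at the identity,
    where the transform is the total sum, this also yields conditions of sum 0. *)
Lemma Ht_zero (e : C) t r f : (forall s, f (s +^ t) = e * f s) -> chi R r t * e = -1 -> Ht f r = 0.
Proof.
move=> fe h; have e0 : Ht f r = - Ht f r.
  rewrite {1}/Ht -(sum_shift _ t) -[RHS]mulN1r -h /Ht mulr_sumr; apply: eq_bigr => s _.
  by rewrite fe chiDr; ring.
by move/eqP: e0; rewrite -addr_eq0 -mulr2n mulrn_eq0 => /eqP.
Qed.

Definition ParV Om (e : C) : Defs.space R q := fun x => forall t s,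
  (~~ Om t s -> co x t s = 0) /\ co x t (s +^ t) = e * co x t s.

Lemma ParV_sub Om e : subspace (ParV Om e).
Proof.
split=> [t s|]; first by rewrite !co0 mulr0.
split=> [x y hx hy t s|c x hx t s].
  have [h1 h2] := hx t s; have [k1 k2] := hy t s; rewrite !coD h2 k2 mulrDr; split=> // n.
  by rewrite h1 ?k1 ?addr0.
by have [h1 h2] := hx t s; rewrite !coZ h2 mulrCA; split=> // n; rewrite h1 ?mulr0.
Qed.

Lemma ParV_pair Om (e : C) t s : e * e = 1 -> Om t s -> Om t (s +^ t) ->
  ParV Om e (Eb t s + e *: Eb t (s +^ t)).
Proof.
move=> e2 os ost t' r.
have E r' : co (Eb t s + e *: Eb t (s +^ t)) t' r' =
    ((t == t') && (s == r'))%:R + e * ((t == t') && (s +^ t == r'))%:R.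
  by rewrite (coD (Eb t s) (e *: Eb t (s +^ t))) (coZ e (Eb t (s +^ t))) !co_Eb.
rewrite !E; case: eqP => [<-|_] /=; last by rewrite mulr0 addr0 mulr0.
split=> [no|].
  case: eqP => [es|_]; first by rewrite -es os in no.
  by case: eqP => [es|_]; [rewrite -es ost in no|rewrite mulr0 addr0].
rewrite (padd_eq s) paddK padd_eq mulrDr mulrA e2 mul1r addrC; congr (_ * _ + _).
Qed.

Lemma span_pairs Om (Q : pstr q -> pstr q -> bool) (e : C) (F : pstr q -> pstr q -> M2 R q) x :
  e * e = 1 -> (forall s u, Q s u = Om (s +^ u) s) -> (forall t s, Om t (s +^ t) = Om t s) ->
  (forall s u, Q s u -> F s u = (c2 * th R (s +^ u) s) *: (Eb (s +^ u) s + e *: Eb (s +^ u) u)) ->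
  spanF (fun st : pstr q * pstr q => Q st.1 st.2) (fun st => F st.1 st.2) x <-> ParV Om e x.
Proof.
move=> e2 QO OO hF; split.
  case=> c ->; apply: (subspace_sum (ParV_sub Om e)) => -[s u] /= Qs.
  rewrite hF //; do 2!apply: (subspaceZ (ParV_sub Om e)).
  have oT : Om (s +^ u) s by rewrite -QO.
  by have := ParV_pair e2 oT; rewrite OO padKd; apply.
move=> hx.
(* [th], its own inverse, and [c2] undo the normalisation of [F]; the half is there because a pair
   is met as [(s, u)] and as [(u, s)]. *)
exists (fun st => th R (st.1 +^ st.2) st.1 / c2 / 2%:R * co x (st.1 +^ st.2) st.1).
pose G t s := (co x t s / 2%:R) *: (Eb t s + e *: Eb t (s +^ t)).
transitivity (\sum_t \sum_s G t s).
  have xE : x = \sum_t \sum_s co x t s *: Eb t s by apply: coE.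
  rewrite {1}xE; apply: eq_bigr => t _.
  transitivity (\sum_s ((co x t s / 2%:R) *: Eb t s + (co x t (s +^ t) / 2%:R) *: Eb t (s +^ t))).
    rewrite big_split /= (sum_shift (fun s => (co x t s / 2%:R) *: Eb t s)) -big_split.
    apply: eq_bigr => s _ /=; rewrite -scalerDl; congr (_ *: _).
    by field.
  apply: eq_bigr => s _; rewrite /G scalerDr scalerA; congr (_ + _ *: _).
  by have [_ ->] := hx t s; rewrite -mulrA mulrC.
transitivity (\sum_s \sum_u G (s +^ u) s).
  rewrite exchange_big; apply: eq_bigr => s _.
  by rewrite [LHS](reindex_inj (can_inj (padKd s))).
rewrite pair_bigA /= [RHS]big_mkcond; apply: eq_bigr => -[s u] _ /=.
case: ifP => h; last first.
  by rewrite /G; have [-> //] := hx (s +^ u) s; rewrite ?mul0r ?scale0r // -QO h.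
rewrite hF // /G padKd scalerA; congr (_ *: _).
rewrite -[LHS]mul1r -(th2 R (s +^ u) s); field.
by rewrite th_neq0 andbT; apply: csqrt_neq0.
Qed.

Lemma tens_swap s u : tens (sg u) (sg s) =
  (th R (s +^ u) s * (-1) ^+ sp s u) *: Eb (s +^ u) u.
Proof.
have := Eb_swap R (s +^ u) s; rewrite dotn_sig scalerA tensZl -/(th R (s +^ u) s) padKd.
move=> /(congr1 (fun M => th R (s +^ u) s *: M)); rewrite scalerA th2 scale1r => ->.
by rewrite scalerA spDr spss addFb.
Qed.

Lemma Aasym_E s u : Aasym (sg s) (sg u) =
  (c2 * th R (s +^ u) s) *: (Eb (s +^ u) s + - (-1) ^+ sp s u *: Eb (s +^ u) u).
Proof.
rewrite /Aasym (tens_swap s u) (tens_Eb R s u) -[RHS]scalerA; congr (_ *: _).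
by rewrite scalerDr scalerA mulrN scaleNr.
Qed.

Lemma Ssym_E s u : Ssym (sg s) (sg u) =
  (c2 * th R (s +^ u) s) *: (Eb (s +^ u) s + (-1) ^+ sp s u *: Eb (s +^ u) u).
Proof.
rewrite /Ssym (tens_swap s u) (tens_Eb R s u) -[RHS]scalerA; congr (_ *: _).
by rewrite scalerDr scalerA.
Qed.

Lemma pair_inN s u : nid u && inN R u s = OmN (s +^ u) s.
Proof.
rewrite inNE /nid /OmN padd_eq0 spDr spss addFb; have [->|_] := eqVneq s u; first by rewrite spss andbF.
by rewrite andb_idl // => h; apply: contraTneq h => ->; rewrite sp0r.
Qed.

Lemma pair_inC s u : nid u && inC R u s = OmC (s +^ u) s.
Proof.
rewrite inCE /nid /OmC padd_eq0 spDr spss addFb [s == s +^ u]eq_sym paddC padd_eq paddss.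
by case: (u == _); case: (s == pid q); case: (s == u).
Qed.

Lemma V_brAP x : V_brA x <-> ParV (@OmC q) (-1) x.
Proof.
apply: (@span_pairs _ (fun s u => nid u && inC R u s) _ (fun s u => Aasym (sg s) (sg u))).
- by rewrite mulrNN mulr1.
- exact: pair_inC.
- by move=> t s; apply: Om_padd; constructor 2.
- by move=> s u /andP[_]; rewrite inCE => /and3P[_ _ /negPf h]; rewrite Aasym_E h.
Qed.

Lemma V_cbAP x : V_cbA x <-> ParV (@OmN q) 1 x.
Proof.
apply: (@span_pairs _ (fun s u => nid u && inN R u s) _ (fun s u => Aasym (sg s) (sg u))).
- by rewrite mulr1.
- exact: pair_inN.
- by move=> t s; apply: Om_padd; constructor 3.
- by move=> s u /andP[_]; rewrite inNE => h; rewrite Aasym_E h expr1 opprK.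
Qed.

Lemma V_cbSP x : V_cbS x <-> ParV (@OmN q) (-1) x.
Proof.
apply: (@span_pairs _ (fun s u => nid u && inN R u s) _ (fun s u => Ssym (sg s) (sg u))).
- by rewrite mulrNN mulr1.
- exact: pair_inN.
- by move=> t s; apply: Om_padd; constructor 3.
- by move=> s u /andP[_]; rewrite inNE => h; rewrite Ssym_E h expr1.
Qed.

Lemma FamV_ParV Om e mu x : FamV Om e mu x -> ParV Om e x.
Proof. by move=> h t s; have [h1 h2 _ _] := h t; split; [apply: h1|apply: h2]. Qed.

(** Oddness alone gives sum 0, and the eigenvalue 0 because the strings in the fibre commute with
    [t]. *)
Lemma ParV_C x : ParV (@OmC q) (-1) x <-> FamV (@OmC q) (-1) 0 x.
Proof.
split=> [h t|]; last exact: FamV_ParV.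
have he s : co x t (s +^ t) = -1 * co x t s by have [] := h t s.
split=> [s||s /and4P[_ _ _ /negPf o]|]; [by have [] := h t s|exact: he| |].
  by rewrite (Ht_zero he) ?mul0r // /chi o expr0 mul1r.
by rewrite -Ht_pid (Ht_zero he) // /chi sp0l expr0 mul1r.
Qed.

Lemma V_brA_FamV x : V_brA x <-> FamV (@OmC q) (-1) 0 x.
Proof. by rewrite V_brAP ParV_C. Qed.

(** The sum of an even function over a fibre may be nonzero; its vanishing is what orthogonality to
    [V_cbadj] amounts to. *)
Lemma ParV_N x : ParV (@OmN q) 1 x /\ (forall t, \sum_s co x t s = 0) <-> FamV (@OmN q) 1 0 x.
Proof.
split=> [[h h0] t|h]; last by split=> [|t]; [exact: FamV_ParV h|case: (h t)].
have he s : co x t (s +^ t) = 1 * co x t s by have [] := h t s.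
split=> [s||s /andP[_ o]|//]; [by have [] := h t s|exact: he|].
by rewrite (Ht_zero he) ?mul0r // /chi o expr1 mulr1.
Qed.

Lemma hs_suml (I : Type) (l : seq I) (F : I -> M2 R q) x :
  hs (\sum_(i <- l) F i) x = \sum_(i <- l) hs (F i) x.
Proof.
apply: (big_morph (fun A => hs A x)) => [A B|]; first by rewrite /hs daggerD mulmxDl mxtraceD.
by rewrite hsE big1 // => i _; rewrite big1 // => j _; rewrite mxE conjc0 mul0r.
Qed.

Lemma hs_mk t f x : hs (mk t f) x = \sum_s conjc (f s) * co x t s.
Proof.
rewrite /mk hs_suml; apply: eq_bigr => s _.
by rewrite /hs daggerZ -scalemxAl mxtraceZ.
Qed.

Lemma V_perp_FamV x : V_cbadj_perp x <-> FamV (@OmN q) 1 0 x.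
Proof.
rewrite -ParV_N /V_cbadj_perp V_cbAP.
have E t : ParV (@OmN q) 1 x -> hs (mk t (fun s => (OmN t s)%:R)) x = \sum_s co x t s.
  move=> h; rewrite hs_mk; apply: eq_bigr => s _.
  case: (boolP (OmN t s)) => [_|n]; first by rewrite conjc1 mul1r.
  by rewrite (h t s).1 ?mulr0.
split=> -[h h0]; (split; first by []); [move=> t|move=> y /V_cbadjP[k hk]].
  rewrite -E //; apply: h0; apply/V_cbadjP; exists (fun t' => if t == t' then 1 else 0) => t' s.
  by rewrite co_mk; case: eqP => [<-|_]; rewrite ?mulr1 ?mulr0.
have -> : hs y x = \sum_t conjc (k t) * hs (mk t (fun s => (OmN t s)%:R)) x.
  rewrite {1}(mkE y) hs_suml; apply: eq_bigr => t _.
  rewrite !hs_mk mulr_sumr; apply: eq_bigr => s _.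
  by rewrite hk conjcM mulrA; congr (_ * _); rewrite mulrC.
by rewrite big1 // => t _; rewrite E // h0 mulr0.
Qed.
End Characterisation2.

(** * The eigenspaces of T and A on a fibre *)

Section Eigen.
Variable R : realType.
Variable q : nat.
Local Notation C := (Cx R).
Local Notation d := (Defs.dim q).
Local Notation Eb := (@Eb R q).
Local Notation c2 := ((csqrt R 2)^-1).
Implicit Types (s t r u : pstr q) (x y : M2 R q) (f g h c : pstr q -> C).

Lemma c2K (z : C) : c2 * (z / (2%:R * c2)) = z / 2%:R.
Proof. by have := c2_neq0 R; move: (c2) => k k0; field. Qed.

Lemma half2 (z : C) : z / 2%:R + z / 2%:R = z. Proof. by field. Qed.

Lemma gS_mk t c : t != pid q -> \sum_(s | inC R t s) c s *: gS R t s =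
  mk t (fun s => if inC R t s then c2 * (c s + c (s +^ t)) else 0).
Proof.
move=> t0; rewrite -(@mk_eq _ _ _ (fun s => if inC R t s then c2 * (c s + 1 * c (s +^ t)) else 0)) => [|s].
  rewrite -mk_pair => [|s]; last exact: inC_shift.
  apply: eq_bigr => s; rewrite inCE => /and3P[_ _ /negPf h].
  by rewrite scale1r gS_E.
by rewrite mul1r.
Qed.

Lemma gA_mk t c : \sum_(s | inN R t s) c s *: gA R t s =
  mk t (fun s => if inN R t s then c2 * (c s - c (s +^ t)) else 0).
Proof.
rewrite -(@mk_eq _ _ _ (fun s => if inN R t s then c2 * (c s + -1 * c (s +^ t)) else 0)) => [|s].
  rewrite -mk_pair => [|s]; last exact: inN_shift.
  by apply: eq_bigr => s; rewrite inNE => h; rewrite scaleN1r gA_E.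
by rewrite mulN1r.
Qed.

(** The image has equal coefficients at [r] and [r + t], since [s] commutes with [t]; this doubling
    absorbs the factor 1/2 in [T_gen]. *)
Lemma T_mk t c : t != pid q -> \sum_(s | inC R t s) c s *: T_gen R t s =
  mk t (fun r => if inC R t r then c2 * (\sum_(s | inC R t s && sp r s) c s) else 0).
Proof.
move=> t0; pose c' r := (\sum_(s | inC R t s && sp r s) c s) / 2%:R.
transitivity (\sum_(r | inC R t r) c' r *: gS R t r).
  under eq_bigr => s _ do rewrite /T_gen scalerA scaler_sumr.
  rewrite (exchange_big_dep (inC R t)) /= => [|s r _ /andP[]//].
  apply: eq_bigr => r qr; rewrite /c' mulr_suml scaler_suml.
  by apply: eq_bigl => s; rewrite qr inNE.
rewrite gS_mk //; apply: mk_eq => r; case: ifP => // qr; congr (_ * _).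
have -> : c' (r +^ t) = c' r.
  rewrite /c'; congr (_ / _); apply: eq_bigl => s; rewrite spDl.
  case: (boolP (inC R t s)) => //; rewrite inCE => /and3P[_ _ /negPf h].
  by rewrite (spC t) h addbF.
exact: half2.
Qed.

(** The difference of the two sums in [A_gen] is the character kernel restricted to the fibre; the 2
    comes from the oddness of the image under the shift. *)
Lemma A_mk t c : \sum_(s | inN R t s) c s *: A_gen R t s =
  mk t (fun r => if inN R t r then c2 * (2%:R * \sum_(s | inN R t s) chi R r s * c s) else 0).
Proof.
pose c' r := \sum_(s | inN R t s) chi R r s * c s.
transitivity (\sum_(r | inN R t r) c' r *: gA R t r).
  transitivity (\sum_(s | inN R t s) \sum_(r | inN R t r) (chi R r s * c s) *: gA R t r).
    apply: eq_bigr => s _; rewrite /A_gen scalerBr !scaler_sumr.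
    rewrite [RHS](bigID (fun r => commb R r s)) /= -sumrN; congr (_ + _).
      by apply: eq_bigr => r /andP[_]; rewrite commbE /chi => /negPf ->; rewrite expr0 mul1r.
    apply: eq_big => [r|r /andP[_]]; first by rewrite commbE negbK [inN R s r]inNE.
    by rewrite inNE /chi => ->; rewrite expr1 mulN1r scaleNr.
  rewrite exchange_big; apply: eq_bigr => r _.
  by rewrite /c' scaler_suml.
rewrite gA_mk; apply: mk_eq => r; case: ifP => // qr; congr (_ * _).
have -> : c' (r +^ t) = - c' r.
  rewrite /c' -sumrN; apply: eq_bigr => s; rewrite inNE => h.
  by rewrite chiDl {2}/chi (spC t) h expr1 mulrN1 mulNr.
by rewrite /c'; ring.
Qed.

(** The equation determines [Ht f] up to the sum S of [f]: it is S - 4 lam f on the fibre, S at the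
    identity and at [t], and 0 at strings anticommuting with [t]. Transforming again at the
    identity, where [f] is 0, gives (d ^ 2 - 8 lam) S = 0, which forces S = 0. *)
Lemma eig_br lam t y : nid t -> d%:R * d%:R != 8%:R * lam ->
  eigsp (inC R t) (gS R t) (T_gen R t) lam y <->
  exists f, Fam (@OmC q) 1 (- (4%:R * lam)) t f /\ y = mk t f.
Proof.
move=> nt ne; have t0 : t != pid q by [].
have QO s := inC_nz R s nt.
split=> [[c [yE]]|[f [[h1 h2 h3 h4] ->]]].
  pose f s := if inC R t s then c2 * (c s + c (s +^ t)) else 0.
  rewrite yE T_mk // gS_mk // -/f mkZ => /mk_inj eT.
  exists f; split; last by [].
  have fO s : ~~ OmC t s -> f s = 0 by rewrite /f QO => /negPf ->.
  have fe s : f (s +^ t) = 1 * f s.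
    by rewrite /f inC_shift // mul1r paddK [c (s +^ t) + _]addrC.
  have fH r : inC R t r -> Ht f r = \sum_s f s - 4%:R * lam * f r.
    move=> qr; rewrite Ht_split; congr (_ - _).
    have := eT r; rewrite qr -mulrA => <-.
    suff -> : \sum_(s | sp r s) f s = 2%:R * (c2 * \sum_(s | inC R t s && sp r s) c s) by ring.
    transitivity (\sum_(s | inC R t s && sp r s) c2 * (c s + c (s +^ t))).
      by rewrite -big_mkcondr /=; apply: eq_bigl => s; rewrite andbC.
    rewrite -mulr_sumr mulrCA; congr (_ * _); rewrite big_split /= mulr_natl mulr2n; congr (_ + _).
    have /negPf rt : ~~ sp r t by move: qr; rewrite inCE => /and3P[].
    rewrite big_mkcond [RHS]big_mkcond -[RHS](sum_shift _ t); apply: eq_bigr => s _.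
    by rewrite inC_shift // spDr rt addbF.
  have S0 : \sum_s f s = 0.
    have e0 : f (pid q) = 0 by rewrite fO // /OmC eqxx andbF.
    have et : f t = 0 by rewrite fO // /OmC eqxx !andbF.
    have H s : Ht f s = (1 + chi R s t) / 2%:R * (\sum_s f s) - 4%:R * lam * f s.
      have [qs|nqs] := boolP (inC R t s).
        rewrite fH //; move: qs; rewrite inCE /chi => /and3P[_ _ /negPf ->].
        by rewrite expr0; field.
      have fs : f s = 0 by apply: fO; rewrite -QO.
      rewrite fs mulr0 subr0; case: (boolP (sp s t)) => st.
        by rewrite (Ht_zero fe) /chi st expr1 ?mulr1 // subrr mul0r mul0r.
      rewrite /chi (negPf st) expr0 -[1 + 1]/(2%:R) divff ?pnatr_eq0 // mul1r.
      move: nqs; rewrite inCE st andbT negb_and !negbK => /orP[]/eqP ->; first exact: Ht_pid.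
      apply: eq_bigr => r _; rewrite /chi; case: (boolP (sp t r)) => tr; last by rewrite expr0 mul1r.
      by rewrite fO ?mulr0 // /OmC spC tr !andbF.
    have hs : \sum_s chi R s t = 0.
      by under eq_bigr do rewrite chiC; rewrite chi_sum (negPf t0).
    have := HtK f (pid q); rewrite e0 mulr0 Ht_pid.
    under eq_bigr do rewrite H.
    rewrite sumrB -mulr_suml -mulr_suml -mulr_sumr big_split /=.
    rewrite hs addr0 sumr_const card_pstr => e.
    have /eqP : (d%:R * d%:R - 8%:R * lam) * \sum_s f s = 0.
      transitivity (2%:R * (d%:R * d%:R / 2%:R * (\sum_s f s) - 4%:R * lam * \sum_s f s)); last by rewrite e mulr0.
      by field.
    by rewrite mulf_eq0 subr_eq0 (negPf ne) => /eqP.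
  split=> // r; rewrite -QO => qr.
  by rewrite fH // S0 sub0r mulNr.
(* The coefficient is counted at [s] and at [s + t], each time with weight [c2]. *)
exists (fun s => f s / (2%:R * c2)).
have fE : mk t f = mk t (fun s => if inC R t s then c2 * (f s / (2%:R * c2) + f (s +^ t) / (2%:R * c2)) else 0).
  apply: mk_eq => s; rewrite QO; case: ifP => [_|/negbT /h1 //].
  by rewrite h2 mul1r mulrDr !c2K half2.
split; first by rewrite gS_mk.
rewrite T_mk // mkZ; apply: mk_eq => r; rewrite QO; case: ifP => [os|/negbT /h1 ->]; last by rewrite mulr0.
rewrite -mulr_suml c2K; have := h3 r os; rewrite Ht_split h4 sub0r.
have -> : \sum_(s | inC R t s && sp r s) f s = \sum_(s | sp r s) f s.
  rewrite [RHS](bigID (inC R t)) /= [X in _ = _ + X]big1 ?addr0 => [|s /andP[_]].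
    by apply: eq_bigl => s; rewrite andbC.
  by rewrite QO => /h1.
move=> e; apply: (@mulfI _ (- (2%:R * 2%:R))); first by rewrite oppr_eq0 mulf_neq0 ?pnatr_eq0.
transitivity (- (2%:R * \sum_(s | sp r s) f s)); first by field.
by rewrite e; ring.
Qed.

(** In contrast to the commuting case, sum 0 comes from oddness, for every [mu]. *)
Lemma eig_cb mu t y :
  eigsp (inN R t) (gA R t) (A_gen R t) mu y <->
  exists f, Fam (@OmN q) (-1) mu t f /\ y = mk t f.
Proof.
have QO s := inN_Om R t s.
split=> [[c [yE]]|[f [[h1 h2 h3 h4] ->]]].
  pose f s := if inN R t s then c2 * (c s - c (s +^ t)) else 0.
  rewrite yE A_mk gA_mk -/f mkZ => /mk_inj eA.
  exists f; split; last by [].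
  have fe s : f (s +^ t) = -1 * f s.
    rewrite /f inN_shift mulN1r paddK; case: ifP => _; last by rewrite oppr0.
    by rewrite -mulrN opprB.
  split=> // [s|r|].
  - by rewrite /f QO => /negPf ->.
  - rewrite -QO => qr; have := eA r; rewrite qr => <-.
    transitivity (\sum_(s | inN R t s) chi R r s * (c2 * (c s - c (s +^ t)))).
      by rewrite [RHS]big_mkcond; apply: eq_bigr => s _; rewrite /f; case: ifP => // _; rewrite mulr0.
    under eq_bigr => s _ do rewrite mulrCA mulrBr.
    rewrite -mulr_sumr; congr (_ * _); rewrite big_split /= mulr_natl mulr2n; congr (_ + _).
    rewrite big_mkcond -(sum_shift _ t) [RHS]big_mkcond; apply: eq_bigr => s _.
    rewrite inN_shift paddK; case: ifP => //; rewrite inNE in qr; move=> _.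
    by rewrite chiDr {2}/chi qr expr1 mulrN1 mulNr opprK.
  - by rewrite -Ht_pid (Ht_zero fe) // /chi sp0l expr0 mul1r.
exists (fun s => f s / (2%:R * c2)).
have fE : mk t f = mk t (fun s => if inN R t s then c2 * (f s / (2%:R * c2) - f (s +^ t) / (2%:R * c2)) else 0).
  apply: mk_eq => s; rewrite QO; case: ifP => [_|/negbT /h1 //].
  by rewrite h2 mulN1r mulNr opprK mulrDr !c2K half2.
split; first by rewrite gA_mk.
rewrite A_mk mkZ; apply: mk_eq => r; rewrite QO; case: ifP => [os|/negbT /h1 ->]; last by rewrite mulr0.
have -> : \sum_(s | inN R t s) chi R r s * (f s / (2%:R * c2)) = Ht f r / (2%:R * c2).
  rewrite /Ht mulr_suml [RHS](bigID (inN R t)) /= [X in _ = _ + X]big1 ?addr0 => [|s].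
    by apply: eq_bigr => s _; rewrite mulrA.
  by rewrite QO => /h1 ->; rewrite mulr0 mul0r.
by rewrite h3 // mulrCA c2K mulrC divfK ?pnatr_eq0.
Qed.
End Eigen.

(** * Direct sum *)

Section Blocks.
Variable R : realType.
Variable q : nat.
Local Notation C := (Cx R).
Local Notation d := (Defs.dim q).
Local Notation dC := (d%:R : C).
Implicit Types Om : pstr q -> pstr q -> bool.
Implicit Types (s t r u : pstr q) (x y : M2 R q) (f g h c : pstr q -> C).

Lemma dC0 : dC != 0. Proof. exact: dim_neq0. Qed.

Lemma FamV_eq0 Om (e mu : C) x : (forall t s, Om t s -> co x t s = 0) -> FamV Om e mu x -> x = 0.
Proof.
move=> h hx; apply: co_inj => t s; rewrite co0.
by case: (boolP (Om t s)) => [/h //|]; case: (hx t) => h1 _ _ _ /h1.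
Qed.

(** Summing over a fibre leaves only [x0], which is constant there. Then [Ht] on the support kills
    [x3] and gives [x1 = x2]; with [x2] replaced by [x1], transforming once more gives 2 d [x1] =
    0. *)
Lemma block_indep Om (e1 e2 : C) x0 x1 x2 x3 :
  LineV Om x0 -> FamV Om e1 dC x1 -> FamV Om e1 (- dC) x2 -> FamV Om e2 0 x3 ->
  (forall t s, Om t s -> co x0 t s + co x1 t s + co x2 t s + co x3 t s = 0) ->
  [/\ x0 = 0, x1 = 0, x2 = 0 & x3 = 0].
Proof.
move=> [h hh] H1 H2 H3 e.
have eq0 t s : co x0 t s + co x1 t s + co x2 t s + co x3 t s = 0.
  case: (boolP (Om t s)) => [/e //|n].
  case: (H1 t) => -> // _ _ _; case: (H2 t) => -> // _ _ _; case: (H3 t) => -> // _ _ _.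
  by rewrite hh (negPf n) !addr0; exact: mul0r.
have z0 : x0 = 0.
  apply: co_inj => t s; rewrite co0 hh; case: (boolP (Om t s)) => [o|_]; last exact: mul0r.
  have S : \sum_r co x0 t r = 0.
    have : \sum_r (co x0 t r + co x1 t r + co x2 t r + co x3 t r) = 0 by apply: big1 => r _.
    rewrite !big_split /=; case: (H1 t) => _ _ _ ->; case: (H2 t) => _ _ _ ->.
    by case: (H3 t) => _ _ _ ->; rewrite !addr0.
  move: S; under eq_bigr do rewrite hh.
  rewrite -mulr_suml -natr_sum => /eqP; rewrite mulf_eq0 pnatr_eq0 sum_nat_eq0.
  case/orP => [/forallP/(_ s)|/eqP ->]; last by rewrite mulr0.
  by rewrite o.
have eq1 t s : co x1 t s + co x2 t s + co x3 t s = 0.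
  by have := eq0 t s; rewrite z0 co0 add0r.
have HtE f1 f2 f3 s : Ht (fun r => f1 r + f2 r + f3 r) s = Ht f1 s + Ht f2 s + Ht f3 s :> C.
  by rewrite !HtD.
have eq2 t s : Om t s -> co x1 t s = co x2 t s.
  move=> o; have : Ht (fun r => co x1 t r + co x2 t r + co x3 t r) s = 0.
    by rewrite /Ht big1 // => r _; rewrite eq1 mulr0.
  rewrite HtE; case: (H1 t) => _ _ -> // _; case: (H2 t) => _ _ -> // _.
  case: (H3 t) => _ _ -> // _ /eqP; rewrite mul0r addr0 mulNr -mulrBr mulf_eq0 (negPf dC0).
  by rewrite subr_eq0 => /eqP.
have z1' t s : Om t s -> co x1 t s = 0.
  move=> o; have : Ht (fun r => co x1 t r + co x2 t r + co x3 t r) s = 0.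
    by rewrite /Ht big1 // => r _; rewrite eq1 mulr0.
  have E r : co x1 t r + co x2 t r + co x3 t r = co x1 t r + co x1 t r + co x3 t r.
    case: (boolP (Om t r)) => [o'|n]; first by rewrite -eq2.
    by case: (H1 t) => -> // _ _ _; case: (H2 t) => -> // _ _ _.
  rewrite (Ht_eq _ E) HtE; case: (H1 t) => _ _ -> // _; case: (H3 t) => _ _ -> // _.
  move/eqP; rewrite mul0r addr0 -mulrDr mulf_eq0 (negPf dC0) /= -mulr2n mulrn_eq0.
  by move/eqP.
have z1 : x1 = 0 by apply: FamV_eq0 H1.
have z2 : x2 = 0 by apply: FamV_eq0 H2 => t s o; rewrite -eq2 // z1'.
split=> //; apply: FamV_eq0 H3 => t s _.
by have := eq1 t s; rewrite z1 z2 !co0 !add0r.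
Qed.

(** [e] is the value of the character of [t] on the support; for this parity [Ht] preserves the
    functions of sum 0 on the support. *)
Definition blk (Om : pstr q -> pstr q -> bool) (e : C) : Prop :=
  [\/ Om = @OmD q /\ e = 1, Om = @OmC q /\ e = 1 | Om = @OmN q /\ e = -1].

Lemma blk_good Om e : blk Om e -> [\/ Om = @OmD q, Om = @OmC q | Om = @OmN q].
Proof. by case=> -[-> _]; [constructor 1|constructor 2|constructor 3]. Qed.

Lemma blk_sqr Om e : blk Om e -> e * e = 1.
Proof. by case=> -[_ ->]; rewrite ?mulrNN mulr1. Qed.

Lemma blk_chi Om e t s : blk Om e -> Om t s -> chi R t s = e.
Proof.
case=> -[-> ->]; rewrite /chi.
- by case/andP => /eqP -> _; rewrite sp0l expr0.
- by case/and4P => _ _ _ /negPf h; rewrite spC h expr0.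
- by case/andP => _ h; rewrite spC h expr1.
Qed.

Lemma Ht0 f s : (forall r, f r = 0) -> Ht f s = 0.
Proof. by move=> h; rewrite /Ht big1 // => r _; rewrite h mulr0. Qed.

Definition pre Om e t f : Prop :=
  [/\ forall s, ~~ Om t s -> f s = 0, forall s, f (s +^ t) = e * f s & \sum_s f s = 0].

(* On these spaces the Hadamard transform acts, with square [d ^ 2]. *)
Lemma pre_Ht Om e t f : blk Om e -> pre Om e t f -> pre Om e t (Ht f).
Proof.
move=> b [h1 h2 h3].
have HS s : Ht f (s +^ t) = e * Ht f s.
  rewrite /Ht mulr_sumr; apply: eq_bigr => r _; rewrite chiDl.
  case: (boolP (Om t r)) => [/(blk_chi b) ->|/h1 ->]; last by rewrite !mulr0.
  by rewrite mulrCA mulrA.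
split=> //; last first.
  rewrite -Ht_pid HtK h1 ?mulr0 //; apply/negP => o.
  by have := Om_nz (blk_good b) o; rewrite eqxx.
move=> s; case: b h2 HS h1 => -[-> ->] h2 HS h1.
- rewrite /OmD; have [t0|t0] := eqVneq t (pid q); last first.
    by move=> _; apply: Ht0 => r; apply: h1; rewrite /OmD (negPf t0).
  by rewrite negbK => /eqP ->; rewrite Ht_pid.
- have [t0|t0] := eqVneq t (pid q).
    by move=> _; apply: Ht0 => r; apply: h1; rewrite /OmC t0 eqxx.
  rewrite /OmC t0 /= !negb_and !negbK => /or3P[/eqP->|/eqP->|st].
  + by rewrite Ht_pid.
  + by rewrite -[t]add0p HS Ht_pid h3 mulr0.
  + by apply: (Ht_zero h2); rewrite /chi st expr1 mulr1.
- rewrite /OmN; have [t0|t0] := eqVneq t (pid q).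
    by move=> _; apply: Ht0 => r; apply: h1; rewrite /OmN t0 eqxx.
  by move=> /= /negPf st; apply: (Ht_zero h2); rewrite /chi st expr0 mul1r.
Qed.

(** On [pre] the operator Ht / d is an involution, and these are its eigenprojections. *)
Lemma Fam_pm Om e t f (k : C) : blk Om e -> k * k = 1 -> pre Om e t f ->
  Fam Om e (k * dC) t (fun s => (f s + k / dC * Ht f s) / 2%:R).
Proof.
move=> b k2 p; have [h1 h2 h3] := p; have [k1 k2' k3] := pre_Ht b p; split.
- by move=> s o; rewrite h1 ?k1 ?mulr0 ?addr0 ?mul0r.
- by move=> s; rewrite h2 k2' mulrCA -mulrDr mulrA.
- move=> s _.
  have -> : Ht (fun s => (f s + k / dC * Ht f s) / 2%:R) s = (Ht f s + k / dC * (dC * dC * f s)) / 2%:R.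
    rewrite (@Ht_eq _ _ _ (fun r => 2%:R^-1 * (f r + k / dC * Ht f r))) => [|r]; last exact: mulrC.
    by rewrite HtZ (HtD f) HtZ HtK mulrC.
  transitivity ((k * k * Ht f s + k / dC * (dC * dC * f s)) / 2%:R); first by rewrite k2 mul1r.
  by field; apply: dC0.
- by rewrite -mulr_suml big_split /= -mulr_sumr h3 k3 mulr0 addr0 mul0r.
Qed.

Lemma Fam_zero Om e t f : blk Om e ->
  (forall s, ~~ Om t s -> f s = 0) -> (forall s, f (s +^ t) = - e * f s) -> \sum_s f s = 0 ->
  Fam Om (- e) 0 t f.
Proof.
move=> b h1 h2 h3; split=> // s o; rewrite mul0r; apply: (Ht_zero h2).
by rewrite chiC (blk_chi b o) mulrN (blk_sqr b).
Qed.

Definition mkf (F : pstr q -> pstr q -> C) : M2 R q := \sum_t mk t (F t).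

Lemma co_mkf F t s : co (mkf F) t s = F t s.
Proof.
rewrite /mkf co_sum (bigD1 t) //= co_mk eqxx big1 ?addr0 // => t' /negPf n.
by rewrite co_mk n.
Qed.

Lemma FamV_mkf Om e mu F : (forall t, Fam Om e mu t (F t)) -> FamV Om e mu (mkf F).
Proof. by move=> h t; apply: Fam_eq (h t) => s; rewrite co_mkf. Qed.

(** Subtract the mean over each fibre, split the rest by parity, and split the part of parity [e] by
    the eigenprojections. *)
Lemma block_span Om e x : blk Om e -> exists x0 x1 x2 x3,
  [/\ LineV Om x0, FamV Om e dC x1, FamV Om e (- dC) x2, FamV Om (- e) 0 x3 &
   forall t s, co x0 t s + co x1 t s + co x2 t s + co x3 t s = if Om t s then co x t s else 0].
Proof.
move=> b; have gO := blk_good b.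
pose n t : nat := (\sum_s Om t s)%N.
pose m t : C := (\sum_(s | Om t s) co x t s) / (n t)%:R.
pose g t s : C := if Om t s then co x t s - m t else 0.
pose ge k t s : C := (g t s + k * g t (s +^ t)) / 2%:R.
have g1 t s : ~~ Om t s -> g t s = 0 by rewrite /g => /negPf ->.
have gS t : \sum_s g t s = 0.
  have nE (c : C) : \sum_(s | Om t s) c = (n t)%:R * c.
    rewrite big_mkcond /n natr_sum mulr_suml; apply: eq_bigr => s _.
    by case: (Om t s); [exact: esym (mul1r _)|exact: esym (mul0r _)].
  rewrite -big_mkcond sumrB nE mulrC.
  (* Over an empty fibre the mean is a division by 0, but then nothing is summed. *)
  rewrite /m; have [n0|n0] := eqVneq (n t) 0%N; last by rewrite divfK ?pnatr_eq0 // subrr.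
  rewrite n0 mulr0 subr0 big1 // => s o; move/eqP: n0; rewrite sum_nat_eq0 => /forallP/(_ s).
  by rewrite o.
have gp k t : k * k = 1 -> pre Om k t (ge k t).
  move=> k2; split=> [s o|s|].
  - by rewrite /ge !g1 ?Om_padd // mulr0 addr0 mul0r.
  - by rewrite /ge paddK mulrA mulrDr mulrA k2 mul1r addrC.
  - by rewrite /ge -mulr_suml big_split /= -mulr_sumr sum_shift gS mulr0 addr0 mul0r.
have e2 := blk_sqr b.
have F (k : C) : k * k = 1 ->
    FamV Om e (k * dC) (mkf (fun t s => (ge e t s + k / dC * Ht (ge e t) s) / 2%:R)).
  by move=> k2; apply: FamV_mkf => t; apply: Fam_pm => //; apply: gp.
exists (mkf (fun t s => if Om t s then m t else 0)),
  (mkf (fun t s => (ge e t s + 1 / dC * Ht (ge e t) s) / 2%:R)),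
  (mkf (fun t s => (ge e t s + -1 / dC * Ht (ge e t) s) / 2%:R)), (mkf (ge (- e))).
split.
- exists m => t s; rewrite co_mkf; case: (Om t s); [exact: esym (mul1r _)|exact: esym (mul0r _)].
- by have := F 1 (mulr1 1); rewrite (mul1r dC).
- by have := F (-1) (etrans (mulrNN 1 1) (mulr1 1)); rewrite (mulN1r dC).
- apply: FamV_mkf => t; have [|k1 k2 k3] := gp (- e) t; first by rewrite mulrNN.
  exact: Fam_zero.
move=> t s; rewrite !co_mkf.
transitivity ((if Om t s then m t else 0) + g t s); last first.
  by rewrite /g; case: (Om t s); rewrite ?addr0 // addrC subrK.
by rewrite -!addrA; congr (_ + _); rewrite /ge; field; apply: dC0.
Qed.

Lemma line_span Om x : (forall t s s', Om t s -> Om t s' -> s = s') ->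
  exists x0, LineV Om x0 /\ forall t s, co x0 t s = if Om t s then co x t s else 0.
Proof.
move=> O1; exists (mkf (fun t s => if Om t s then co x t s else 0)); split; last exact: co_mkf.
exists (fun t => \sum_(s | Om t s) co x t s) => t s; rewrite co_mkf.
case: (boolP (Om t s)) => [o|_]; last exact: esym (mul0r _).
rewrite [RHS]mul1r (bigD1 s) //= big1 ?addr0 // => r /andP[o' /eqP n].
by case: n; apply: O1 o' o.
Qed.
End Blocks.

(** * One and two qubits *)

Section Small.
Variable R : realType.
Variable q : nat.
Local Notation C := (Cx R).
Local Notation d := (Defs.dim q).
Local Notation dC := (d%:R : C).
Implicit Types Om : pstr q -> pstr q -> bool.
Implicit Types (s t r u : pstr q) (x y : M2 R q) (f g h c : pstr q -> C).

Lemma perp1 s t : q = 1%N -> t != pid q -> sp s t = false -> s = pid q \/ s = t.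
Proof.
move=> q1; subst q => /eqP t0; rewrite /sp big_ord1 => h.
have E (s1 s2 : pstr 1) : s1 ord0 = s2 ord0 -> s1 = s2.
  by move=> e; apply/ffunP => k; rewrite ord1.
have {}t0 : t ord0 <> ord0 by move=> e; apply: t0; apply: E; rewrite ffunE.
have : s ord0 = ord0 \/ s ord0 = t ord0.
  move: h t0; case: (s ord0) => [[|[|[|[|?]]]] ?] //; case: (t ord0) => [[|[|[|[|?]]]] ?] //= _ n;
  by [left; apply: val_inj|right; apply: val_inj|case: n; apply: val_inj].
by case=> e; [left|right]; apply: E; rewrite e // ffunE.
Qed.

(** For two qubits the span of two independent commuting strings is Lagrangian: it has four
    elements, and so has its orthogonal complement by a character count. *)
Lemma perp2 t s r : q = 2%N -> t != pid q -> s != pid q -> s != t ->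
  sp s t = false -> sp r t = false -> sp r s = false ->
  [\/ r = pid q, r = t, r = s | r = s +^ t].
Proof.
move=> q2 t0 s0 st hst hrt hrs.
pose A := [set u in [:: pid q; t; s; s +^ t]].
pose B := [set u | ~~ sp t u & ~~ sp s u].
have AB : A \subset B.
  apply/subsetP => u; rewrite !inE => /or4P[] /eqP ->;
  by rewrite ?spDr ?sp0r ?spss ?(spC t s) ?hst.
have cA : #|A| = 4%N.
  have e1 : (t == s +^ t) = false.
    by apply/eqP => e; move: s0; rewrite -(paddK t s) -e paddss eqxx.
  have e2 : (s == s +^ t) = false.
    by apply/eqP => e; move: t0; rewrite -(padKd s t) -e paddss eqxx.
  rewrite /A cardsE; apply/eqP; rewrite (card_uniqP _) //= !inE !negb_or e1 e2 !(eq_sym (pid q)).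
  by rewrite padd_eq0 t0 s0 st eq_sym st.
have cB : #|B| = 4%N.
  (* The product (1 + chi t)(1 + chi s) is 4 on [B] and 0 elsewhere; expanded, only the trivial
     character survives, with sum 16. *)
  have : (#|B| * 4)%N%:R = (4 * 4)%N%:R :> C.
    transitivity (\sum_u (1 + chi R t u) * (1 + chi R s u)).
      rewrite natrM mulrC -sum1_card natr_sum mulr_sumr big_mkcond; apply: eq_bigr => u _.
      rewrite inE /chi; case: (sp t u) => /=; first by rewrite expr1 subrr mul0r.
      by case: (sp s u); rewrite /= ?expr0 ?expr1 ?subrr ?mulr0 // mulr1; ring.
    under eq_bigr => u _ do rewrite mulrDl mul1r mulrDr mulr1 -chiDl.
    rewrite !big_split /= !chi_sum (negPf t0) (negPf s0) padd_eq0 eq_sym (negPf st) !addr0.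
    by rewrite sumr_const card_pstr -natrM q2.
  by move/eqP; rewrite eqr_nat eqn_mul2r /= => /eqP.
have /eqP E : A == B by rewrite eqEcard AB cA cB.
have : r \in A by rewrite E inE (spC t) hrt (spC s) hrs.
by rewrite !inE => /or4P[] /eqP; [constructor 1|constructor 2|constructor 3|constructor 4].
Qed.

Lemma small_zero Om (e : C) x : blk Om e ->
  (forall t f s, pre Om e t f -> Om t s -> Ht f s = dC * f s) ->
  FamV Om e (- dC) x -> x = 0.
Proof.
move=> b h hx; apply: (FamV_eq0 _ hx) => t s o.
have [h1 h2 h3 h4] := hx t.
have := h3 s o; rewrite (h t) // mulNr => /eqP; rewrite -addr_eq0 -mulr2n mulrn_eq0 /=.
by rewrite mulf_eq0 (negPf (dC0 R q)) => /eqP.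
Qed.

(** For few qubits all of the fibre but [s] and [u] anticommutes with [s]; the transform is minus
    the sum of [f], corrected at these two points. *)
Lemma Ht_pick2 f s u :
  (forall r, chi R s r * f r = (if r == s then 2%:R * f r else 0) + (if r == u then 2%:R * f r else 0) - f r) ->
  \sum_r f r = 0 -> Ht f s = 2%:R * f s + 2%:R * f u.
Proof.
move=> h h0; rewrite /Ht; under eq_bigr do rewrite h.
by rewrite !big_split /= sumrN h0 oppr0 addr0 -!big_mkcond !big_pred1_eq.
Qed.

Lemma Ht_pick1 f s : (forall r, chi R s r * f r = (if r == s then 2%:R * f r else 0) - f r) ->
  \sum_r f r = 0 -> Ht f s = 2%:R * f s.
Proof.
move=> h h0; rewrite /Ht; under eq_bigr do rewrite h.
by rewrite big_split /= sumrN h0 oppr0 addr0 -!big_mkcond !big_pred1_eq.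
Qed.

Lemma chi_cases s r (f : pstr q -> C) : chi R s r * f r = if sp s r then - f r else f r.
Proof. by rewrite /chi; case: sp; rewrite ?expr0 ?expr1 ?mul1r ?mulN1r. Qed.

Lemma small_D t f s : q = 1%N -> pre (@OmD q) 1 t f -> OmD t s -> Ht f s = dC * f s.
Proof.
move=> q1 [h1 h2 h3] /andP[/eqP t0 s0].
have -> : dC = 2%:R by rewrite /Defs.dim q1.
apply: Ht_pick1 => // r; rewrite chi_cases.
case: (boolP (sp s r)) => [sr|/negPf sr].
  by case: eqP => [e|_]; [rewrite e spss in sr|rewrite add0r].
rewrite spC in sr; have [->|->] := perp1 q1 s0 sr; last by rewrite eqxx; ring.
by rewrite h1 ?mulr0 ?if_same ?subrr // /OmD eqxx andbF.
Qed.

Lemma OmN1 t s r : q = 1%N -> OmN t s -> OmN t r -> r = s \/ r = s +^ t.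
Proof.
move=> q1 /andP[t0 hs] /andP[_ hr].
have [|e|e] := @perp1 (r +^ s) t q1 t0; first by rewrite spDl hs hr.
  by left; apply/eqP; rewrite -padd_eq0 e.
by right; rewrite -e paddC paddK.
Qed.

Lemma small_N t f s : q = 1%N -> pre (@OmN q) (-1) t f -> OmN t s -> Ht f s = dC * f s.
Proof.
move=> q1 [h1 h2 h3] os; have /andP[t0 st] := os.
have -> : dC = 2%:R by rewrite /Defs.dim q1.
apply: Ht_pick1 => // r; rewrite chi_cases.
case: (boolP (OmN t r)) => [or|/h1 ->]; last by rewrite oppr0 mulr0 !if_same addr0.
have [->|->] := OmN1 q1 os or; first by rewrite eqxx spss; ring.
rewrite spDr spss st /= padd_eq; case: eqP => [e|_]; last by rewrite add0r.
by move: t0; rewrite -(padKd s t) -e paddss eqxx.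
Qed.

(** Only [s] and [s + t] in the fibre commute with [s], and [f] agrees at both, so the eigenvalue is
    4 = d. *)
Lemma small_C t f s : q = 2%N -> pre (@OmC q) 1 t f -> OmC t s -> Ht f s = dC * f s.
Proof.
move=> q2 [h1 h2 h3] os; have /and4P[t0 s0 st /negPf hst] := os.
have hss : (s == s +^ t) = false.
  by apply/eqP => e; move: t0; rewrite -(padKd s t) -e paddss eqxx.
rewrite (@Ht_pick2 f s (s +^ t)) // => [|r].
  by rewrite h2 mul1r -mulrDl -natrD /Defs.dim q2.
rewrite chi_cases; case: (boolP (OmC t r)) => [or|/h1 ->]; last by rewrite oppr0 mulr0 !if_same !addr0.
have /and4P[_ r0 rt /negPf hrt] := or.
case: (boolP (sp s r)) => [sr|/negPf sr].
  case: eqP => [e|_]; first by rewrite e spss in sr.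
  by case: eqP => [e|_]; [rewrite e spDr spss hst in sr|rewrite !add0r].
rewrite spC in sr; have [e|e|->|->] := perp2 q2 t0 s0 st hst hrt sr.
- by rewrite e eqxx in r0.
- by rewrite e eqxx in rt.
- by rewrite eqxx hss; ring.
- by rewrite eqxx eq_sym hss; ring.
Qed.

Lemma OmC1 t s : q = 1%N -> OmC t s = false.
Proof.
move=> q1; apply/negP => /and4P[t0 s0 st /negPf h].
by have [e|e] := perp1 q1 t0 h; [rewrite e eqxx in s0|rewrite e eqxx in st].
Qed.

(** A fibre is the pair [s], [s + t], so oddness alone gives the eigenvalue d; hence [V_cbS] is a
    single piece for one qubit. *)
Lemma ParV_N1 x : q = 1%N -> ParV (@OmN q) (-1) x <-> FamV (@OmN q) (-1) dC x.
Proof.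
move=> q1; split=> [h t|]; last exact: FamV_ParV.
have he s : co x t (s +^ t) = -1 * co x t s by have [] := h t s.
have h0 : \sum_s co x t s = 0 by rewrite -Ht_pid (Ht_zero he) // /chi sp0l expr0 mul1r.
have hs s : ~~ OmN t s -> co x t s = 0 by have [] := h t s.
by split=> // s o; apply: (@small_N t).
Qed.

Lemma ParV_N1_line x : q = 1%N -> ParV (@OmN q) 1 x <-> LineV (@OmN q) x.
Proof.
move=> q1; split=> [h|[k hk] t s]; last first.
  rewrite !hk Om_padd ?mul1r; last by constructor 3.
  by split=> // /negPf ->; exact: mul0r.
exists (fun t => if [pick s | OmN t s] is Some s then co x t s else 0) => t s.
case: (boolP (OmN t s)) => [o|n]; last by rewrite (h t s).1 //; exact: esym (mul0r _).
rewrite [RHS]mul1r; case: pickP => [r or|/(_ s)]; last by rewrite o.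
have [->//|->] := OmN1 q1 or o.
by rewrite (h t r).2 mul1r.
Qed.

(** An even function on the pair [s], [s + t] is constant, and a constant function of sum 0
    vanishes. *)
Lemma perp_zero1 x : q = 1%N -> FamV (@OmN q) 1 0 x -> x = 0.
Proof.
move=> q1 hx; have [k hk] := (ParV_N1_line x q1).1 (FamV_ParV hx).
have lx : LineV (@OmN q) (- x) by exists (fun t => - k t) => t s; rewrite coN hk mulrN.
have z (mu : C) := subspace0 (FamV_sub (@OmN q) (-1) mu).
by have [t s _|] := block_indep lx (z _) (z _) hx; rewrite ?coN ?co0 ?addr0 ?addNr.
Qed.
End Small.

(** * Nonzero vectors *)

Section Nonzero.
Variable R : realType.
Variable q : nat.
Local Notation C := (Cx R).
Local Notation d := (Defs.dim q).
Local Notation dC := (d%:R : C).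
Implicit Types Om : pstr q -> pstr q -> bool.
Implicit Types (s t r u : pstr q) (x y : M2 R q) (f g h c : pstr q -> C).

Definition nontrivial (V : Defs.space R q) : Prop := exists x, V x /\ x != 0.

Lemma mk_neq0 t f s : f s != 0 -> mk t f != 0.
Proof.
by apply: contraNneq => e; have := co_mk t f t s; rewrite e co0 eqxx => <-.
Qed.

Lemma FamV_mk Om e mu t f : Fam Om e mu t f -> FamV Om e mu (mk t f).
Proof.
move=> h t'; have [<-|n] := eqVneq t t'; first by apply: Fam_eq h => s; rewrite co_mk eqxx.
by apply: Fam_eq (Fam0 _ _ _ _) => s; rewrite co_mk (negPf n).
Qed.

(** The vector is the eigenprojection of [f]; 2 d times its value at [s] is the quantity assumed
    nonzero. *)
Lemma pm_nontrivial Om e (k : C) t f s : blk Om e -> k * k = 1 -> pre Om e t f ->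
  dC * f s + k * Ht f s != 0 -> nontrivial (FamV Om e (k * dC)).
Proof.
move=> b k2 p nz; exists (mk t (fun s => (f s + k / dC * Ht f s) / 2%:R)); split.
  exact/FamV_mk/Fam_pm.
apply: (@mk_neq0 _ _ s); apply: contra nz => /eqP e0; apply/eqP.
transitivity (2%:R * dC * ((f s + k / dC * Ht f s) / 2%:R)); last by rewrite e0 mulr0.
by field; apply: dC0.
Qed.

(** A point mass made even or odd under the shift; over the identity with [e = 1] it is twice a
    point mass. *)
Definition dlt (e : C) t s r : C := (if r == s then 1 else 0) + e * (if r == s +^ t then 1 else 0).

Lemma sum_pt (F : pstr q -> C) s : \sum_r F r * (if r == s then 1 else 0) = F s.
Proof.
rewrite (bigD1 s) //= eqxx mulr1 big1 ?addr0 // => r /negPf ->; exact: mulr0.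
Qed.

Lemma Ht_dlt e t s r : Ht (dlt e t s) r = chi R r s + e * chi R r (s +^ t).
Proof. by rewrite /dlt HtD HtZ /Ht !sum_pt. Qed.

Lemma sum_dlt e t s : \sum_r dlt e t s r = 1 + e.
Proof. by rewrite -Ht_pid Ht_dlt /chi !sp0l expr0 mulr1. Qed.

Lemma dlt_supp Om (e : C) t s : (forall r, Om t (r +^ t) = Om t r) -> Om t s ->
  forall r, ~~ Om t r -> dlt e t s r = 0.
Proof.
move=> OO o r n; rewrite /dlt; case: eqP => [e1|_]; first by rewrite -e1 (negPf n) in o.
by case: eqP => [e1|_]; [rewrite -OO -e1 (negPf n) in o|rewrite mulr0 addr0].
Qed.

Lemma dlt_par (e : C) t s r : e * e = 1 -> dlt e t s (r +^ t) = e * dlt e t s r.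
Proof.
move=> e2; rewrite /dlt [r +^ t == s]padd_eq [r +^ t == _]padd_eq paddK mulrDr mulrA e2 mul1r.
exact: addrC.
Qed.

Lemma pre_dlt2 Om (e : C) t s s' : blk Om e -> Om t s -> Om t s' ->
  pre Om e t (fun r => dlt e t s r - dlt e t s' r).
Proof.
move=> b o o'; have OO r := Om_padd (blk_good b) t r; split.
- by move=> r n; rewrite !(dlt_supp _ OO) ?subr0.
- by move=> r; rewrite !dlt_par ?(blk_sqr b) // mulrBr.
- by rewrite sumrB !sum_dlt subrr.
Qed.

Lemma dC_pm (m : nat) (k : C) : (d != m)%N -> (0 < m)%N -> k * k = 1 -> dC + k * m%:R != 0.
Proof.
move=> dm m0 /eqP; rewrite -expr2 sqrf_eq1 => /orP[] /eqP ->.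
  by rewrite mul1r -natrD pnatr_eq0 -lt0n addn_gt0 m0 orbT.
by rewrite mulN1r subr_eq0 eqr_nat.
Qed.

Definition bX : 'I_4 := of_bits true false.
Definition bZ : 'I_4 := of_bits false true.

Lemma exN : (1 <= q)%N -> exists t s, sp s t.
Proof.
move=> q1; pose k := Ordinal q1.
by exists (single k bX), (single k bZ); rewrite sp_single !ffunE eqxx.
Qed.

(** Test strings for the nonzero vectors: an anticommuting pair on each of two qubits. *)
Lemma ex2 : (2 <= q)%N -> exists t t' s s' : pstr q,
  [/\ sp t' t, sp s s', sp s t = false, sp s' t = false & sp s t' = false].
Proof.
move=> q2; pose k0 := Ordinal (ltnW q2); pose k1 := Ordinal q2.
exists (single k0 bX), (single k0 bZ), (single k1 bX), (single k1 bZ).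
by split; rewrite sp_single !ffunE.
Qed.

Lemma sp_nz s t : sp s t -> s != pid q. Proof. by apply: contraTneq => ->; rewrite sp0l. Qed.
Lemma sp_nz2 s t : sp s t -> t != pid q. Proof. by rewrite spC; apply: sp_nz. Qed.

Lemma sp_sep s s' u : sp s u -> sp s' u = false -> s != s'.
Proof. by move=> h; apply: contraFneq => <-. Qed.

Lemma shift_neq s t : t != pid q -> (s == s +^ t) = false.
Proof. by move=> t0; apply/eqP => e; move: t0; rewrite -(padKd s t) -e paddss eqxx. Qed.

Lemma ex2_OmC t t' s s' : sp t' t -> sp s s' -> sp s t = false -> sp t s' = false -> OmC t s.
Proof.
by move=> tt' ss' st ts'; rewrite /OmC (sp_nz2 tt') (sp_nz ss') st andbT (sp_sep ss').
Qed.

(** The test value is 2 (d + 2 k), zero only for d = 2 and k = -1, the case in which the space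
    itself is zero. *)
Lemma nz_D (k : C) : (1 <= q)%N -> k * k = 1 -> d != 2%N \/ k = 1 ->
  nontrivial (FamV (@OmD q) 1 (k * dC)).
Proof.
move=> q1 k2 hk; have [s' [s ss']] := exN q1.
have b : blk (@OmD q) (1 : C) by constructor 1.
have o : OmD (pid q) s by rewrite /OmD eqxx (sp_nz ss').
have o' : OmD (pid q) s' by rewrite /OmD eqxx (sp_nz2 ss').
apply: (pm_nontrivial (s := s) b k2 (pre_dlt2 b o o')).
have -> : Ht (fun r => dlt 1 (pid q) s r - dlt 1 (pid q) s' r) s = 2%:R * 2%:R.
  rewrite (@Ht_eq _ _ _ (fun r => dlt 1 (pid q) s r + -1 * dlt 1 (pid q) s' r)) => [|r]; last by rewrite mulN1r.
  by rewrite HtD HtZ !Ht_dlt !padd0 /chi spss ss' expr0 expr1; ring.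
rewrite /dlt !padd0 eqxx (negPf (@sp_sep s s' s' ss' (spss s'))).
have -> : dC * (1 + 1 * 1 - (0 + 1 * 0)) + k * (2%:R * 2%:R) = 2%:R * (dC + k * 2%:R) by ring.
rewrite mulf_neq0 ?pnatr_eq0 //; case: hk => [d2|->]; first exact: dC_pm.
by rewrite mul1r -natrD pnatr_eq0 addn2.
Qed.

(** The test value is d + 4 k, zero only for d = 4 and k = -1; hence [V_br2] enters from three
    qubits on. *)
Lemma nz_C (k : C) : (2 <= q)%N -> k * k = 1 -> d != 4%N \/ k = 1 ->
  nontrivial (FamV (@OmC q) 1 (k * dC)).
Proof.
move=> q2 k2 hk; have [t [t' [s [s' [tt' ss' st s't st']]]]] := ex2 q2.
have b : blk (@OmC q) (1 : C) by constructor 2.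
have o : OmC t s by apply: (ex2_OmC tt' ss' st); rewrite spC.
have o' : OmC t s' by rewrite spC in ss'; apply: (ex2_OmC tt' ss' s't); rewrite spC.
apply: (pm_nontrivial (s := s) b k2 (pre_dlt2 b o o')).
have -> : Ht (fun r => dlt 1 t s r - dlt 1 t s' r) s = 4%:R.
  rewrite (@Ht_eq _ _ _ (fun r => dlt 1 t s r + -1 * dlt 1 t s' r)) => [|r]; last by rewrite mulN1r.
  by rewrite HtD HtZ !Ht_dlt /chi !spDr spss ss' st expr0 expr1; ring.
have n1 : (s == s +^ t) = false by apply: shift_neq; apply: sp_nz2 tt'.
have n2 : (s == s') = false by apply/negbTE/(sp_sep ss'); rewrite spss.
have n3 : (s == s' +^ t) = false.
  by apply/negbTE/(sp_sep ss'); rewrite spDl spss spC s't.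
rewrite /dlt eqxx n1 n2 n3.
have -> : dC * (1 + 1 * 0 - (0 + 1 * 0)) + k * 4%:R = dC + k * 4%:R by ring.
case: hk => [d4|->]; first exact: dC_pm.
by rewrite mul1r -natrD pnatr_eq0 addn4.
Qed.

Lemma nz_N (k : C) : (1 <= q)%N -> k * k = 1 -> d != 2%N \/ k = 1 ->
  nontrivial (FamV (@OmN q) (-1) (k * dC)).
Proof.
move=> q1 k2 hk; have [t [s st]] := exN q1.
have b : blk (@OmN q) (-1 : C) by constructor 3.
have o : OmN t s by rewrite /OmN st (sp_nz2 st).
have p : pre (@OmN q) (-1) t (dlt (-1) t s).
  split; last by rewrite sum_dlt subrr.
    by apply: dlt_supp => // r; apply: Om_padd; constructor 3.
  by move=> r; rewrite dlt_par // mulrNN mulr1.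
apply: (pm_nontrivial (s := s) b k2 p).
rewrite Ht_dlt /chi spDr spss st expr0 expr1 /dlt eqxx shift_neq ?(sp_nz2 st) //.
have -> : dC * (1 + -1 * 0) + k * (1 + -1 * -1) = dC + k * 2%:R by ring.
case: hk => [d2|->]; first exact: dC_pm.
by rewrite mul1r -natrD pnatr_eq0 addn2.
Qed.

Lemma nz_Codd : (2 <= q)%N -> nontrivial (FamV (@OmC q) (-1) 0).
Proof.
move=> q2; have [t [t' [s [s' [tt' ss' st s't st']]]]] := ex2 q2.
have b : blk (@OmC q) (1 : C) by constructor 2.
have o : OmC t s by apply: (ex2_OmC tt' ss' st); rewrite spC.
exists (mk t (dlt (-1) t s)); split; last first.
  by apply: (@mk_neq0 _ _ s); rewrite /dlt eqxx shift_neq ?(sp_nz2 tt') // mulr0 addr0 oner_eq0.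
apply: FamV_mk; apply: (Fam_zero b); last by rewrite sum_dlt subrr.
  by apply: dlt_supp => // r; apply: Om_padd; constructor 2.
by move=> r; rewrite dlt_par // mulrNN mulr1.
Qed.

Lemma nz_Neven : (2 <= q)%N -> nontrivial (FamV (@OmN q) 1 0).
Proof.
move=> q2; have [t [t' [s [s' [tt' ss' st s't st']]]]] := ex2 q2.
have b : blk (@OmN q) (-1 : C) by constructor 3.
have o : OmN t t' by rewrite /OmN tt' (sp_nz2 tt').
have o' : OmN t (t' +^ s) by rewrite /OmN spDl tt' st (sp_nz2 tt').
have OO r : OmN t (r +^ t) = OmN t r by apply: Om_padd; constructor 3.
(* Even functions need a second pair to reach sum 0: [s] commutes with [t], so [t' + s] is again in
   the fibre, and it is neither [t'] nor [t' + t]. *)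
exists (mk t (fun r => dlt 1 t t' r - dlt 1 t (t' +^ s) r)); split; last first.
  apply: (@mk_neq0 _ _ t'); rewrite /dlt eqxx !shift_neq ?(sp_nz2 tt') ?(sp_nz ss') //.
  have -> : (t' == t' +^ s +^ t) = false.
    apply/negbTE; apply: contraTneq ss' => e; have /esym e0 := congr1 (padd t') e.
    rewrite paddss -paddA padKd in e0.
    by move/eqP: e0; rewrite padd_eq0 => /eqP ->; rewrite spC s't.
  by rewrite mulr0 !addr0 subr0 oner_eq0.
apply: FamV_mk; rewrite -[1]opprK; apply: (Fam_zero b).
- by move=> r n; rewrite !(dlt_supp _ OO) ?subr0.
- by move=> r; rewrite opprK !dlt_par ?mulr1 // mulrBr.
- by rewrite sumrB !sum_dlt subrr.
Qed.

Lemma nz_line Om t s : Om t s -> nontrivial (LineV Om : Defs.space R q).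
Proof.
move=> o; exists (mk t (fun s => if Om t s then 1 else 0)); split; last first.
  by apply: (@mk_neq0 _ _ s); rewrite o oner_eq0.
exists (fun t' => if t == t' then 1 else 0) => t' s'; rewrite co_mk.
case: eqP => [<-|_]; last by rewrite mulr0.
by rewrite mulr1; case: (Om t s').
Qed.
End Nonzero.

(** * Irreducible decomposition *)

Section DirectSum.
Variable R : realType.
Variable q : nat.
Local Notation space := (Defs.space R q).
Local Notation nthV := (nth (fun _ : M2 R q => False)).

(** A recursive sum, so that spanning can be shown summand by summand along the list. *)
Fixpoint insum (Vs : seq space) (x : M2 R q) : Prop :=
  if Vs is V :: Vs' then exists v w, [/\ V v, insum Vs' w & x = v + w] else x = 0.

Lemma insumP Vs x : insum Vs x -> exists v : nat -> M2 R q,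
  (forall n, (n < size Vs)%N -> nthV Vs n (v n)) /\ x = \sum_(i < size Vs) v i.
Proof.
elim: Vs x => [|V Vs IH] x /=; first by move=> ->; exists (fun=> 0); rewrite big_ord0.
case=> v0 [w [Vv /IH[v [hv ->]] ->]].
exists (fun n => if n is n'.+1 then v n' else v0); split; first by case=> //= n; apply: hv.
by rewrite big_ord_recl.
Qed.

Lemma direct_sum_intro (Vs : seq space) :
  (forall n, (n < size Vs)%N -> subspace (nthV Vs n)) ->
  (forall x, insum Vs x) ->
  (forall w : nat -> M2 R q, (forall n, (n < size Vs)%N -> nthV Vs n (w n)) ->
     \sum_(i < size Vs) w i = 0 -> forall n, (n < size Vs)%N -> w n = 0) ->
  direct_sum Vs.
Proof.
move=> sub span ind; split=> [x|v w hv hw e i].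
  have [v [hv ->]] := insumP (span x).
  by exists (fun i => v i); split=> // i; apply: hv.
pose z n := if insub n is Some j then v j - w j else 0.
have zE (j : 'I_(size Vs)) : z j = v j - w j by rewrite /z valK.
apply/eqP; rewrite -subr_eq0 -zE; apply/eqP/ind => // [n nV|].
  by rewrite -[n]/(nat_of_ord (Ordinal nV)) zE; apply: subspaceB; [apply: sub|apply: hv|apply: hw].
by under eq_bigr do rewrite zE; rewrite sumrB e subrr.
Qed.
End DirectSum.

(** * The fourteen components together *)

Section Main.
Variable R : realType.
Variable q : nat.
Local Notation C := (Cx R).
Local Notation d := (Defs.dim q).
Local Notation dC := (d%:R : C).
Implicit Types Om : pstr q -> pstr q -> bool.
Implicit Types (s t r u : pstr q) (x y : M2 R q).

Lemma irrep_Fam (V : Defs.space R q) Om e mu :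
  (forall x, V x <-> FamV Om e mu x) -> [\/ Om = @OmD q, Om = @OmC q | Om = @OmN q] ->
  conjc e = e -> conjc mu = mu -> nontrivial (FamV Om e mu) -> irrep V.
Proof.
move=> VE gO ce cmu [x [hx x0]]; split.
- have [h0 [hD hZ]] := FamV_sub Om e mu; split; first exact/VE.
  by split=> [y z /VE hy /VE hz|a y /VE hy]; apply/VE; [apply: hD|apply: hZ].
- by move=> U cU y /VE hy; apply/VE; apply: (FamV_inv (good_equivariant gO) cU hy).
- by exists x; split=> //; apply/VE.
move=> W sW WV iW; have [|h|h] := FamV_irr gO ce cmu sW _ iW; [|by left|].
  by move=> y /WV /VE.
by right=> y /VE /h.
Qed.

Lemma irrep_Line (V : Defs.space R q) Om :
  (forall x, V x <-> LineV Om x) -> equivariant Om ->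
  (forall t s t' s', Om t s -> Om t' s' -> (t == pid q) = (t' == pid q)) ->
  (exists t s, Om t s) -> irrep V.
Proof.
move=> VE eO tO [t [s o]]; have [x [hx x0]] := nz_line R o; split.
- have [h0 [hD hZ]] := LineV_sub R Om; split; first exact/VE.
  by split=> [y z /VE hy /VE hz|a y /VE hy]; apply/VE; [apply: hD|apply: hZ].
- by move=> U cU y /VE hy; apply/VE; apply: (LineV_inv eO cU hy).
- by exists x; split=> //; apply/VE.
move=> W sW WV iW; have [|h|h] := LineV_irr eO tO sW _ iW; [|by left|].
  by move=> y /WV /VE.
by right=> y /VE /h.
Qed.

Lemma dC_conj : conjc dC = dC. Proof. exact: conjc_nat. Qed.
Lemma NdC_conj : conjc (- dC) = - dC.
Proof. by rewrite rmorphN; congr (- _); exact: dC_conj. Qed.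
Lemma N1_conj : conjc (-1 : C) = -1. Proof. by apply: sqr1_conj; rewrite mulrNN mulr1. Qed.

Lemma V_1_FamV x : V_1 x <-> FamV (@OmD q) 1 dC x.
Proof. by rewrite /V_1 V_epsP opprK mul1r. Qed.
Lemma V_2_FamV x : V_2 x <-> FamV (@OmD q) 1 (- dC) x.
Proof. by rewrite /V_2 V_epsP mulN1r. Qed.

Lemma OmC0 s : @OmC q (pid q) s = false. Proof. by rewrite /OmC eqxx. Qed.
Lemma OmN0 s : @OmN q (pid q) s = false. Proof. by rewrite /OmN eqxx. Qed.

Lemma V_br1_FamV x : V_br1 x <-> FamV (@OmC q) 1 dC x.
Proof.
apply: sumsp_FamV => [s|t y nt]; first exact: OmC0.
have ne : dC * dC != 8%:R * (- (dC / 4%:R)).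
  rewrite -subr_eq0 (_ : dC * dC - 8%:R * (- (dC / 4%:R)) = dC * (dC + 2%:R)); last by field.
  by rewrite mulf_neq0 ?dC0 // -natrD pnatr_eq0 addn2.
have := eig_br y nt ne.
by rewrite (_ : - (4%:R * (- (dC / 4%:R))) = dC); last by field.
Qed.

Lemma V_br2_FamV x : (2 <= q)%N -> V_br2 x <-> FamV (@OmC q) 1 (- dC) x.
Proof.
move=> q2; apply: sumsp_FamV => [s|t y nt]; first exact: OmC0.
(* Equality would mean d = 2, which two or more qubits exclude. *)
have ne : dC * dC != 8%:R * (dC / 4%:R).
  rewrite -subr_eq0 (_ : dC * dC - 8%:R * (dC / 4%:R) = dC * (dC - 2%:R)); last by field.
  rewrite mulf_neq0 ?dC0 // subr_eq0 eqr_nat.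
  by rewrite /Defs.dim -{2}(expn1 2) eqn_exp2l // neq_ltn q2 orbT.
have := eig_br y nt ne.
by rewrite (_ : - (4%:R * (dC / 4%:R)) = - dC); last by field.
Qed.

Lemma V_cb1_FamV x : V_cb1 x <-> FamV (@OmN q) (-1) dC x.
Proof. by apply: sumsp_FamV => [s|t y nt]; [exact: OmN0|exact: eig_cb]. Qed.
Lemma V_cb2_FamV x : V_cb2 x <-> FamV (@OmN q) (-1) (- dC) x.
Proof. by apply: sumsp_FamV => [s|t y nt]; [exact: OmN0|exact: eig_cb]. Qed.

Lemma Om_cases t s : [\/ OmI t s, OmR t s, OmL t s | [\/ OmD t s, OmC t s | OmN t s]].
Proof.
rewrite /OmI /OmR /OmL /OmD /OmC /OmN.
have [t0|t0] := eqVneq t (pid q); have [s0|s0] := eqVneq s (pid q) => /=.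
- by constructor 1.
- by constructor 4; constructor 1.
- by constructor 2.
have [st|st] := eqVneq s t; first by constructor 3.
by constructor 4; case: (sp s t); [constructor 3|constructor 2].
Qed.

Lemma Om_excl t s :
  [/\ OmI t s -> [/\ ~~ OmR t s, ~~ OmL t s, ~~ OmD t s, ~~ OmC t s & ~~ OmN t s],
      OmR t s -> [/\ ~~ OmI t s, ~~ OmL t s, ~~ OmD t s, ~~ OmC t s & ~~ OmN t s],
      OmL t s -> [/\ ~~ OmI t s, ~~ OmR t s, ~~ OmD t s, ~~ OmC t s & ~~ OmN t s] &
   [/\ OmD t s -> [/\ ~~ OmI t s, ~~ OmR t s, ~~ OmL t s, ~~ OmC t s & ~~ OmN t s],
      OmC t s -> [/\ ~~ OmI t s, ~~ OmR t s, ~~ OmL t s, ~~ OmD t s & ~~ OmN t s] &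
      OmN t s -> [/\ ~~ OmI t s, ~~ OmR t s, ~~ OmL t s, ~~ OmD t s & ~~ OmC t s]]].
Proof.
rewrite /OmI /OmR /OmL /OmD /OmC /OmN.
have [->|t0] := eqVneq t (pid q); have [->|s0] := eqVneq s (pid q); rewrite ?eqxx ?sp0l ?sp0r /= ?andbF ?andbT //.
  by rewrite eq_sym (negPf t0).
by have [->|st] := eqVneq s t; rewrite ?spss //=; case: (sp s t).
Qed.

Lemma span14 x : exists xI xR xL x0 x1 x2 xa b1 b2 xb c1 c2 xA xp,
  [/\ [/\ LineV (@OmI q) xI, LineV (@OmR q) xR & LineV (@OmL q) xL],
      [/\ LineV (@OmD q) x0, FamV (@OmD q) 1 dC x1 & FamV (@OmD q) 1 (- dC) x2],
      [/\ LineV (@OmC q) xa, FamV (@OmC q) 1 dC b1, FamV (@OmC q) 1 (- dC) b2 &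
          FamV (@OmC q) (-1) 0 xA],
      [/\ LineV (@OmN q) xb, FamV (@OmN q) (-1) dC c1, FamV (@OmN q) (-1) (- dC) c2 &
          FamV (@OmN q) 1 0 xp] &
      x = xI + (xR + (xL + (x0 + (x1 + (x2 + (xa + (b1 + (b2 + (xb + (c1 + (c2 + (xA + xp))))))))))))].
Proof.
have [xI [hI eI]] : exists x0, LineV (@OmI q) x0 /\ forall t s, co x0 t s = if OmI t s then co x t s else 0.
  by apply: line_span => t s s' /andP[_ /eqP ->] /andP[_ /eqP ->].
have [xR [hR eR]] : exists x0, LineV (@OmR q) x0 /\ forall t s, co x0 t s = if OmR t s then co x t s else 0.
  by apply: line_span => t s s' /andP[_ /eqP ->] /andP[_ /eqP ->].
have [xL [hL eL]] : exists x0, LineV (@OmL q) x0 /\ forall t s, co x0 t s = if OmL t s then co x t s else 0.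
  by apply: line_span => t s s' /andP[_ /eqP ->] /andP[_ /eqP ->].
have [|x0 [x1 [x2 [x3 [h0 h1 h2 h3 eD]]]]] := @block_span R q (@OmD q) 1 x; first by constructor 1.
have [|xa [b1 [b2 [xA [ha hb1 hb2 hA eC]]]]] := @block_span R q (@OmC q) 1 x; first by constructor 2.
have [|xb [c1 [c2 [xp [hb hc1 hc2 hp eN]]]]] := @block_span R q (@OmN q) (-1) x; first by constructor 3.
(* Over the identity the shift is trivial, so parity -1 leaves only 0. *)
have z3 : x3 = 0.
  apply: (FamV_eq0 _ h3) => t s /andP[/eqP t0 _]; have [_ e _ _] := h3 t.
  by have := e s; rewrite t0 padd0 mulN1r => /eqP; rewrite -addr_eq0 -mulr2n mulrn_eq0 => /eqP.
exists xI, xR, xL, x0, x1, x2, xa, b1, b2, xb, c1, c2, xA, xp.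
rewrite opprK in hp; split; [by []..|].
apply: co_inj => t s; rewrite !coD.
transitivity (co xI t s + co xR t s + co xL t s + (co x0 t s + co x1 t s + co x2 t s + co x3 t s)
  + (co xa t s + co b1 t s + co b2 t s + co xA t s) + (co xb t s + co c1 t s + co c2 t s + co xp t s)).
  rewrite eI eR eL eD eC eN; have [EI ER EL [ED EC EN]] := Om_excl t s.
  by case: (Om_cases t s) => [o|o|o|[o|o|o]]; rewrite o;
   [have [/negPf-> /negPf-> /negPf-> /negPf-> /negPf->] := EI o|have [/negPf-> /negPf-> /negPf-> /negPf-> /negPf->] := ER o
   |have [/negPf-> /negPf-> /negPf-> /negPf-> /negPf->] := EL o|have [/negPf-> /negPf-> /negPf-> /negPf-> /negPf->] := ED o
   |have [/negPf-> /negPf-> /negPf-> /negPf-> /negPf->] := EC o|have [/negPf-> /negPf-> /negPf-> /negPf-> /negPf->] := EN o];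
   rewrite ?addr0 ?add0r.
rewrite z3 co0; move: (co xI t s) (co xR t s) (co xL t s) (co x0 t s) (co x1 t s) (co x2 t s)
  (co xa t s) (co b1 t s) (co b2 t s) (co xA t s) (co xb t s) (co c1 t s) (co c2 t s) (co xp t s).
by move=> *; ring.
Qed.

(** The six supports are disjoint, so on each of them only its own components survive. *)
Lemma indep14 xI xR xL x0 x1 x2 xa b1 b2 xb c1 c2 xA xp :
  [/\ LineV (@OmI q) xI, LineV (@OmR q) xR & LineV (@OmL q) xL] ->
  [/\ LineV (@OmD q) x0, FamV (@OmD q) 1 dC x1 & FamV (@OmD q) 1 (- dC) x2] ->
  [/\ LineV (@OmC q) xa, FamV (@OmC q) 1 dC b1, FamV (@OmC q) 1 (- dC) b2 & FamV (@OmC q) (-1) 0 xA] ->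
  [/\ LineV (@OmN q) xb, FamV (@OmN q) (-1) dC c1, FamV (@OmN q) (-1) (- dC) c2 & FamV (@OmN q) 1 0 xp] ->
  xI + xR + xL + x0 + x1 + x2 + xa + b1 + b2 + xb + c1 + c2 + xA + xp = 0 ->
  [/\ [/\ xI = 0, xR = 0 & xL = 0], [/\ x0 = 0, x1 = 0 & x2 = 0],
      [/\ xa = 0, b1 = 0, b2 = 0 & xA = 0] & [/\ xb = 0, c1 = 0, c2 = 0 & xp = 0]].
Proof.
move=> [hI hR hL] [h0 h1 h2] [ha hb1 hb2 hA] [hb hc1 hc2 hp] e.
have L0 Om x t s : LineV Om x -> ~~ Om t s -> co x t s = 0.
  by case=> h hh /negPf n; rewrite hh n; exact: mul0r.
have F0 Om k mu x t s : FamV Om k mu x -> ~~ Om t s -> co x t s = 0.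
  by move=> h n; case: (h t) => /(_ s n).
have E t s : co xI t s + co xR t s + co xL t s + (co x0 t s + co x1 t s + co x2 t s)
  + (co xa t s + co b1 t s + co b2 t s + co xA t s) + (co xb t s + co c1 t s + co c2 t s + co xp t s) = 0.
  rewrite -[RHS](co0 R t s) -e !coD.
  move: (co xI t s) (co xR t s) (co xL t s) (co x0 t s) (co x1 t s) (co x2 t s)
    (co xa t s) (co b1 t s) (co b2 t s) (co xA t s) (co xb t s) (co c1 t s) (co c2 t s) (co xp t s).
  by move=> *; ring.
have zL Om x : LineV Om x -> (forall t s, Om t s -> co x t s = 0) -> x = 0.
  move=> h hz; apply: co_inj => t s; rewrite co0; case: (boolP (Om t s)) => [/hz //|n].
  exact: L0 h n.
split.
- split.
  + apply: (zL _ _ hI) => t s o; have := E t s; have [/(_ o)[n1 n2 n3 n4 n5] _ _ _] := Om_excl t s.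
    by rewrite (L0 _ _ _ _ hR) // (L0 _ _ _ _ hL) // (L0 _ _ _ _ h0) // (F0 _ _ _ _ _ _ h1) // (F0 _ _ _ _ _ _ h2) // (L0 _ _ _ _ ha) // (F0 _ _ _ _ _ _ hb1) // (F0 _ _ _ _ _ _ hb2) // (F0 _ _ _ _ _ _ hA) // (L0 _ _ _ _ hb) // (F0 _ _ _ _ _ _ hc1) // (F0 _ _ _ _ _ _ hc2) // (F0 _ _ _ _ _ _ hp) // !addr0.
  + apply: (zL _ _ hR) => t s o; have := E t s; have [_ /(_ o)[n1 n2 n3 n4 n5] _ _] := Om_excl t s.
    by rewrite (L0 _ _ _ _ hI) // (L0 _ _ _ _ hL) // (L0 _ _ _ _ h0) // (F0 _ _ _ _ _ _ h1) // (F0 _ _ _ _ _ _ h2) // (L0 _ _ _ _ ha) // (F0 _ _ _ _ _ _ hb1) // (F0 _ _ _ _ _ _ hb2) // (F0 _ _ _ _ _ _ hA) // (L0 _ _ _ _ hb) // (F0 _ _ _ _ _ _ hc1) // (F0 _ _ _ _ _ _ hc2) // (F0 _ _ _ _ _ _ hp) // !addr0 add0r.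
  + apply: (zL _ _ hL) => t s o; have := E t s; have [_ _ /(_ o)[n1 n2 n3 n4 n5] _] := Om_excl t s.
    by rewrite (L0 _ _ _ _ hI) // (L0 _ _ _ _ hR) // (L0 _ _ _ _ h0) // (F0 _ _ _ _ _ _ h1) // (F0 _ _ _ _ _ _ h2) // (L0 _ _ _ _ ha) // (F0 _ _ _ _ _ _ hb1) // (F0 _ _ _ _ _ _ hb2) // (F0 _ _ _ _ _ _ hA) // (L0 _ _ _ _ hb) // (F0 _ _ _ _ _ _ hc1) // (F0 _ _ _ _ _ _ hc2) // (F0 _ _ _ _ _ _ hp) // !addr0 add0r.
- have [t s o|-> -> -> _ //] := block_indep h0 h1 h2 (subspace0 (FamV_sub (@OmD q) 1 0)).
  have := E t s; have [_ _ _ [/(_ o)[n1 n2 n3 n4 n5] _ _]] := Om_excl t s.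
  by rewrite (L0 _ _ _ _ hI) // (L0 _ _ _ _ hR) // (L0 _ _ _ _ hL) // (L0 _ _ _ _ ha) // (F0 _ _ _ _ _ _ hb1) // (F0 _ _ _ _ _ _ hb2) // (F0 _ _ _ _ _ _ hA) // (L0 _ _ _ _ hb) // (F0 _ _ _ _ _ _ hc1) // (F0 _ _ _ _ _ _ hc2) // (F0 _ _ _ _ _ _ hp) // co0 !addr0 !add0r.
- apply: (block_indep ha hb1 hb2 hA) => t s o.
  have := E t s; have [_ _ _ [_ /(_ o)[n1 n2 n3 n4 n5] _]] := Om_excl t s.
  by rewrite (L0 _ _ _ _ hI) // (L0 _ _ _ _ hR) // (L0 _ _ _ _ hL) // (L0 _ _ _ _ h0) // (F0 _ _ _ _ _ _ h1) // (F0 _ _ _ _ _ _ h2) // (L0 _ _ _ _ hb) // (F0 _ _ _ _ _ _ hc1) // (F0 _ _ _ _ _ _ hc2) // (F0 _ _ _ _ _ _ hp) // !addr0 !add0r.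
- apply: (block_indep hb hc1 hc2 hp) => t s o.
  have := E t s; have [_ _ _ [_ _ /(_ o)[n1 n2 n3 n4 n5]]] := Om_excl t s.
  by rewrite (L0 _ _ _ _ hI) // (L0 _ _ _ _ hR) // (L0 _ _ _ _ hL) // (L0 _ _ _ _ h0) // (F0 _ _ _ _ _ _ h1) // (F0 _ _ _ _ _ _ h2) // (L0 _ _ _ _ ha) // (F0 _ _ _ _ _ _ hb1) // (F0 _ _ _ _ _ _ hb2) // (F0 _ _ _ _ _ _ hA) // !addr0 !add0r.
Qed.
End Main.

(** * Irreducible summands and the three decompositions *)

Section Irreducible.
Variable R : realType.
Variable q : nat.
Local Notation C := (Cx R).
Local Notation d := (Defs.dim q).
Local Notation dC := (d%:R : C).
Implicit Types (s t r u : pstr q) (x y : M2 R q).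

Lemma line_equivariant Om : [\/ Om = @OmI q, Om = @OmR q | Om = @OmL q] -> equivariant Om.
Proof.
move=> hO pi inj piD _.
have pi0 : pi (pid q) = pid q by rewrite -{1}(paddss (pid q)) piD paddss.
have pi0E s : (pi s == pid q) = (s == pid q) by rewrite -{1}pi0 (inj_eq inj).
by case: hO => -> t s; rewrite /OmI /OmR /OmL ?pi0E ?(inj_eq inj).
Qed.

Lemma irrep_id : irrep (@V_id R q).
Proof.
apply: (irrep_Line (@V_idP R q)); first by apply: line_equivariant; constructor 1.
  by move=> t s t' s' /andP[/eqP -> _] /andP[/eqP -> _].
by exists (pid q), (pid q); rewrite /OmI eqxx.
Qed.

Lemma irrep_r : (1 <= q)%N -> irrep (@V_r R q).
Proof.
move=> q1; have [t [s st]] := exN q1.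
apply: (irrep_Line (@V_rP R q)); first by apply: line_equivariant; constructor 2.
  by move=> ? ? ? ? /andP[/negPf -> _] /andP[/negPf -> _].
by exists t, (pid q); rewrite /OmR eqxx (sp_nz2 st).
Qed.

Lemma irrep_l : (1 <= q)%N -> irrep (@V_l R q).
Proof.
move=> q1; have [t [s st]] := exN q1.
apply: (irrep_Line (@V_lP R q)); first by apply: line_equivariant; constructor 3.
  by move=> ? ? ? ? /andP[/negPf -> _] /andP[/negPf -> _].
by exists t, t; rewrite /OmL eqxx (sp_nz2 st).
Qed.

Lemma irrep_line_good (V : Defs.space R q) Om :
  [\/ Om = @OmD q, Om = @OmC q | Om = @OmN q] -> (forall x, V x <-> LineV Om x) ->
  (exists t s, Om t s) -> irrep V.
Proof.
move=> gO VE o; apply: (irrep_Line VE) => //; first exact: good_equivariant.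
by move=> t s t' s'; apply: Om_nz_eq.
Qed.

Lemma irrep_0 : (1 <= q)%N -> irrep (@V_0 R q).
Proof.
move=> q1; have [t [s st]] := exN q1.
apply: (irrep_line_good _ (@V_0P R q)); first by constructor 1.
by exists (pid q), s; rewrite /OmD eqxx (sp_nz st).
Qed.

Lemma irrep_cbadj (V : Defs.space R q) : (1 <= q)%N ->
  (forall x, V x <-> LineV (@OmN q) x) -> irrep V.
Proof.
move=> q1 VE; have [t [s st]] := exN q1.
apply: (irrep_line_good _ VE); first by constructor 3.
by exists t, s; rewrite /OmN st (sp_nz2 st).
Qed.

Lemma irrep_bradj : (2 <= q)%N -> irrep (@V_bradj R q).
Proof.
move=> q2; have [t [t' [s [s' [tt' ss' st s't st']]]]] := ex2 q2.
apply: (irrep_line_good _ (@V_bradjP R q)); first by constructor 2.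
by exists t, s; apply: (ex2_OmC tt' ss' st); rewrite spC.
Qed.

Lemma dim_neq2 : (2 <= q)%N -> d != 2%N.
Proof. by move=> q2; rewrite /Defs.dim -{2}(expn1 2) eqn_exp2l // neq_ltn q2 orbT. Qed.
Lemma dim_neq4 : (3 <= q)%N -> d != 4%N.
Proof. by move=> q3; rewrite /Defs.dim -[4%N]/(2 ^ 2)%N eqn_exp2l // neq_ltn q3 orbT. Qed.

Lemma irrep_1 : (1 <= q)%N -> irrep (@V_1 R q).
Proof.
move=> q1; apply: (irrep_Fam (@V_1_FamV R q)); [by constructor 1|exact: conjc1|exact: dC_conj|].
by have := nz_D q1 (mulr1 (1 : C)) (or_intror erefl); rewrite (mul1r dC).
Qed.

Lemma irrep_2 : (2 <= q)%N -> irrep (@V_2 R q).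
Proof.
move=> q2; apply: (irrep_Fam (@V_2_FamV R q)); [by constructor 1|exact: conjc1|exact: NdC_conj|].
have := nz_D (ltnW q2) (etrans (mulrNN (1 : C) 1) (mulr1 1)) (or_introl (dim_neq2 q2)).
by rewrite (mulN1r dC).
Qed.

Lemma irrep_br1 : (2 <= q)%N -> irrep (@V_br1 R q).
Proof.
move=> q2; apply: (irrep_Fam (@V_br1_FamV R q)); [by constructor 2|exact: conjc1|exact: dC_conj|].
by have := nz_C q2 (mulr1 (1 : C)) (or_intror erefl); rewrite (mul1r dC).
Qed.

Lemma irrep_br2 : (3 <= q)%N -> irrep (@V_br2 R q).
Proof.
move=> q3; apply: (irrep_Fam (fun x => V_br2_FamV x (ltnW q3)));
  [by constructor 2|exact: conjc1|exact: NdC_conj|].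
have := nz_C (ltnW q3) (etrans (mulrNN (1 : C) 1) (mulr1 1)) (or_introl (dim_neq4 q3)).
by rewrite (mulN1r dC).
Qed.

Lemma irrep_cb1 (V : Defs.space R q) : (1 <= q)%N ->
  (forall x, V x <-> FamV (@OmN q) (-1) dC x) -> irrep V.
Proof.
move=> q1 VE; apply: (irrep_Fam VE); [by constructor 3|exact: N1_conj|exact: dC_conj|].
by have := nz_N q1 (mulr1 (1 : C)) (or_intror erefl); rewrite (mul1r dC).
Qed.

Lemma irrep_cb2 : (2 <= q)%N -> irrep (@V_cb2 R q).
Proof.
move=> q2; apply: (irrep_Fam (@V_cb2_FamV R q)); [by constructor 3|exact: N1_conj|exact: NdC_conj|].
have := nz_N (ltnW q2) (etrans (mulrNN (1 : C) 1) (mulr1 1)) (or_introl (dim_neq2 q2)).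
by rewrite (mulN1r dC).
Qed.

Lemma irrep_brA : (2 <= q)%N -> irrep (@V_brA R q).
Proof.
move=> q2; apply: (irrep_Fam (@V_brA_FamV R q)); [by constructor 2|exact: N1_conj|exact: conjc0|].
exact: nz_Codd.
Qed.

Lemma irrep_perp : (2 <= q)%N -> irrep (@V_cbadj_perp R q).
Proof.
move=> q2; apply: (irrep_Fam (@V_perp_FamV R q)); [by constructor 3|exact: conjc1|exact: conjc0|].
exact: nz_Neven.
Qed.

Lemma insum_cons (V : Defs.space R q) Vs x y : V x -> insum Vs y -> insum (V :: Vs) (x + y).
Proof. by exists x, y. Qed.

Lemma insum1 (V : Defs.space R q) x : V x -> insum [:: V] x.
Proof. by exists x, 0; rewrite addr0. Qed.

Lemma decomposition_intro (Vs : seq (Defs.space R q)) :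
  (forall n, (n < size Vs)%N -> irrep (nth (fun _ => False) Vs n)) ->
  (forall x, insum Vs x) ->
  (forall w : nat -> M2 R q, (forall n, (n < size Vs)%N -> nth (fun _ => False) Vs n (w n)) ->
     \sum_(i < size Vs) w i = 0 -> forall n, (n < size Vs)%N -> w n = 0) ->
  irrep_decomposition Vs.
Proof.
move=> irr span ind; split; last by move=> i; apply: irr.
by apply: direct_sum_intro => // n /irr[].
Qed.

Lemma decomposition3 : (3 <= q)%N -> irrep_decomposition
  [:: @V_id R q; @V_r R q; @V_l R q; @V_0 R q; @V_1 R q; @V_2 R q; @V_bradj R q;
      @V_br1 R q; @V_br2 R q; @V_cbadj R q; @V_cb1 R q; @V_cb2 R q; @V_brA R q;
      @V_cbadj_perp R q].
Proof.
move=> q3; have q2 := ltnW q3; have q1 := ltnW q2.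
apply: decomposition_intro.
- case=> [_|]; first exact: irrep_id.
  case=> [_|]; first exact: irrep_r.
  case=> [_|]; first exact: irrep_l.
  case=> [_|]; first exact: irrep_0.
  case=> [_|]; first exact: irrep_1.
  case=> [_|]; first exact: irrep_2.
  case=> [_|]; first exact: irrep_bradj.
  case=> [_|]; first exact: irrep_br1.
  case=> [_|]; first exact: irrep_br2.
  case=> [_|]; first exact: (irrep_cbadj q1 (@V_cbadjP R q)).
  case=> [_|]; first exact: (irrep_cb1 q1 (@V_cb1_FamV R q)).
  case=> [_|]; first exact: irrep_cb2.
  case=> [_|]; first exact: irrep_brA.
  case=> [_|]; first exact: irrep_perp.
  by [].
- move=> x; have [xI [xR [xL [x0 [x1 [x2 [xa [b1 [b2 [xb [c1 [c2 [xA [xp]]]]]]]]]]]]]] := span14 x.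
  move=> [[/V_idP hI /V_rP hR /V_lP hL] [/V_0P h0 /V_1_FamV h1 /V_2_FamV h2]].
  move=> [/V_bradjP ha /V_br1_FamV hb1 /(V_br2_FamV _ q2) hb2 /V_brA_FamV hA].
  move=> [/V_cbadjP hb /V_cb1_FamV hc1 /V_cb2_FamV hc2 /V_perp_FamV hp] ->.
  by do 13![apply: insum_cons => //]; apply: insum1.
move=> w hw; rewrite /= !big_ord_recr big_ord0 /= add0r => e.
have [||||[w0 w1 w2] [w3 w4 w5] [w6 w7 w8 w12] [w9 w10 w11 w13]] := indep14 _ _ _ _ e.
- by split; [apply/V_idP/(hw 0%N)|apply/V_rP/(hw 1%N)|apply/V_lP/(hw 2%N)].
- by split; [apply/V_0P/(hw 3%N)|apply/V_1_FamV/(hw 4%N)|apply/V_2_FamV/(hw 5%N)].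
- by split; [apply/V_bradjP/(hw 6%N)|apply/V_br1_FamV/(hw 7%N)|apply/(V_br2_FamV _ q2)/(hw 8%N)|
    apply/V_brA_FamV/(hw 12%N)].
- by split; [apply/V_cbadjP/(hw 9%N)|apply/V_cb1_FamV/(hw 10%N)|apply/V_cb2_FamV/(hw 11%N)|
    apply/V_perp_FamV/(hw 13%N)].
by do 14?[case=> [_ //|]].
Qed.

Lemma decomposition2 : q = 2%N -> irrep_decomposition
  [:: @V_id R q; @V_r R q; @V_l R q; @V_0 R q; @V_1 R q; @V_2 R q; @V_bradj R q;
      @V_br1 R q; @V_cbadj R q; @V_cb1 R q; @V_cb2 R q; @V_brA R q; @V_cbadj_perp R q].
Proof.
move=> eq2; have q2 : (2 <= q)%N by rewrite eq2.
have q1 := ltnW q2.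
apply: decomposition_intro.
- case=> [_|]; first exact: irrep_id.
  case=> [_|]; first exact: irrep_r.
  case=> [_|]; first exact: irrep_l.
  case=> [_|]; first exact: irrep_0.
  case=> [_|]; first exact: irrep_1.
  case=> [_|]; first exact: irrep_2.
  case=> [_|]; first exact: irrep_bradj.
  case=> [_|]; first exact: irrep_br1.
  case=> [_|]; first exact: (irrep_cbadj q1 (@V_cbadjP R q)).
  case=> [_|]; first exact: (irrep_cb1 q1 (@V_cb1_FamV R q)).
  case=> [_|]; first exact: irrep_cb2.
  case=> [_|]; first exact: irrep_brA.
  case=> [_|]; first exact: irrep_perp.
  by [].
- move=> x; have [xI [xR [xL [x0 [x1 [x2 [xa [b1 [b2 [xb [c1 [c2 [xA [xp]]]]]]]]]]]]]] := span14 x.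
  move=> [[/V_idP hI /V_rP hR /V_lP hL] [/V_0P h0 /V_1_FamV h1 /V_2_FamV h2]].
  move=> [/V_bradjP ha /V_br1_FamV hb1 hb2 /V_brA_FamV hA].
  move=> [/V_cbadjP hb /V_cb1_FamV hc1 /V_cb2_FamV hc2 /V_perp_FamV hp] ->.
  (* For two qubits [Ht] is d on the commuting fibres, so the part for - d is zero. *)
  have -> : b2 = 0.
    by apply: small_zero hb2 => [|t f s]; [constructor 2|exact: small_C].
  by rewrite add0r; do 12![apply: insum_cons => //]; apply: insum1.
move=> w hw; rewrite /= !big_ord_recr big_ord0 /= add0r => e.
(* The absent component enters the independence statement as 0. *)
have z8 : FamV (@OmC q) 1 (- dC) (0 : M2 R q) := subspace0 (FamV_sub _ _ _).
have [|||||[w0 w1 w2] [w3 w4 w5] [w6 w7 _ w11] [w8 w9 w10 w12]] :=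
  @indep14 R q (w 0%N) (w 1%N) (w 2%N) (w 3%N) (w 4%N) (w 5%N) (w 6%N) (w 7%N) 0
    (w 8%N) (w 9%N) (w 10%N) (w 11%N) (w 12%N).
- by split; [apply/V_idP/(hw 0%N)|apply/V_rP/(hw 1%N)|apply/V_lP/(hw 2%N)].
- by split; [apply/V_0P/(hw 3%N)|apply/V_1_FamV/(hw 4%N)|apply/V_2_FamV/(hw 5%N)].
- by split; [apply/V_bradjP/(hw 6%N)|apply/V_br1_FamV/(hw 7%N)|exact: z8|apply/V_brA_FamV/(hw 11%N)].
- by split; [apply/V_cbadjP/(hw 8%N)|apply/V_cb1_FamV/(hw 9%N)|apply/V_cb2_FamV/(hw 10%N)|
    apply/V_perp_FamV/(hw 12%N)].
- by rewrite addr0.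
by do 13?[case=> [_ //|]].
Qed.

Lemma V_cbS_FamV x : q = 1%N -> V_cbS x <-> FamV (@OmN q) (-1) dC x.
Proof. by move=> q1; rewrite V_cbSP ParV_N1. Qed.

Lemma V_cbA_LineV x : q = 1%N -> V_cbA x <-> LineV (@OmN q) x.
Proof. by move=> q1; rewrite V_cbAP ParV_N1_line. Qed.

Lemma decomposition1 : q = 1%N -> irrep_decomposition
  [:: @V_id R q; @V_r R q; @V_l R q; @V_0 R q; @V_1 R q; @V_cbS R q; @V_cbA R q].
Proof.
move=> eq1; have q1 : (1 <= q)%N by rewrite eq1.
have SP x := V_cbS_FamV x eq1; have AP x := V_cbA_LineV x eq1.
apply: decomposition_intro.
- case=> [_|]; first exact: irrep_id.
  case=> [_|]; first exact: irrep_r.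
  case=> [_|]; first exact: irrep_l.
  case=> [_|]; first exact: irrep_0.
  case=> [_|]; first exact: irrep_1.
  case=> [_|]; first exact: (irrep_cb1 q1 SP).
  case=> [_|]; first exact: (irrep_cbadj q1 AP).
  by [].
- move=> x; have [xI [xR [xL [x0 [x1 [x2 [xa [b1 [b2 [xb [c1 [c2 [xA [xp]]]]]]]]]]]]]] := span14 x.
  move=> [[/V_idP hI /V_rP hR /V_lP hL] [/V_0P h0 /V_1_FamV h1 h2]].
  move=> [ha hb1 hb2 hA] [/AP hb /SP hc1 hc2 hp] ->.
  have zC Om e mu (y : M2 R q) : FamV Om e mu y -> (forall t s, Om t s = false) -> y = 0.
    by move=> h n; apply: (FamV_eq0 _ h) => t s; rewrite n.
  (* One qubit has no distinct nontrivial commuting strings, so the components over [OmC] vanish. *)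
  have C0 t s : OmC t s = false := OmC1 t s eq1.
  have -> : xa = 0.
    apply: co_inj => t s; rewrite co0; have [k ->] := ha; rewrite C0; exact: mul0r.
  rewrite (zC _ _ _ _ hb1 C0) (zC _ _ _ _ hb2 C0) (zC _ _ _ _ hA C0) (perp_zero1 eq1 hp).
  have -> : x2 = 0.
    by apply: small_zero h2 => [|t f s]; [constructor 1|exact: small_D].
  have -> : c2 = 0.
    by apply: small_zero hc2 => [|t f s]; [constructor 3|exact: small_N].
  rewrite !add0r !addr0 (addrC xb).
  by do 6![apply: insum_cons => //]; apply: insum1.
move=> w hw; rewrite /= !big_ord_recr big_ord0 /= add0r => e.
have z Om (k mu : C) : FamV Om k mu (0 : M2 R q) := subspace0 (FamV_sub _ _ _).
(* [w 6] precedes [w 5]: [V_cbA] holds the constant functions, [V_cbS] the odd ones. *)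
have [|||||[w0 w1 w2] [w3 w4 _] _ [w6 w5 _ _]] :=
  @indep14 R q (w 0%N) (w 1%N) (w 2%N) (w 3%N) (w 4%N) 0 0 0 0 (w 6%N) (w 5%N) 0 0 0.
- by split; [apply/V_idP/(hw 0%N)|apply/V_rP/(hw 1%N)|apply/V_lP/(hw 2%N)].
- by split; [apply/V_0P/(hw 3%N)|apply/V_1_FamV/(hw 4%N)|exact: z].
- by split; [exact: subspace0 (LineV_sub _ _)|exact: z..].
- by split; [apply/AP/(hw 6%N)|apply/SP/(hw 5%N)|exact: z..].
- by rewrite !addr0 addrAC.
by do 7?[case=> [_ //|]].
Qed.
End Irreducible.

Theorem theorem1 (R : realType) (q : nat) (hq : (1 <= q)%N) :
  (q = 1%N ->
     irrep_decomposition
       [:: @V_id R q; @V_r R q; @V_l R q; @V_0 R q; @V_1 R q; @V_cbS R q; @V_cbA R q])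
  /\ (q = 2%N ->
     irrep_decomposition
       [:: @V_id R q; @V_r R q; @V_l R q; @V_0 R q; @V_1 R q; @V_2 R q; @V_bradj R q;
           @V_br1 R q; @V_cbadj R q; @V_cb1 R q; @V_cb2 R q; @V_brA R q; @V_cbadj_perp R q])
  /\ ((3 <= q)%N ->
     irrep_decomposition
       [:: @V_id R q; @V_r R q; @V_l R q; @V_0 R q; @V_1 R q; @V_2 R q; @V_bradj R q;
           @V_br1 R q; @V_br2 R q; @V_cbadj R q; @V_cb1 R q; @V_cb2 R q; @V_brA R q;
           @V_cbadj_perp R q]).
Proof.
split; first exact: decomposition1.
by split; [exact: decomposition2|exact: decomposition3].
Qed.
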